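(* Let $g\ge5$ be odd, let $C$ be the rosary of genus $g$, canonically embedded in $\mathbb{P}\mathrm{H}^0(C,\omega_C)\cong\mathbb{P}^{g-1}$, and let $m\ge2$. Then the $m$-th Hilbert point $[C]_m$ is semistable if and only if $g\le 2m+1$.
   Context: The rosary of genus $g$ is obtained from $g-1$ copies $P_i$ of $\mathbb{P}^1$, $i\in\mathbb{Z}/(g-1)$, with coordinate $u_i$ at $0$ and $v_i=1/u_i$ at $\infty$, by gluing $\infty\in P_i$ to $0\in P_{i+1}$ into a tacnode with local ring consisting of pairs of germs $(f(v_i),h(u_{i+1}))$ with $f(0)=h(0)$, $f'(0)=h'(0)$; its dualizing sheaf $\omega_C$ is very ample for odd $g\ge5$ and $\operatorname{Sym}^m\mathrm{H}^0(\omega_C)\to\mathrm{H}^0(\omega_C^m)$ is surjective. The $m$-th Hilbert point of $X\subset\mathbb{P}V$ is the point of $\mathbb{P}(\bigwedge^{N_m}\mathrm{H}^0(\mathbb{P}V,\mathcal{O}(m))^\vee)$ dual to the top wedge power of the restriction map, $N_m=h^0(X,\mathcal{O}_X(m))$; semistable means $0$ is not in the closure of the $\mathrm{SL}(V)$-orbit of a lift. *)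

(* Defs.v *)
From HB Require Import structures.
From mathcomp Require Import all_boot all_order all_algebra.
Set Implicit Arguments. Unset Strict Implicit. Unset Printing Implicit Defensive.
Import Order.TTheory GRing.Theory Num.Theory.
Local Open Scope ring_scope.

Section Rosary.
Variable F : fieldType.

(* Sections of the dualizing sheaf of the rosary of genus g.           *)
(* Components P_i, i : 'I_(g-1), successor i+1 = ordS i (cyclic).      *)
(* A global section of omega_C is a tuple of meromorphic differentials *)
(* eta_i on the normalization P_i with poles of order <= 2 at 0 and oo *)
(* (the conductor of a tacnode bounds the poles), i.e.                 *)
(*   eta_i = (a_i u_i^-2 + b_i u_i^-1 + c_i) du_i ,                    *)
(* stored as the row i of a matrix eta : 'M_(g-1,3) = (a_i, b_i, c_i), *)
(* subject to Rosenlicht's condition at every tacnode p_i (oo in P_i   *)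
(* glued to 0 in P_(i+1)):  res_{v_i=0}(f eta_i) + res_{u=0}(h eta_(i+1)) = 0 *)
(* for every (f,h) in O_{p_i}.  Since poles have order <= 2 only the   *)
(* common 1-jet (s,t) = (f(0),f'(0)) = (h(0),h'(0)) matters; in the    *)
(* coordinate v = 1/u, eta_i = -(c_i v^-2 + b_i v^-1 + a_i) dv, so     *)
(*   res(f eta_i) = -(c_i t + b_i s),  res(h eta_(i+1)) = a_(i+1) t + b_(i+1) s. *)
Definition c0 : 'I_3 := @Ordinal 3 0 isT.
Definition c1 : 'I_3 := @Ordinal 3 1 isT.
Definition c2 : 'I_3 := @Ordinal 3 2 isT.

Definition res_inf n (eta : 'M[F]_(n,3)) (i : 'I_n) (s t : F) : F :=
  - (eta i c2 * t + eta i c1 * s).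
Definition res_zero n (eta : 'M[F]_(n,3)) (i : 'I_n) (s t : F) : F :=
  eta i c0 * t + eta i c1 * s.

Definition is_omega n (eta : 'M[F]_(n,3)) : Prop :=
  forall (i : 'I_n) (s t : F), res_inf eta i s t + res_zero eta (ordS i) s t = 0.

(* B is a basis of H^0(C, omega_C) (C of genus g has g-1 components). *)
Definition omega_basis g (B : 'I_g -> 'M[F]_(g.-1,3)) : Prop :=
  [/\ forall j, is_omega (B j),
      forall lam : 'I_g -> F, \sum_j lam j *: B j = 0 -> forall j, lam j = 0 &
      forall eta, is_omega eta -> exists lam : 'I_g -> F, eta = \sum_j lam j *: B j].

(* Canonical map on the chart u_i <> oo of P_i, trivialising omega by  *)
(* du_i/u_i^2: the j-th homogeneous coordinate is u^2 eta^(j)_i / du.   *)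
Definition cpoly g (B : 'I_g -> 'M[F]_(g.-1,3)) (j : 'I_g) (i : 'I_g.-1) : {poly F} :=
  (B j i c0)%:P + (B j i c1) *: 'X + (B j i c2) *: 'X^2.

Definition Mon (g m : nat) : finType :=
  {e : {ffun 'I_g -> 'I_m.+1} | \sum_j (e j : nat) == m}.

(* A form is its coefficient vector f : Mon g m -> F.                    *)
(* f vanishes on the canonical image of C (a reduced curve, so this is  *)
(* the kernel of H^0(P^(g-1),O(m)) -> H^0(C,O_C(m))): it vanishes on   *)
(* every component (the point oo of P_i is the point 0 of P_(i+1)).    *)
Definition vanishes_on_C g m (B : 'I_g -> 'M[F]_(g.-1,3)) (f : Mon g m -> F) : Prop :=
  forall i : 'I_g.-1,
    \sum_(e : Mon g m) f e *: \prod_(j : 'I_g) (cpoly B j i) ^+ (val e j : nat) = 0.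

(* Action of A in 'M_g on forms: coefficient of x^e' in the monomial   *)
(* (A x)^e = prod_j (sum_k A j k x_k)^(e j).                             *)
Definition word g m (e : Mon g m) : seq 'I_g :=
  flatten [seq nseq (val e j : nat) j | j <- enum 'I_g].

Definition symcoef g m (A : 'M[F]_g) (e' e : Mon g m) : F :=
  \sum_(tau : m.-tuple 'I_g | [forall k, count_mem k tau == (val e' k : nat)])
     \prod_(jk <- zip (word e) tau) A jk.1 jk.2.

(* Plucker coordinates of the Hilbert point: for a linear map R (rows    *)
(* R i : forms -> F) representing the restriction map, the coordinate   *)
(* of the basis element e_T of /\^N Sym^m indexed by the N-subset T of  *)
(* monomials (listed increasingly as kappa) is the minor det R|_T.     *)
Definition increasing g m N (kappa : {ffun 'I_N -> Mon g m}) : bool :=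
  [forall k1 : 'I_N, forall k2 : 'I_N,
     (k1 < k2)%N ==> (enum_rank (kappa k1) < enum_rank (kappa k2))%N].

Definition pluecker g m N (R : 'I_N -> Mon g m -> F)
    (kappa : {ffun 'I_N -> Mon g m}) : F :=
  if increasing kappa then \det (\matrix_(i < N, k < N) R i (kappa k)) else 0.

(* The lift acted on by A in SL(V): the restriction map precomposed with *)
(* the substitution f |-> f o A on forms.                                 *)
Definition actR g m N (A : 'M[F]_g) (R : 'I_N -> Mon g m -> F) : 'I_N -> Mon g m -> F :=
  fun i e => \sum_(e' : Mon g m) R i e' * symcoef A e' e.

Inductive polyfun (D : finType) : ((D -> F) -> F) -> Prop :=
| pf_const (c : F) : polyfun (fun _ => c)
| pf_coord (d : D) : polyfun (fun x => x d)
| pf_add p q : polyfun p -> polyfun q -> polyfun (fun x => p x + q x)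
| pf_mul p q : polyfun p -> polyfun q -> polyfun (fun x => p x * q x).

Definition zero_in_orbit_closure g m N (R : 'I_N -> Mon g m -> F) : Prop :=
  forall P : ({ffun 'I_N -> Mon g m} -> F) -> F, polyfun P ->
    (forall A : 'M[F]_g, \det A = 1 -> P (pluecker (actR A R)) = 0) ->
    P (fun _ => 0) = 0.

(* R represents the restriction map H^0(P V, O(m)) -> H^0(C, O_C(m)) :  *)
(* its rows are linearly independent and its kernel is the space of     *)
(* degree-m forms vanishing on C (so N = N_m).                           *)
Definition represents_restriction g m (B : 'I_g -> 'M[F]_(g.-1,3)) N
    (R : 'I_N -> Mon g m -> F) : Prop :=
  (forall lam : 'I_N -> F, (forall e, \sum_i lam i * R i e = 0) -> forall i, lam i = 0)
  /\ (forall f : Mon g m -> F, (forall i, \sum_e R i e * f e = 0) <-> vanishes_on_C B f).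

Definition hilbert_point_semistable g m (B : 'I_g -> 'M[F]_(g.-1,3)) : Prop :=
  forall N (R : 'I_N -> Mon g m -> F),
    represents_restriction B R -> ~ zero_in_orbit_closure R.

End Rosary.

(* Main.v *)
(* Semistability. If 0 lies in the Zariski closure of the orbit, a place of the function field of SL_g *)
(* carries the generic matrix A to the unstable point. Writing A = L^-1 D k with D diagonal and L, k *)
(* invertible over the valuation ring, the reduction of k together with the values of D (made rational *)
(* by Fourier-Motzkin elimination) is a weighted basis of V with respect to which all nonzero Pluecker *)
(* coordinates have positive weight. As in Kempf's theorem, a weighted filtration of minimal norm among *)
(* those is unique, hence stable under the stabiliser of the Hilbert point. The rosary has an *)
(* automorphism, a twisted rotation, with distinct eigenvalues on H^0(omega), so some weights on its *)
(* eigenbasis y, w_a, w'_b destabilise. This is contradicted by exhibiting, for any weights, a monomial *)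
(* basis of H^0(C, O(m)) in the eigenbasis of nonpositive centered weight: one of low y-degree *)
(* 2l(m-1), or one of high y-degree 2l(m-1)^2 + 2, where g = 2l + 1; the former y-degree is at most *)
(* the average exactly when l <= m. If l > m, every monomial basis has y-degree at least 2l(m-1), and *)
(* the one-parameter subgroup scaling y destabilises. *)
Require Import Defs.
From HB Require Import structures.
From mathcomp Require Import all_boot all_order all_algebra.
From mathcomp Require Import all_fingroup cyclic separable cyclotomic.
From mathcomp Require Import ring lra zify mpoly.
From mathcomp Require boolp classical_sets.
Set Implicit Arguments. Unset Strict Implicit. Unset Printing Implicit Defensive.
Import Order.TTheory GRing.Theory Num.Theory.
Local Open Scope ring_scope.

(** * Monomials and substitutions *)

(** Write g = 2l + 1 and let z be a primitive l-th root of unity. In the eigenbasis y, w_a, w'_b (a,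
    b in Z/l) every monomial restricts to each component as a multiple of a power of u. Its order r
    and its character s cut H^0(C, O(m)) into blocks, of dimension 1 for r = 0, 1, 2m-1, 2m and of
    dimension 2 otherwise. Hence N = 2l(2m-1), and a family of monomials is a basis once it has the
    right number of members in each block, with distinct values of z^alpha in the blocks of
    dimension 2 ([vanishes_rows], [section_basis_minor]).

    Instability for l > m: the y-exponent of a monomial has the parity of r, so every monomial basis
    has y-degree at least 2l(m-1) ([y_degree_bound]). This exceeds the average mN/g, and the
    subgroup scaling y drives the Hilbert point to 0 ([unstable_high_genus]).

    Semistability for l <= m: by [multiplicity_free_criterion] it is enough to test the torus of the
    eigenbasis. Indeed a place of the function field yields a destabilising weighted basis
    ([destabilizing_weights]). One of minimal norm exists, and its filtration is preserved by the
    twisted rotation ([optimal_exists], [optimal_invariant]). The eigenvalues of the rotation are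
    distinct, so the filtration is adapted to the eigenbasis ([eigenbasis_destabilized]). On the
    other hand, for any weights [low_weight_basis_exists] produces a monomial basis of nonpositive
    centered weight. The weight of a word splits into a multiple of its y-degree, a term odd under r
    -> 2m - r, and a deviation of its letters from their means ([choice_weight]). A basis of high or
    of low y-degree is taken according to the sign of the first factor, and letters of least weight
    keep the total deviation nonpositive. *)

Section MonomialsOfTuples.
Variables (g m : nat).
Implicit Types (t : m.-tuple 'I_g) (e : Mon g m).

Definition tuple_content t : {ffun 'I_g -> 'I_m.+1} :=
  [ffun j => inord (count_mem j t)].

Lemma tuple_contentE t j : tuple_content t j = count_mem j t :> nat.
Proof. by rewrite ffunE inordK // ltnS -[X in (_ <= X)%N](size_tuple t) count_size. Qed.

Lemma sum_count_mem (s : seq 'I_g) (f : 'I_g -> nat) :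
  (\sum_j count_mem j s * f j = \sum_(j <- s) f j)%N.
Proof.
elim: s => [|x s IH]; first by rewrite big_nil big1.
rewrite big_cons -IH /= (bigD1 x) //= eqxx mulnDl mul1n -addnA; congr (_ + _)%N.
rewrite [in RHS](bigD1 x) //=; congr (_ + _)%N; apply: eq_bigr => j /negPf jx.
by rewrite eq_sym jx.
Qed.

Lemma tuple_content_subproof t : \sum_j (tuple_content t j : nat) == m.
Proof.
rewrite (eq_bigr (fun j => (count_mem j t * 1)%N)); last first.
  by move=> j _; rewrite tuple_contentE muln1.
by rewrite sum_count_mem sum1_size size_tuple.
Qed.

Definition expo e (j : 'I_g) : nat := val e j.

Definition tmon t : Mon g m := Sub (tuple_content t) (tuple_content_subproof t).

Lemma tmonE t j : expo (tmon t) j = count_mem j t.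
Proof. exact: tuple_contentE. Qed.

Lemma tmon_eqP t e :
  (tmon t == e) = [forall k, count_mem k t == expo e k].
Proof.
apply/eqP/forallP => [<- k|H]; first by rewrite tmonE.
by apply/val_inj/ffunP => k; apply/val_inj; rewrite /= tuple_contentE (eqP (H k)).
Qed.

Lemma count_word e k : count_mem k (word e) = expo e k.
Proof.
rewrite /word count_flatten -map_comp sumnE big_map big_enum /=.
rewrite (bigD1 k) //= count_nseq /= eqxx mul1n big1 ?addn0 // => j jk.
by rewrite count_nseq /= (negPf jk) mul0n.
Qed.

Lemma size_word e : size (word e) == m.
Proof.
apply/eqP; rewrite -sum1_size -sum_count_mem -[RHS](eqP (valP e)).
by apply: eq_bigr => j _; rewrite count_word muln1.
Qed.

Definition tword e : m.-tuple 'I_g := Tuple (size_word e).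

Lemma twordK : cancel tword tmon.
Proof. by move=> e; apply/eqP; rewrite tmon_eqP; apply/forallP => k; rewrite count_word. Qed.

Lemma tmon_perm t t' : tmon t = tmon t' -> exists s : 'S_m, t' = [tuple tnth t (s i) | i < m].
Proof.
move=> tt'; have /tuple_permP [s Hs] : perm_eq t' t.
  by apply/allP => x _ /=; rewrite -!tmonE tt'.
by exists s; apply/val_inj.
Qed.

Lemma tmon_eq_perm t t' : perm_eq t t' -> tmon t = tmon t'.
Proof.
move=> /seq.permP tt'; apply/eqP; rewrite tmon_eqP; apply/forallP => k.
by rewrite tmonE tt'.
Qed.

Lemma prod_tmon (R : comNzRingType) (x : 'I_g -> R) t :
  \prod_j x j ^+ expo (tmon t) j = \prod_(i < m) x (tnth t i).
Proof.
rewrite -(big_tuple _ _ t predT x).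
under eq_bigr do rewrite tmonE.
elim: (tval t) => [|a s IH]; first by rewrite big_nil big1.
rewrite big_cons -IH /= (bigD1 a) //= eqxx add1n exprS -mulrA; congr (_ * _).
rewrite [in RHS](bigD1 a) //=; congr (_ * _); apply: eq_bigr => j /negPf ja.
by rewrite eq_sym ja.
Qed.

Lemma sum_tmon (V : nmodType) (x : 'I_g -> V) t :
  \sum_j x j *+ expo (tmon t) j = \sum_(j <- t) x j.
Proof.
under eq_bigr do rewrite tmonE.
elim: (tval t) => [|a s IH]; first by rewrite big_nil big1.
rewrite big_cons -IH /= (bigD1 a) //= eqxx add1n mulrS -addrA; congr (_ + _).
rewrite [in RHS](bigD1 a) //=; congr (_ + _); apply: eq_bigr => j /negPf ja.
by rewrite eq_sym ja.
Qed.

End MonomialsOfTuples.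

Section Substitution.
Variables (K : fieldType) (g m : nat).
Implicit Types (A B : 'M[K]_g) (e : Mon g m) (t : m.-tuple 'I_g).

Definition tcoef A t t' : K := \prod_(i < m) A (tnth t i) (tnth t' i).

Lemma prod_zip_tuple A t t' :
  \prod_(jk <- zip t t') A jk.1 jk.2 = tcoef A t t'.
Proof.
rewrite /tcoef; have -> : zip t t' = zip_tuple t t' by [].
rewrite big_tuple; apply: eq_bigr => i _.
by rewrite !(tnth_nth (tnth t i, tnth t' i)) /= nth_zip ?size_tuple //= -!tnth_nth.
Qed.

Lemma symcoefE A e' e :
  symcoef A e' e = \sum_(t | tmon t == e') tcoef A (tword e) t.
Proof.
rewrite /symcoef; apply: eq_big => [t|t _]; first by rewrite tmon_eqP.
exact: (prod_zip_tuple A (tword e) t).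
Qed.

(** Permuting the letters of both words simultaneously does not change the product, so any word
    spelling the monomial may replace the canonical one. *)
Lemma symcoef_tmon A e' t :
  symcoef A e' (tmon t) = \sum_(t' | tmon t' == e') tcoef A t t'.
Proof.
rewrite symcoefE; have /tmon_perm [s ->] : tmon t = tmon (tword (tmon t)) by rewrite twordK.
rewrite (reindex (fun t' : m.-tuple 'I_g => [tuple tnth t' (s i) | i < m])) /=; last first.
  exists (fun t' : m.-tuple 'I_g => [tuple tnth t' ((s^-1)%g i) | i < m]) => u _;
    apply: eq_from_tnth => i; by rewrite !tnth_mktuple ?permK ?permKV.
apply: eq_big => u.
  by congr (_ == _); apply/tmon_eq_perm; apply/tuple_permP; exists s.
move=> _; rewrite /tcoef [in RHS](reindex_inj (@perm_inj _ s)) /=.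
by apply: eq_bigr => i _; rewrite !tnth_mktuple.
Qed.

Lemma sum_tuple_distr (R : comNzRingType) (f : 'I_m -> 'I_g -> R) :
  \prod_(i < m) \sum_k f i k = \sum_(t : m.-tuple 'I_g) \prod_(i < m) f i (tnth t i).
Proof.
rewrite bigA_distr_bigA /= (reindex (fun t : m.-tuple 'I_g => [ffun i => tnth t i])).
  by apply: eq_bigr => t _; apply: eq_bigr => i _; rewrite ffunE.
exists (fun f : {ffun 'I_m -> 'I_g} => [tuple f i | i < m]) => u _.
  by apply: eq_from_tnth => i; rewrite tnth_mktuple ffunE.
by apply/ffunP => i; rewrite ffunE tnth_mktuple.
Qed.

Lemma symcoef_mul A B e'' e :
  symcoef (A *m B) e'' e = \sum_e' symcoef B e'' e' * symcoef A e' e.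
Proof.
rewrite symcoefE.
transitivity (\sum_t' tcoef A (tword e) t' * symcoef B e'' (tmon t')).
  under [RHS]eq_bigr => t' _ do rewrite symcoef_tmon mulr_sumr.
  rewrite exchange_big /=; apply: eq_bigr => t _.
  transitivity (\prod_(i < m) \sum_k A (tnth (tword e) i) k * B k (tnth t i)).
    by apply: eq_bigr => i _; rewrite mxE.
  rewrite sum_tuple_distr; apply: eq_bigr => t' _.
  by rewrite -big_split.
rewrite (partition_big (@tmon g m) predT) //=; apply: eq_bigr => e' _.
rewrite (symcoefE A) mulr_sumr; apply: eq_bigr => t' /eqP ->.
by rewrite mulrC.
Qed.

Lemma symcoef_diag (d : 'rV[K]_g) e' e :
  symcoef (diag_mx d) e' e = (\prod_j d 0 j ^+ expo e j) *+ (e' == e).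
Proof.
rewrite symcoefE; have H t : t != tword e -> tcoef (diag_mx d) (tword e) t = 0.
  move=> ne; apply/eqP; rewrite /tcoef prodf_seq_eq0; apply: contraR ne => /hasPn H.
  apply/eqP/eq_from_tnth => i; apply/eqP.
  move: (H i); rewrite mem_index_enum mxE /= => /(_ isT).
  apply: contraR => ne; rewrite eq_sym in ne; move: ne => /negPf ne; by rewrite ne mulr0n eqxx.
case: eqP => [->|ne].
  rewrite (bigD1 (tword e)) ?twordK //= big1 ?addr0; last by move=> t /andP[_ /H].
  rewrite mulr1n -[in RHS](twordK e) prod_tmon; apply: eq_bigr => i _.
  by rewrite mxE eqxx mulr1n.
rewrite big1 // => t /eqP te; apply: H; apply/eqP => te'.
by apply: ne; rewrite -te te' twordK.
Qed.

Lemma symcoef1 e' e : symcoef (1%:M : 'M[K]_g) e' e = (e' == e)%:R.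
Proof.
rewrite -diag_const_mx symcoef_diag big1 // => j _.
by rewrite mxE expr1n.
Qed.

Lemma symcoef_neq0 A e' e : symcoef A e' e != 0 ->
  exists t : m.-tuple 'I_g, tmon t = e' /\ forall i, A (tnth (tword e) i) (tnth t i) != 0.
Proof.
rewrite symcoefE => H.
have [t /andP[/eqP te] Ht] : exists t, (tmon t == e') && (tcoef A (tword e) t != 0).
  apply/existsP; apply: contraR H => /existsPn H; apply/eqP/big1 => t te.
  by move: (H t); rewrite te negbK => /eqP.
exists t; split=> // i; apply: contraNneq Ht => Hi.
by rewrite /tcoef (bigD1 i) //= Hi mul0r.
Qed.

(* [symcoef A] is the matrix of [f |-> f o A] on forms of degree m. *)
Lemma subst_monomial (R : comNzRingType) (phi : {rmorphism K -> R}) A (x : 'I_g -> R) e :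
  \prod_j (\sum_k phi (A j k) * x k) ^+ expo e j =
  \sum_e' phi (symcoef A e' e) * \prod_k x k ^+ expo e' k.
Proof.
rewrite -{1}(twordK e) prod_tmon sum_tuple_distr.
rewrite (partition_big (@tmon g m) predT) //=; apply: eq_bigr => e' _.
rewrite symcoefE rmorph_sum mulr_suml; apply: eq_bigr => t /eqP <-.
by rewrite big_split prod_tmon rmorph_prod.
Qed.

End Substitution.

(** * Minors of the restriction map *)

Section Minors.
Variables (K : fieldType) (g m N : nat).
Implicit Types (R : 'I_N -> Mon g m -> K) (A B : 'M[K]_g) (kappa : {ffun 'I_N -> Mon g m}).

(** Defined for all maps [kappa], not only the increasing ones, so that expansions need no sorting;
    [minor_perm] and [injective_sort] lead back to Plücker coordinates up to sign. *)
Definition minor R kappa : K := \det (\matrix_(i < N, k < N) R i (kappa k)).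

Lemma eq_minor R R' kappa : R =2 R' -> minor R kappa = minor R' kappa.
Proof. by move=> RR'; congr (\det _); apply/matrixP => i k; rewrite !mxE RR'. Qed.

(** A form of Cauchy-Binet over all maps f, with products of entries in place of the minors of the
    substitution matrix. The later arguments ask which summands survive and what value they have, so
    repetitions do no harm. *)
Lemma minor_actR A R kappa : minor (actR A R) kappa =
  \sum_(f : {ffun 'I_N -> Mon g m}) minor R f * \prod_k symcoef A (f k) (kappa k).
Proof.
rewrite /minor -det_tr /determinant.
under eq_bigr => s _.
  under eq_bigr => k _ do rewrite !mxE.
  rewrite /actR bigA_distr_bigA mulr_sumr /=.
  under eq_bigr => f _ do rewrite big_split /= mulrA.
  over.
rewrite exchange_big; apply: eq_bigr => f _ /=.
rewrite -mulr_suml; congr (_ * _); rewrite -[RHS]det_tr.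
by apply: eq_bigr => s _; congr (_ * _); apply: eq_bigr => k _; rewrite !mxE.
Qed.

Lemma actR_mul A B R : actR (A *m B) R =2 actR A (actR B R).
Proof.
move=> i e; rewrite /actR.
under eq_bigr => e'' _ do rewrite symcoef_mul mulr_sumr.
rewrite exchange_big /=; apply: eq_bigr => e' _; rewrite mulr_suml.
by apply: eq_bigr => e'' _; rewrite mulrA.
Qed.

Lemma eq_actR A R R' : R =2 R' -> actR A R =2 actR A R'.
Proof. by move=> RR' i e; apply: eq_bigr => e' _; rewrite RR'. Qed.

Lemma actR_diag (d : 'rV[K]_g) R i e :
  actR (diag_mx d) R i e = R i e * \prod_j d 0 j ^+ expo e j.
Proof.
rewrite /actR (bigD1 e) //= symcoef_diag eqxx mulr1n [X in _ + X]big1 ?addr0 // => e' /negPf ee'.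
by rewrite symcoef_diag ee' mulr0n mulr0.
Qed.

Lemma actR1 R : actR 1%:M R =2 R.
Proof.
move=> i e; rewrite -diag_const_mx actR_diag big1 ?mulr1 // => j _.
by rewrite mxE expr1n.
Qed.

Lemma minor_diag (d : 'rV[K]_g) R kappa : minor (actR (diag_mx d) R) kappa =
  minor R kappa * \prod_k \prod_j d 0 j ^+ expo (kappa k) j.
Proof.
rewrite /minor -det_tr -[in RHS]det_tr /determinant mulr_suml.
apply: eq_bigr => s _; rewrite -mulrA; congr (_ * _); rewrite -big_split /=.
by apply: eq_bigr => k _; rewrite !mxE actR_diag.
Qed.

Lemma minor_perm R kappa (s : 'S_N) :
  minor R [ffun k => kappa (s k)] = (-1) ^+ s * minor R kappa.
Proof.
rewrite -odd_permV -det_perm mulrC -det_mulmx -col_permE; congr (\det _).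
by apply/matrixP => i k; rewrite !mxE ffunE.
Qed.

Lemma minor_inj R kappa : minor R kappa != 0 -> injective kappa.
Proof.
move=> nz k1 k2 k12; apply/eqP; apply: contraNT nz => nek.
rewrite /minor -det_tr (determinant_alternate nek) // => j.
by rewrite !mxE k12.
Qed.

Lemma injective_sort kappa : injective kappa ->
  exists s : 'S_N, increasing [ffun k => kappa (s k)].
Proof.
move=> kinj.
pose t := [tuple kappa k | k < N]; pose rk := @enum_rank (Mon g m).
pose t' := sort_tuple (relpre rk (fun x y => x <= y)%N) t.
have /tuple_permP [s Hs] : perm_eq t' t by rewrite perm_sort.
have nthE k : tnth t' k = kappa (s k).
  by rewrite (_ : t' = [tuple tnth t (s i) | i < N]) ?tnth_mktuple //; apply/val_inj.
have st : sorted (relpre rk (fun x y => x <= y)%N) t'.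
  by apply: sort_sorted => x y; exact: leq_total.
exists s; apply/forallP => k1; apply/forallP => k2; apply/implyP => k12; rewrite !ffunE.
rewrite ltn_neqAle; apply/andP; split.
  apply/eqP => /val_inj/enum_rank_inj/kinj/perm_inj k12'.
  by rewrite k12' ltnn in k12.
have tr : transitive (relpre rk (fun x y => x <= y)%N) by move=> x y z; exact: leq_trans.
rewrite -!nthE !(tnth_nth (kappa k1)).
by apply: (sorted_ltn_nth tr (kappa k1) st) => //; rewrite inE size_tuple.
Qed.

End Minors.

Section CenteredWeight.
Variables (g m N : nat).

Definition exponent_sum (kappa : {ffun 'I_N -> Mon g m}) (j : 'I_g) : nat :=
  (\sum_k expo (kappa k) j)%N.

(* g times the projection of the torus weight to the weights of SL_g. *)
Definition centered_weight kappa : 'rV[int]_g :=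
  \row_j ((g * exponent_sum kappa j)%:Z - (m * N)%:Z).

End CenteredWeight.

(** * Elimination *)

Section Elimination.
Variables (K : fieldType) (n : nat).
Implicit Types (P : 'I_n -> 'I_n -> K -> Prop) (M L U : 'M[K]_n).

(** [P i j] is the set of entries allowed at position (i, j), and the closure conditions make the
    allowed matrices a ring. The two instances are the valuation ring at every position
    ([finite_entry]) and the parabolic of a weight filtration ([filtered_op]). *)
Definition op_closed P :=
  [/\ forall i j, P i j 0, forall i, P i i 1,
      forall i j c d, P i j c -> P i j d -> P i j (c + d),
      forall i j c, P i j c -> P i j (- c) &
      forall i j k c d, P i j c -> P j k d -> P i k (c * d)].

Definition op_matrix P M := forall i j, P i j (M i j).

Definition op_unit P M :=
  exists M', [/\ op_matrix P M, op_matrix P M', M *m M' = 1%:M & M' *m M = 1%:M].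

Lemma op_matrix_mul P M M' : op_closed P ->
  op_matrix P M -> op_matrix P M' -> op_matrix P (M *m M').
Proof.
case=> P0 _ PD _ PM HM HM' i j; rewrite mxE.
by elim/big_ind: _ => // [|k _]; [exact: PD | exact: PM].
Qed.

Lemma op_matrix1 P : op_closed P -> op_matrix P 1%:M.
Proof. by case=> P0 P1 _ _ _ i j; rewrite mxE; case: eqP => [->|]. Qed.

Lemma op_unit1 P : op_closed P -> op_unit P 1%:M.
Proof. by move=> cP; exists 1%:M; split; rewrite ?mulmx1 //; exact: op_matrix1. Qed.

Lemma op_unit_mul P M M' : op_closed P -> op_unit P M -> op_unit P M' -> op_unit P (M *m M').
Proof.
move=> cP [N [HM HN MN NM]] [N' [HM' HN' MN' NM']]; exists (N' *m N).
split; try exact: op_matrix_mul.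
  by rewrite mulmxA -(mulmxA M) MN' mulmx1.
by rewrite mulmxA -(mulmxA N') NM mulmx1.
Qed.

Definition col_op (i : 'I_n) (v : 'I_n -> K) : 'M[K]_n :=
  1%:M - \matrix_(a, b) (if (b == i) && (a != i) then v a else 0).
Definition row_op (j : 'I_n) (v : 'I_n -> K) : 'M[K]_n :=
  1%:M - \matrix_(a, b) (if (a == j) && (b != j) then v b else 0).

Lemma nilpotent_op_unit P N : op_closed P -> op_matrix P N -> N *m N = 0 -> op_unit P (1%:M - N).
Proof.
move=> cP HN NN; have H1 := op_matrix1 cP; case: (cP) => P0 _ PD PN _.
exists (1%:M + N); split.
- by move=> i j; rewrite mxE; apply: PD => //; rewrite mxE; apply: PN.
- by move=> i j; rewrite mxE; apply: PD.
- by rewrite mulmxDr mulmx1 mulmxBl mul1mx NN subr0 subrK.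
- by rewrite mulmxDl mul1mx mulmxBr mulmx1 NN subr0 subrK.
Qed.

Lemma col_op_unit P i v : op_closed P -> (forall a, P a i (v a)) -> op_unit P (col_op i v).
Proof.
move=> cP Hv; apply: nilpotent_op_unit => //; case: cP => P0 _ _ _ _.
  by move=> a b; rewrite mxE; case: ifP => // /andP[/eqP -> _].
apply/matrixP => a b; rewrite !mxE big1 // => k _; rewrite !mxE.
by case: eqP => [->|]; rewrite ?eqxx ?andbF ?mulr0 ?mul0r.
Qed.

Lemma row_op_unit P j v : op_closed P -> (forall b, P j b (v b)) -> op_unit P (row_op j v).
Proof.
move=> cP Hv; apply: nilpotent_op_unit => //; case: cP => P0 _ _ _ _.
  by move=> a b; rewrite mxE; case: ifP => // /andP[/eqP -> _].
apply/matrixP => a b; rewrite !mxE big1 // => k _; rewrite !mxE.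
by case: (k == j); rewrite ?andbF ?mulr0 ?mul0r.
Qed.

Lemma pivotE M i j : M i j != 0 ->
  forall a d, (col_op i (fun a => M a j / M i j) *m M *m row_op j (fun d => M i d / M i j)) a d
    = if a == i then (if d == j then M i j else 0) else M a d - M a j * M i d / M i j.
Proof.
move=> nz a d.
have LM b : (col_op i (fun a => M a j / M i j) *m M) a b =
    if a == i then M i b else M a b - M a j * M i b / M i j.
  rewrite mulmxBl mul1mx !mxE (bigD1 i) //= big1 ?addr0.
    by rewrite mxE eqxx /=; case: eqP => [->|_] /=; [rewrite mul0r subr0 | rewrite mulrAC].
  by move=> k /negPf ki; rewrite mxE ki mul0r.
move: (_ *m M) LM => LM LME.
rewrite mulmxBr mulmx1 [LHS]mxE [X in _ + X]mxE [X in - X]mxE (bigD1 j) //= big1 ?addr0; last first.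
  by move=> k /negPf kj; rewrite [X in _ * X]mxE kj mulr0.
rewrite [X in _ - _ * X]mxE eqxx /= !LME.
by case: (a =P i) => _; case: (d =P j) => [->|_] /=; rewrite ?mulr0 ?subr0 //; field.
Qed.

Definition isolated M i j := [&& M i j != 0,
  [forall j', (j' != j) ==> (M i j' == 0)] & [forall i', (i' != i) ==> (M i' j == 0)]].

Lemma isolatedP M i j : reflect [/\ M i j != 0, forall j', M i j' != 0 -> j' = j &
  forall i', M i' j != 0 -> i' = i] (isolated M i j).
Proof.
apply: (iffP and3P) => [[nz /forallP Hr /forallP Hc]|[nz Hr Hc]]; split=> //.
- by move=> j' nz'; apply/eqP; apply: contraR nz' => ne; move: (Hr j'); rewrite ne.
- by move=> i' nz'; apply/eqP; apply: contraR nz' => ne; move: (Hc i'); rewrite ne.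
- by apply/forallP => j'; apply/implyP; apply: contraNT => /Hr ->.
- by apply/forallP => i'; apply/implyP; apply: contraNT => /Hc ->.
Qed.

(** Gaussian elimination with full pivoting. Rows owning an isolated entry keep it, and each pivot
    among the remaining rows and columns isolates one more entry, so the set [bad] shrinks. Only the
    pivoting rule differs between the Smith form over a place and the Bruhat decomposition. *)
Lemma elimination P Q M : op_closed P -> op_closed Q -> M \in unitmx ->
  (forall M' (A : {set 'I_n * 'I_n}), (exists2 x, x \in A & M' x.1 x.2 != 0) ->
     exists i j, [/\ (i, j) \in A, M' i j != 0,
       forall i', (i', j) \in A -> P i' i (M' i' j / M' i j) &
       forall j', (i, j') \in A -> Q j j' (M' i j' / M' i j)]) ->
  exists L U (s : 'S_n), [/\ op_unit P L, op_unit Q U &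
     forall i j, ((L *m M *m U) i j != 0) = (j == s i)].
Proof.
move=> cP cQ uM piv.
pose bad M' := [set i | [forall j, ~~ isolated M' i j]].
have [c] := ubnP #|bad M|.
elim: c M uM => // c IH M uM bM.
have rownz i : exists j, M i j != 0.
  apply/existsP; apply: contraLR uM; rewrite negb_exists => /forallP H.
  rewrite unitmxE (expand_det_row _ i) big1 ?unitr0 // => j _.
  by move: (H j); rewrite negbK => /eqP ->; rewrite mul0r.
have [b0|[i0 Hi0]] := set_0Vmem (bad M).
  have iso i : exists j, isolated M i j.
    apply/existsP; apply: contraFT (in_set0 i); rewrite negb_exists -b0 inE.
    by move=> /forallP H; apply/forallP.
  pose s i := xchoose (iso i); have sP i : isolated M i (s i) by exact: (xchooseP (iso i)).
  have sinj : injective s.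
    move=> i i' ss; have /isolatedP[nz _ _] := sP i; have /isolatedP[_ _ H] := sP i'.
    by apply: H; rewrite -ss.
  exists 1%:M, 1%:M, (perm sinj); split; try exact: op_unit1.
  move=> i j; rewrite mul1mx mulmx1 permE; have /isolatedP[nz H _] := sP i.
  by apply/idP/eqP => [/H|->].
pose A := [set x : 'I_n * 'I_n | (x.1 \in bad M) && [forall i, ~~ isolated M i x.2]].
have [j0 nz0] := rownz i0.
have [|i [j [Aij nz HP HQ]]] := piv M A.
  exists (i0, j0) => //=; rewrite inE /= Hi0; apply/forallP => i.
  apply/negP => iso; have /isolatedP[_ _ /(_ _ nz0) ii] := iso.
  by move: Hi0; rewrite inE ii => /forallP /(_ j0); rewrite iso.
move: Aij; rewrite !inE /= => /andP[bi bj].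
have colz i' : i' \notin bad M -> M i' j = 0.
  rewrite inE => /forallPn[j1]; rewrite negbK => iso; apply/eqP; apply: contraTT bj => nz'.
  have /isolatedP[_ H _] := iso; rewrite (H _ nz').
  by apply/forallPn; exists i'; rewrite negbK.
have rowz j' : ~~ [forall i, ~~ isolated M i j'] -> M i j' = 0.
  move=> /forallPn[i1]; rewrite negbK => iso; apply/eqP; apply: contraTT bi => nz'.
  have /isolatedP[_ _ H] := iso; rewrite (H _ nz').
  by apply/forallPn; exists j'; rewrite negbK.
pose L := col_op i (fun a => M a j / M i j); pose U := row_op j (fun d => M i d / M i j).
have uL : op_unit P L.
  apply: col_op_unit => // a; have [aA|aA] := boolP (a \in bad M).
    by apply: HP; rewrite inE /= aA.
  by rewrite colz // mul0r; case: cP.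
have uU : op_unit Q U.
  apply: row_op_unit => // d; have [dA|dA] := boolP [forall i, ~~ isolated M i d].
    by apply: HQ; rewrite inE /= dA inE bi.
  by rewrite rowz // mul0r; case: cQ.
pose M' := L *m M *m U.
have M'E a d : M' a d = if a == i then (if d == j then M i j else 0)
   else M a d - M a j * M i d / M i j by exact: pivotE.
have uM' : M' \in unitmx.
  have [L' [_ _ LL _]] := uL; have [U' [_ _ UU _]] := uU.
  by rewrite !unitmx_mul uM (proj1 (mulmx1_unit LL)) (proj1 (mulmx1_unit UU)).
have isoij : isolated M' i j.
  apply/isolatedP; split; first by rewrite M'E !eqxx.
    by move=> j'; rewrite M'E eqxx; case: (j' =P j) => // _; rewrite eqxx.
  move=> i'; rewrite M'E; case: (i' =P i) => // _.
  by rewrite mulfK // subrr eqxx.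
have bM' : bad M' \proper bad M.
  apply/properP; split; last first.
    by exists i; rewrite ?inE //; apply/forallPn; exists j; rewrite negbK.
  apply/subsetP => i1; apply: contraLR => gi1; have z1 := colz _ gi1.
  move: gi1; rewrite !inE => /forallPn[j1]; rewrite negbK => iso.
  apply/forallPn; exists j1; rewrite negbK.
  have ii1 : i1 != i.
    by apply: contraTneq bi => <-; apply/forallPn; exists j1; rewrite negbK.
  have zj1 : M i j1 = 0 by apply: rowz; apply/forallPn; exists i1; rewrite negbK.
  have jj1 : j1 != j by apply: contraNneq nz => <-; rewrite zj1.
  have /isolatedP[nz1 H1 H2] := iso; apply/isolatedP; split.
  - by rewrite M'E (negPf ii1) zj1 mulr0 mul0r subr0.
  - by move=> j'; rewrite M'E (negPf ii1) z1 !mul0r subr0 => /H1.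
  - move=> i'; rewrite M'E zj1 mulr0 mul0r subr0; case: (i' == i); last by move/H2.
    by rewrite (negPf jj1) eqxx.
have [|L1 [U1 [s [uL1 uU1 Hs]]]] := IH M' uM'.
  by rewrite -ltnS; apply: leq_trans bM; rewrite ltnS proper_card.
exists (L1 *m L), (U *m U1), s; split; try exact: op_unit_mul.
by move=> a b; rewrite -Hs /M' !mulmxA.
Qed.

End Elimination.

(** * Places *)

Section PartialHomomorphisms.
Variables (K : fieldType) (F : closedFieldType).
Implicit Types G : K * F -> Prop.

(** The graph of a ring homomorphism from a subring of K to F; the last clause is single-valuedness.
    As graphs, extensions are inclusions and Zorn's lemma applies directly. *)
Definition partial_hom G :=
  [/\ G (1, 1), forall x y, G x -> G y -> G (x - y), forall x y, G x -> G y -> G (x * y) &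
      forall c, G (0, c) -> c = 0].

Section Closure.
Variables (G : K * F -> Prop) (hG : partial_hom G).

Lemma phom1 : G (1, 1). Proof. by case: hG. Qed.
Lemma phomB x y : G x -> G y -> G (x - y). Proof. by case: hG => _ H _ _; exact: H. Qed.
Lemma phomM x y : G x -> G y -> G (x * y). Proof. by case: hG => _ _ H _; exact: H. Qed.
Lemma phom_fun c : G (0, c) -> c = 0. Proof. by case: hG => _ _ _; exact. Qed.
Lemma phom0 : G 0. Proof. by rewrite -(subrr (1, 1)); apply: phomB; exact: phom1. Qed.
Lemma phomN x : G x -> G (- x).
Proof. by move=> Gx; rewrite -sub0r; apply: phomB => //; exact: phom0. Qed.
Lemma phomD x y : G x -> G y -> G (x + y).
Proof. by move=> Gx Gy; rewrite -[y]opprK; apply: phomB => //; exact: phomN. Qed.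
Lemma phom_eq a c d : G (a, c) -> G (a, d) -> c = d.
Proof.
move=> Gc Gd; apply/eqP; rewrite -subr_eq0; apply/eqP/phom_fun.
by rewrite -(subrr a); exact: (phomB Gc Gd).
Qed.
Lemma phomM2 a b c d : G (a, c) -> G (b, d) -> G (a * b, c * d).
Proof. by move=> Ga Gb; exact: (phomM Ga Gb). Qed.
Lemma phom_sum (I : Type) (r : seq I) (P : pred I) a c :
  (forall i, P i -> G (a i, c i)) -> G (\sum_(i <- r | P i) a i, \sum_(i <- r | P i) c i).
Proof.
move=> H; elim/big_rec2: _ => [|i u v Pi]; first exact: phom0.
exact: (phomD (H i Pi)).
Qed.
Lemma phom_prod (I : Type) (r : seq I) (P : pred I) a c :
  (forall i, P i -> G (a i, c i)) -> G (\prod_(i <- r | P i) a i, \prod_(i <- r | P i) c i).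
Proof.
move=> H; elim/big_rec2: _ => [|i u v Pi]; first exact: phom1.
exact: (phomM (H i Pi)).
Qed.
Lemma phomX a c n : G (a, c) -> G (a ^+ n, c ^+ n).
Proof.
by move=> H; elim: n => [|n IH]; rewrite ?expr0 ?exprS; [exact: phom1 | exact: (phomM H IH)].
Qed.

End Closure.

Definition maximal_phom G := partial_hom G /\
  forall G', partial_hom G' -> (forall x, G x -> G' x) -> forall x, G' x -> G x.

Lemma maximal_phom_exists G0 : partial_hom G0 ->
  exists2 G, maximal_phom G & forall x, G0 x -> G x.
Proof.
move=> hG0.
(* [G0] is joined to every member so that the empty chain, whose union is empty, also satisfies
   [P]. *)
pose P (A : classical_sets.set (K * F)) := partial_hom (fun x => A x \/ G0 x).
have [C HC tot|A [PA maxA]] := @classical_sets.Zorn_bigcup (K * F)%type P.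
  pose U := classical_sets.bigcup C id.
  have pair x y : (U x \/ G0 x) -> (U y \/ G0 y) ->
      exists G1, [/\ partial_hom G1, G1 x, G1 y & forall z, G1 z -> U z \/ G0 z].
    have UP A : C A -> forall z, A z \/ G0 z -> U z \/ G0 z.
      by move=> CA z [Az|]; [left; exists A | right].
    move=> [[A CA Ax]|G0x] [[B CB By]|G0y].
    - have [AB|BA] := tot A B CA CB.
        by exists (fun z => B z \/ G0 z); split; auto; [exact: HC CB | exact: UP CB].
      by exists (fun z => A z \/ G0 z); split; auto; [exact: HC CA | exact: UP CA].
    - by exists (fun z => A z \/ G0 z); split; auto; [exact: HC CA | exact: UP CA].
    - by exists (fun z => B z \/ G0 z); split; auto; [exact: HC CB | exact: UP CB].
    - by exists G0; split=> // z; right.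
  split.
  - by right; exact: phom1.
  - by move=> x y /pair H /H [G1 [hG1 xG yG]]; apply; apply: phomB.
  - by move=> x y /pair H /H [G1 [hG1 xG yG]]; apply; apply: phomM.
  - by move=> c /[dup] /pair H /H [G1 [hG1 /(phom_fun hG1)]].
exists (fun x => A x \/ G0 x); last by right.
split=> // G' hG' sub x G'x; left; apply: boolp.contrapT => nAx.
apply: (maxA G').
  by split=> [z Az|/(_ x G'x)//]; apply: sub; left.
rewrite /P; have -> // : (fun x => G' x \/ G0 x) = G'.
apply/boolp.funext => z; apply/boolp.propext; split; last by left.
by case=> // G0z; apply: sub; right.
Qed.

(* Combining the two relations lowers d + k; [U], [I], [O] stand for the elements of value 1, *)
(* value 0, and finite value. *)
Lemma no_double_relation (U I O : K -> Prop) (x : K) : x != 0 ->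
  (forall a, U a -> a != 0) -> I 0 -> O 0 ->
  (forall a b c, I a -> U b -> O c -> I (a / b * c)) ->
  (forall a b c, O a -> U b -> O c -> O (a / b * c)) ->
  (forall a b, I a -> I b -> I (a - b)) -> (forall a b, U a -> I b -> U (a - b)) ->
  (forall a b, O a -> O b -> O (a - b)) -> (forall a, I a -> O a) -> (forall a, U a -> O a) ->
  forall (d k : nat) (p q : nat -> K),
  (forall i, (d < i)%N -> p i = 0) -> (forall i, (k < i)%N -> q i = 0) ->
  U (p 0%N) -> (forall i, (0 < i)%N -> I (p i)) ->
  U (q 0%N) -> (forall i, (0 < i)%N -> O (q i)) ->
  \sum_(i < d.+1) p i * x ^+ i = 0 -> \sum_(i < k.+1) q i * x^-1 ^+ i = 0 -> False.
Proof.
move=> x0 U0 I0 O0 IM OM IB UB OB IO UO d k.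
have [N] := ubnP (d + k); elim: N d k => // N IH d k dkN p q pd qk Up Ip Uq Oq Sp Sq.
have pO i : O (p i) by case: i => [|i]; [exact: UO | apply/IO/Ip].
have qO i : O (q i) by case: i => [|i]; [exact: UO | exact: Oq].
have extend (r : nat -> K) (y : K) e f : (e <= f)%N -> (forall i, (e < i)%N -> r i = 0) ->
    \sum_(i < e.+1) r i * y ^+ i = 0 -> \sum_(i < f.+1) r i * y ^+ i = 0.
  move=> ef re Sr; rewrite -(big_mkord xpredT (fun i => r i * y ^+ i)).
  rewrite (@big_cat_nat _ _ _ e.+1) //= big_mkord Sr add0r big_nat_cond big1 // => i.
  by rewrite andbT => /andP[ei _]; rewrite re // mul0r.
have reverse (r : nat -> K) (y : K) f : y != 0 -> \sum_(i < f.+1) r i * y^-1 ^+ i = 0 ->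
    \sum_(i < f.+1) r (f - i)%N * y ^+ i = 0.
  move=> y0 Sr; rewrite (reindex_inj rev_ord_inj) /=.
  transitivity (y ^+ f * \sum_(i < f.+1) r i * y^-1 ^+ i); last by rewrite Sr mulr0.
  rewrite mulr_sumr; apply: eq_bigr => i _; have lif : (i <= f)%N by rewrite -ltnS.
  rewrite subSS subKn // mulrCA; congr (_ * _).
  by rewrite expfB_cond ?(negPf y0) // exprVn.
have [kd|dk] := leqP k d.
  case: d => [|d] in dkN pd Sp kd *.
    by move: Sp; rewrite big_ord1 expr0 mulr1; apply/eqP/U0.
  pose p' i := if (i <= d)%N then p i - p d.+1 / q 0%N * q (d.+1 - i)%N else 0.
  apply: (IH d k _ p' q) => //; rewrite /p'.
  - by move=> i di; rewrite leqNgt di.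
  - by rewrite leq0n; apply: UB => //; apply: IM => //; exact: Ip.
  - by move=> i i0; case: ifP => // _; apply: IB; [exact: Ip | apply: IM => //; exact: Ip].
  - have /reverse : \sum_(i < d.+2) q i * x^-1 ^+ i = 0 by exact: extend Sq.
    move=> /(_ x0) Sq'.
    have : \sum_(i < d.+2) (p i - p d.+1 / q 0%N * q (d.+1 - i)%N) * x ^+ i = 0.
      move: (p d.+1 / _) => c; under eq_bigr => i _ do rewrite mulrBl -mulrA.
      by rewrite sumrB Sp -mulr_sumr Sq' mulr0 subr0.
    rewrite big_ord_recr /= subnn divfK ?U0 // subrr mul0r addr0 => S; rewrite -[RHS]S.
    by apply: eq_bigr => i _; rewrite -ltnS ltn_ord.
case: k => [|k] in dkN qk Sq dk *; first by [].
pose q' i := if (i <= k)%N then q i - q k.+1 / p 0%N * p (k.+1 - i)%N else 0.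
apply: (IH d k _ p q') => //; rewrite /q'.
- by rewrite -ltnS -addnS.
- by move=> i di; rewrite leqNgt di.
- by rewrite leq0n subn0 (pd k.+1) // mulr0 subr0.
- by move=> i i0; case: ifP => // _; apply: OB => //; apply: OM.
- have /reverse : \sum_(i < k.+2) p i * (x^-1)^-1 ^+ i = 0.
    by rewrite invrK; apply: extend Sp => //; exact: ltnW.
  rewrite invr_eq0 => /(_ x0) Sp'.
  have : \sum_(i < k.+2) (q i - q k.+1 / p 0%N * p (k.+1 - i)%N) * x^-1 ^+ i = 0.
    move: (q k.+1 / _) => c; under eq_bigr => i _ do rewrite mulrBl -mulrA.
    by rewrite sumrB Sq -mulr_sumr Sp' mulr0 subr0.
  rewrite big_ord_recr /= subnn divfK ?U0 // subrr mul0r addr0 => S; rewrite -[RHS]S.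
  by apply: eq_bigr => i _; rewrite -ltnS ltn_ord.
Qed.

Section Maximal.
Variables (G : K * F -> Prop) (maxG : maximal_phom G) (onto : forall c, exists a, G (a, c)).
Let hG : partial_hom G := proj1 maxG.

(** Localising at the elements of nonzero value extends the homomorphism, so by maximality the
    fractions already belong to [G]. *)
Lemma phom_inv s sg : G (s, sg) -> sg != 0 -> s != 0 /\ G (s^-1, sg^-1).
Proof.
have nz t ta : G (t, ta) -> ta != 0 -> t != 0.
  by move=> Gt; apply: contraNneq => t0; rewrite t0 in Gt; rewrite (phom_fun hG Gt).
move=> Gs sg0; split; first exact: nz Gs sg0.
pose G' (x : K * F) := exists b be t ta,
  [/\ G (b, be), G (t, ta), ta != 0 & x = (b / t, be / ta)].
apply: (proj2 maxG G'); last first.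
- by exists 1, 1, s, sg; split=> //; [exact: phom1 | rewrite !div1r].
- by case=> a c Gac; exists a, c, 1, 1; split; rewrite ?oner_eq0 ?divr1 //; exact: phom1.
split.
- by exists 1, 1, 1, 1; split; rewrite ?oner_eq0 ?divr1 //; exact: phom1.
- move=> _ _ [b [be [t [ta [Gb Gt ta0 ->]]]]] [b' [be' [t' [ta' [Gb' Gt' ta0' ->]]]]].
  exists (b * t' - b' * t), (be * ta' - be' * ta), (t * t'), (ta * ta'); split.
  + by apply: (phomB hG (phomM hG Gb Gt') (phomM hG Gb' Gt)).
  + exact: (phomM hG Gt Gt').
  + by rewrite mulf_neq0.
  + have t0 := nz _ _ Gt ta0; have t0' := nz _ _ Gt' ta0'.
    by congr (_, _) => /=; field; rewrite ?t0 ?t0' ?ta0 ?ta0'.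
- move=> _ _ [b [be [t [ta [Gb Gt ta0 ->]]]]] [b' [be' [t' [ta' [Gb' Gt' ta0' ->]]]]].
  exists (b * b'), (be * be'), (t * t'), (ta * ta'); split.
  + exact: (phomM hG Gb Gb').
  + exact: (phomM hG Gt Gt').
  + by rewrite mulf_neq0.
  + by congr (_, _) => /=; rewrite mulf_div.
- move=> c [b [be [t [ta [Gb Gt ta0 [b0 ->]]]]]].
  have t0 := nz _ _ Gt ta0; move/esym/eqP: b0.
  rewrite mulf_eq0 invr_eq0 (negPf t0) orbF => /eqP b0.
  by rewrite b0 in Gb; rewrite (phom_fun hG Gb) mul0r.
Qed.

Definition polyG (p : {poly K}) (pi : {poly F}) := forall i, G (p`_i, pi`_i).

Lemma polyGB p pi q ka : polyG p pi -> polyG q ka -> polyG (p - q) (pi - ka).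
Proof. by move=> Hp Hq i; rewrite !coefB; exact: (phomB hG (Hp i) (Hq i)). Qed.

Lemma polyGD p pi q ka : polyG p pi -> polyG q ka -> polyG (p + q) (pi + ka).
Proof. by move=> Hp Hq i; rewrite !coefD; exact: (phomD hG (Hp i) (Hq i)). Qed.

Lemma polyGM p pi q ka : polyG p pi -> polyG q ka -> polyG (p * q) (pi * ka).
Proof.
move=> Hp Hq i; rewrite !coefM; apply: phom_sum => // j _.
exact: (phomM hG (Hp _) (Hq _)).
Qed.

Lemma polyGC a c : G (a, c) -> polyG a%:P c%:P.
Proof. by move=> Gac i; rewrite !coefC; case: eqP => // _; exact: phom0. Qed.

Lemma polyGX : polyG 'X 'X.
Proof. by move=> i; rewrite !coefX; case: eqP => _; [exact: phom1 | exact: phom0]. Qed.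

Lemma polyG_lift pi : exists p, polyG p pi.
Proof.
elim/poly_ind: pi => [|pi c [p Hp]].
  by exists 0 => i; rewrite !coef0; exact: phom0.
have [a Ga] := onto c; exists (p * 'X + a%:P).
by apply: polyGD; [exact: polyGM polyGX | exact: polyGC].
Qed.

(** Without such a pair of polynomials, evaluation at (x, c) would be a homomorphism extending [G]
    and sending x to c. *)
Lemma adjoin_obstruction x c : ~ G (x, c) ->
  exists p pi, [/\ polyG p pi, p.[x] = 0 & pi.[c] != 0].
Proof.
move=> nG; apply: boolp.contrapT => H; apply: nG.
pose G' (y : K * F) := exists p pi, polyG p pi /\ y = (p.[x], pi.[c]).
apply: (proj2 maxG G'); last first.
- by exists 'X, 'X; split; [exact: polyGX | rewrite !hornerX].
- move=> [a b] Gab; exists a%:P, b%:P; split; first exact: polyGC.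
  by rewrite !hornerC.
split.
- by exists 1%:P, 1%:P; split; [exact: (polyGC (phom1 hG)) | rewrite !hornerC].
- move=> _ _ [p [pi [Hp ->]]] [q [ka [Hq ->]]]; exists (p - q), (pi - ka).
  by split; [exact: polyGB | rewrite !hornerD !hornerN].
- move=> _ _ [p [pi [Hp ->]]] [q [ka [Hq ->]]]; exists (p * q), (pi * ka).
  by split; [exact: polyGM | rewrite !hornerM].
- move=> d [p [pi [Hp [px ->]]]]; have [//|nz] := eqVneq pi.[c] 0.
  by case: H; exists p, pi.
Qed.

(** The reductions of the polynomial relations of x form an ideal J of F[X]. A nonconstant member
    has a root c because F is closed; the obstruction to x -> c is a member not vanishing at c, and
    its remainder is a nonzero member of smaller degree. So J contains 1. *)
Lemma unit_obstruction x : (forall c, ~ G (x, c)) -> exists2 p, polyG p 1 & p.[x] = 0.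
Proof.
move=> nG; pose J pi := exists2 p, polyG p pi & p.[x] = 0.
have JM ka pi : J pi -> J (ka * pi).
  move=> [p Hp px]; have [q Hq] := polyG_lift ka.
  by exists (q * p); [exact: polyGM | rewrite hornerM px mulr0].
have JB ka pi : J pi -> J ka -> J (pi - ka).
  move=> [p Hp px] [q Hq qx].
  by exists (p - q); [exact: polyGB | rewrite hornerD hornerN px qx subr0].
have [n [pi [Jpi pi0 spi]]] : exists n pi, [/\ J pi, pi != 0 & (size pi < n)%N].
  have [p [pi [Hp px pi0]]] := adjoin_obstruction (nG 0).
  exists (size pi).+1, pi; split=> //; first by exists p.
  by apply: contraNneq pi0 => ->; rewrite horner0.
elim: n => // n IH in pi Jpi pi0 spi *.
have [/closed_rootP [c /eqP rc]|] := boolP (size pi != 1%N); last first.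
  rewrite negbK => /size_poly1P[c c0 Epi].
  have := JM (c^-1)%:P _ Jpi.
  by rewrite (_ : _ * pi = 1) // Epi -polyCM mulVf.
have [p [ka [Hp px kac]]] := adjoin_obstruction (nG c).
have Jka : J ka by exists p.
apply: (IH (ka %% pi)).
- rewrite (_ : ka %% pi = ka - ka %/ pi * pi); last by rewrite {2}(divp_eq ka pi) addrC addKr.
  by apply: JB => //; exact: JM.
- apply: contraNneq kac => r0.
  by rewrite (divp_eq ka pi) r0 addr0 hornerM rc mulr0.
- by apply: (@leq_trans (size pi)); [rewrite ltn_modp | rewrite -ltnS].
Qed.

(** If both alternatives fail, x satisfies a relation with constant term of value 1 and other
    coefficients of value 0, and 1/x satisfies one with finite coefficients and constant term of
    value 1 after scaling. [no_double_relation] forbids this. *)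
Lemma maximal_phom_place x : (exists c, G (x, c)) \/ x != 0 /\ G (x^-1, 0).
Proof.
have [|nG] := boolp.pselect (exists c, G (x, c)); first by left.
right; have x0 : x != 0.
  by apply/eqP => x0; apply: nG; exists 0; rewrite x0; exact: phom0.
split=> //; apply: boolp.contrapT => nG'.
have [p Hp px] : exists2 p, polyG p 1 & p.[x] = 0.
  by apply: unit_obstruction => c Gc; apply: nG; exists c.
have [q [ka [Hq qx ka0]]] := adjoin_obstruction nG'.
rewrite horner_coef0 in ka0; have [b Gb] := onto (ka`_0)^-1.
have hO a c : G (a, c) -> exists c, G (a, c) by exists c.
apply: (@no_double_relation (fun a => G (a, 1)) (fun a => G (a, 0))
    (fun a => exists c, G (a, c)) x x0 _ _ _ _ _ _ _ _ _ _ (size p) (size q)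
    (fun i => p`_i) (fun i => b * q`_i)).
- by move=> a Ga; apply/eqP => a0; rewrite a0 in Ga; have /eqP := phom_fun hG Ga; rewrite oner_eq0.
- exact: phom0.
- by exists 0; exact: phom0.
- move=> a u c Ga Gu [d Gc]; have [_ Gu'] := phom_inv Gu (oner_neq0 _).
  suff : G (a / u * c, 0 / 1 * d) by rewrite !mul0r.
  exact: (phomM hG (phomM hG Ga Gu') Gc).
- move=> a u c [d Ga] Gu [e Gc]; have [_ Gu'] := phom_inv Gu (oner_neq0 _).
  by exists (d / 1 * e); exact: (phomM hG (phomM hG Ga Gu') Gc).
- by move=> a c Ga Gc; rewrite -[0](subr0 0); exact: (phomB hG Ga Gc).
- by move=> a c Ga Gc; rewrite -[1](subr0 1); exact: (phomB hG Ga Gc).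
- by move=> a c [d Ga] [e Gc]; exists (d - e); exact: (phomB hG Ga Gc).
- by move=> a; exact: hO.
- by move=> a; exact: hO.
- by move=> i /ltnW; exact: nth_default.
- by move=> i /ltnW si; rewrite nth_default ?mulr0.
- by have := Hp 0%N; rewrite coef1.
- by move=> [|i] // _; have := Hp i.+1; rewrite coef1.
- by rewrite -(mulVf ka0); exact: (phomM hG Gb (Hq _)).
- by move=> i _; exists ((ka`_0)^-1 * ka`_i); exact: (phomM hG Gb (Hq _)).
- by rewrite -[RHS]px (@horner_coef_wide _ (size p).+1) // leqnSn.
- under eq_bigr => i _ do rewrite -mulrA.
  by rewrite -mulr_sumr -(@horner_coef_wide _ (size q).+1) ?qx ?mulr0 // leqnSn.
Qed.

End Maximal.

Lemma place_extension G0 : partial_hom G0 -> (forall c, exists a, G0 (a, c)) ->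
  exists G, [/\ partial_hom G, forall x, G0 x -> G x,
    forall s sg, G (s, sg) -> sg != 0 -> s != 0 /\ G (s^-1, sg^-1) &
    forall x, (exists c, G (x, c)) \/ x != 0 /\ G (x^-1, 0)].
Proof.
move=> hG0 onto; have [G maxG sub] := maximal_phom_exists hG0.
exists G; split=> //; [by case: maxG | exact: phom_inv | move=> x].
by apply: maximal_phom_place => // c; have [a /sub] := onto c; exists a.
Qed.

End PartialHomomorphisms.

(** * Gordan's theorem and points of minimal norm *)

Lemma seq_least (T : eqType) (le : T -> T -> Prop) (s : seq T) :
  (forall x y, x \in s -> y \in s -> le x y \/ le y x) ->
  (forall x y z, x \in s -> y \in s -> z \in s -> le x y -> le y z -> le x z) ->
  s != [::] -> exists2 x, x \in s & forall y, y \in s -> le x y.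
Proof.
elim: s => // a s IH tot tr _.
have ss x : x \in s -> x \in a :: s by rewrite inE orbC => ->.
have as_ : a \in a :: s by rewrite mem_head.
have leaa : le a a by case: (tot a a as_ as_).
have [->|s0] := eqVneq s [::].
  by exists a; rewrite ?mem_head // => y; rewrite inE => /eqP->.
have [x y ? ?|x y z ? ? ?|//|x xs xl] := IH; first by apply: tot; exact: ss.
  by apply: tr; exact: ss.
have [ax|xa] := tot a x as_ (ss _ xs).
  exists a => // y; rewrite inE => /orP[/eqP->//|ys].
  by apply: (tr a x y) => //; [exact: ss | exact: ss | exact: xl].
exists x; first exact: ss.
by move=> y; rewrite inE => /orP[/eqP->//|/xl].
Qed.

Section Gordan.

Lemma seq_between (l u : seq rat) : (forall x y, x \in l -> y \in u -> x < y) ->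
  exists z, (forall x, x \in l -> x < z) /\ (forall y, y \in u -> z < y).
Proof.
have above x (v : seq rat) : (forall y, y \in v -> x < y) ->
    exists z, x < z /\ forall y, y \in v -> z < y.
  elim: v => [|y v IH] xv; first by exists (x + 1); split; [lra|].
  have [|z [xz zv]] := IH; first by move=> y' ?; apply: xv; rewrite inE orbC; apply/orP; left.
  have xy : x < y by apply: xv; rewrite mem_head.
  have [zy|yz] := ltP z y.
    by exists z; split=> // y'; rewrite inE => /orP[/eqP->|/zv].
  exists ((x + y) / 2); split; first by lra.
  move=> y'; rewrite inE => /orP[/eqP->|/zv]; lra.
elim: l => [|x l IH] lu.
  elim: u {lu} => [|y u [z [_ zu]]]; first by exists 0.
  have [zy|yz] := ltP z y; [exists z | exists (y - 1)]; split=> // y'.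
    by rewrite inE => /orP[/eqP->|/zu].
  by rewrite inE => /orP[/eqP->|/zu]; lra.
have [x' y ? ?|z [lz zu]] := IH; first by apply: lu; rewrite // inE orbC; apply/orP; left.
have [xz|zx] := ltP x z.
  by exists z; split=> // x'; rewrite inE => /orP[/eqP->|/lz].
have [y ?|w [xw wu]] := above x u; first by apply: lu; rewrite ?mem_head.
exists w; split=> // x'; rewrite inE => /orP[/eqP->//|/lz]; lra.
Qed.

(** In the application [Good t] says that the monomial d^t has value 0 at a place. The value group
    may be any ordered group; Gordan's theorem replaces the values of d by rational weights with the
    same signs on finitely many monomials. *)
Variables (n : nat) (Good : 'rV[int]_n -> Prop).
Hypotheses (GoodD : forall s t, Good s -> Good t -> Good (s + t)) (Good0 : ~ Good 0).

Definition pairing (s : 'rV[int]_n) (lam : 'I_n -> rat) : rat := \sum_i (s 0 i)%:~R * lam i.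

Lemma pairingD s t lam : pairing (s + t) lam = pairing s lam + pairing t lam.
Proof. by rewrite -big_split; apply: eq_bigr => i _; rewrite mxE rmorphD mulrDl. Qed.

Lemma pairingMn s k lam : pairing (s *+ k) lam = pairing s lam *+ k.
Proof.
elim: k => [|k IH]; last by rewrite !mulrS pairingD IH.
by rewrite !mulr0n /pairing big1 // => i _; rewrite mxE mul0r.
Qed.

Lemma GoodMn s k : Good s -> (0 < k)%N -> Good (s *+ k).
Proof.
by move=> Gs; case: k => // k _; elim: k => [//|k IH]; rewrite mulrS; exact: GoodD.
Qed.

(* Fourier-Motzkin elimination of the coordinates one by one. *)
Lemma gordan (S : seq 'rV[int]_n) : (forall s, s \in S -> Good s) ->
  exists lam, forall s, s \in S -> 0 < pairing s lam.
Proof.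
suff H k : (k <= n)%N -> forall S : seq (matrix int 1 n), (forall s, s \in S -> Good s) ->
    (forall s, s \in S -> forall i : 'I_n, (k <= i)%N -> s 0 i = 0) ->
    exists lam, forall s, s \in S -> 0 < pairing s lam.
  by move=> GS; apply: (H n (leqnn n) S GS) => s _ i; rewrite leqNgt ltn_ord.
elim: k => [_|k IH kn] {}S GS S0.
  exists (fun=> 0) => s sS; case: Good0; suff <- : s = 0 by exact: GS.
  by apply/rowP => i; rewrite S0 // mxE.
pose j := Ordinal kn.
pose Z := [seq s : matrix int 1 n <- S | s 0 j == 0]; pose P := [seq s : matrix int 1 n <- S | 0 < s 0 j].
pose M := [seq s : matrix int 1 n <- S | s 0 j < 0].
pose comb (s t : matrix int 1 n) := t *+ absz (s 0 j) + s *+ absz (t 0 j).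
have [||lam Hlam] := IH (ltnW kn) (Z ++ [seq comb s t | s <- P, t <- M]).
- move=> s; rewrite mem_cat => /orP[|/allpairsP[[p q] /= [pP qM ->]]].
    by rewrite mem_filter => /andP[_]; exact: GS.
  move: pP qM; rewrite !mem_filter => /andP[p0 /GS Gp] /andP[q0 /GS Gq].
  by apply: GoodD; apply: GoodMn => //; rewrite absz_gt0; lia.
- move=> s; rewrite mem_cat => /orP[sZ|/allpairsP[[p q] /= [pP qM ->]]] i.
    move: sZ; rewrite mem_filter => /andP[/eqP s0 sS]; rewrite leq_eqVlt => /orP[/eqP ki|].
      by rewrite (_ : i = j) //; apply/val_inj.
    exact: S0.
  move: pP qM; rewrite !mem_filter => /andP[p0 pS] /andP[q0 qS].
  rewrite leq_eqVlt => /orP[/eqP ki|ki].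
    rewrite (_ : i = j); last exact/val_inj.
    rewrite /comb mxE !mulmxnE -(mulr_natr (q 0 j)) -(mulr_natr (p 0 j)) !natz gtz0_abs // ltz0_abs //.
    by rewrite mulrN mulrC subrr.
  by rewrite /comb mxE !mulmxnE (S0 p pS i) ?(S0 q qS i) // !mul0rn addr0.
have pair0 s : s \in P -> 0 < ((s 0 j)%:~R : rat).
  by rewrite mem_filter ltr0z => /andP[].
have pair1 s : s \in M -> ((s 0 j)%:~R : rat) < 0.
  by rewrite mem_filter ltrz0 => /andP[].
have [|z [zl zu]] := @seq_between [seq - (pairing s lam / (s 0 j)%:~R) | s <- P]
    [seq - (pairing s lam / (s 0 j)%:~R) | s <- M].
  move=> _ _ /mapP[p pP ->] /mapP[q qM ->].
  have := Hlam (comb p q); rewrite mem_cat orbC => H.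
  have {H} : 0 < pairing (comb p q) lam.
    by apply: H; apply/orP; left; apply/allpairsP; exists (p, q).
  have := pair0 _ pP; have := pair1 _ qM; rewrite pairingD !pairingMn -(mulr_natl (pairing q _)) -(mulr_natl (pairing p _)) !natr_absz.
  rewrite !intr_norm => q0 p0; rewrite (gtr0_norm p0) (ltr0_norm q0).
  move: (pairing p lam) (pairing q lam) ((p 0 j)%:~R) ((q 0 j)%:~R) p0 q0 => a b c d c0 d0 H.
  rewrite -subr_gt0; have -> : - (b / d) - - (a / c) = (c * b + - d * a) / (c * - d).
    by field; rewrite (lt0r_neq0 c0) (ltr0_neq0 d0).
  by rewrite divr_gt0 // mulr_gt0 // oppr_gt0.
exists (fun i => lam i + (if i == j then z else 0)) => s sS.
have -> : pairing s (fun i => lam i + (if i == j then z else 0)) = pairing s lam + (s 0 j)%:~R * z.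
  rewrite /pairing; under eq_bigr => i _ do rewrite mulrDr.
  rewrite big_split /=; congr (_ + _).
  by rewrite (bigD1 j) //= eqxx big1 ?addr0 // => i /negPf ->; rewrite mulr0.
have [sj|sj|sj] := ltgtP (s 0 j) 0.
- have sM : s \in M by rewrite mem_filter sj.
  have := zu _ (map_f _ sM); have := pair1 _ sM => sj0.
  by rewrite ltrNr ltr_ndivrMr // => ?; lra.
- have sP : s \in P by rewrite mem_filter sj.
  have := zl _ (map_f _ sP); have := pair0 _ sP => sj0.
  by rewrite ltrNl ltr_pdivlMr // => ?; lra.
- by rewrite sj mul0r addr0; apply: Hlam; rewrite mem_cat mem_filter sj eqxx sS.
Qed.

End Gordan.

Section MinimalNorm.
Variable n : nat.
Implicit Types (u v : 'rV[rat]_n) (S E : seq 'rV[rat]_n).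

Definition dot u v : rat := \sum_i u 0 i * v 0 i.

Lemma dotE u v : dot u v = (u *m v^T) 0 0.
Proof. by rewrite mxE; apply: eq_bigr => i _; rewrite mxE. Qed.
Lemma dotC u v : dot u v = dot v u.
Proof. by apply: eq_bigr => i _; rewrite mulrC. Qed.
Lemma dotDl u v w : dot (u + v) w = dot u w + dot v w.
Proof. by rewrite !dotE mulmxDl mxE. Qed.
Lemma dotZl a u v : dot (a *: u) v = a * dot u v.
Proof. by rewrite !dotE -scalemxAl mxE. Qed.
Lemma dotDr u v w : dot u (v + w) = dot u v + dot u w.
Proof. by rewrite dotC dotDl !(dotC u). Qed.
Lemma dotZr a u v : dot u (a *: v) = a * dot u v.
Proof. by rewrite dotC dotZl dotC. Qed.
Lemma dot_ge0 u : 0 <= dot u u.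
Proof. by apply: sumr_ge0 => i _; rewrite -expr2 sqr_ge0. Qed.
Lemma dot_eq0 u : dot u u <= 0 -> u = 0.
Proof.
move=> u0; have /eqP : dot u u = 0 by apply/eqP; rewrite eq_le u0 dot_ge0.
rewrite psumr_eq0 => [/allP H|i _]; last by rewrite -expr2 sqr_ge0.
apply/rowP => i; have := H i; rewrite mem_index_enum => /(_ isT) /=.
by rewrite -expr2 sqrf_eq0 mxE => /eqP.
Qed.

(** The minimiser is the orthogonal projection of [mu0] on the span of E, computed from a row basis
    B; its Gram matrix is invertible because the form is definite over the rationals. *)
Lemma min_norm_affine E mu0 : (forall t, t \in E -> dot t mu0 = 1) ->
  exists2 lam, forall t, t \in E -> dot t lam = 1 &
    forall mu, (forall t, t \in E -> dot t mu = 1) -> dot lam lam <= dot mu mu.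
Proof.
move=> H0; pose T : 'M[rat]_(size E, n) := \matrix_(i < size E) nth 0 E i.
pose B := row_base T; have Bfree : row_free B := row_base_free T.
have BB : B *m B^T \in unitmx.
  rewrite -row_free_unit -kermx_eq0; apply/eqP/row_matrixP => i; rewrite row0.
  have : row i (kermx (B *m B^T)) *m (B *m B^T) = 0 by rewrite -row_mul mulmx_ker row0.
  move: (row i _) => x xBB; have : dot (x *m B) (x *m B) <= 0.
    by rewrite dotE trmx_mul mulmxA -(mulmxA x) xBB mul0mx mxE.
  by move/dot_eq0/eqP; rewrite mulmx_free_eq0 // => /eqP.
have orth w : (forall t, t \in E -> dot t w = 0) -> B *m w^T = 0.
  move=> Hw; have TW : T *m w^T = 0.
    apply/matrixP => i k; rewrite ord1 [RHS]mxE -(Hw (nth 0 E i)) ?mem_nth // mxE.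
    by apply: eq_bigr => l _; rewrite !mxE.
  have /submxP [Y ->] : (B <= T)%MS by rewrite eq_row_base.
  by rewrite -mulmxA TW mulmx0.
pose y := mu0 *m B^T *m invmx (B *m B^T); pose lam := y *m B.
have Hlam : (mu0 - lam) *m B^T = 0.
  by rewrite mulmxBl -(mulmxA y) /y mulmxKV // subrr.
have sol t : t \in E -> dot t lam = 1.
  move=> tE; have : dot t (mu0 - lam) = 0.
    have /submxP [Y Et] : (t <= B)%MS.
      rewrite eq_row_base; have it := etrans (index_mem t E) tE.
      by have := row_sub (Ordinal it) T; rewrite rowK /= nth_index.
    by rewrite dotC dotE Et trmx_mul mulmxA Hlam mul0mx mxE.
  by rewrite dotDr -scaleN1r dotZr H0 // mulN1r => /eqP; rewrite subr_eq0 => /eqP.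
exists lam => // mu Hmu.
have perp : dot lam (mu - lam) = 0.
  rewrite dotE /lam -mulmxA (orth (mu - lam)) ?mulmx0 ?mxE // => t tE.
  by rewrite dotDr -scaleN1r dotZr sol // Hmu // mulN1r subrr.
have {1 2}-> : mu = (mu - lam) + lam by rewrite subrK.
move: (mu - lam) perp => w perp.
by rewrite dotDl !dotDr (dotC w lam) perp addr0 add0r lerDr dot_ge0.
Qed.

Definition feasible S E lam :=
  (forall s, s \in S -> 1 <= dot s lam) /\ (forall t, t \in E -> dot t lam = 1).

(* Drop one inequality; if the minimiser of the relaxed problem violates it, it is active at the *)
(* minimiser of the original one. *)
Lemma min_norm_feasible S E mu0 : feasible S E mu0 ->
  exists2 lam, feasible S E lam & forall mu, feasible S E mu -> dot lam lam <= dot mu mu.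
Proof.
elim: S => [|s S IH] in E mu0 *.
  move=> [_ /min_norm_affine [lam H1 H2]]; exists lam; first by split.
  by move=> mu [_ /H2].
have drop E' mu : feasible (s :: S) E' mu -> 1 <= dot s mu /\ feasible S E' mu.
  move=> [H1 H2]; split; first by apply: H1; rewrite mem_head.
  by split=> // t tS; apply: H1; rewrite inE tS orbT.
move=> F0; have [_ /IH [p Fp pmin]] := drop _ _ F0.
have [sp|sp] := leP 1 (dot s p).
  exists p; last by move=> mu /drop[_ /pmin].
  by case: Fp => H1 H2; split=> // t; rewrite inE => /orP[/eqP->|/H1].
have cross q : feasible (s :: S) E q ->
    exists r, feasible S (s :: E) r /\ dot r r <= dot q q.
  (* The parameter at which the segment from p to q meets the hyperplane where the constraint s is
     active; by convexity the norm there is at most that of q. *)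
  move=> /drop [sq Fq]; pose t := (1 - dot s p) / (dot s q - dot s p).
  have d0 : 0 < dot s q - dot s p by lra.
  have t0 : 0 <= t by rewrite divr_ge0 //; lra.
  have t1 : t <= 1 by rewrite ler_pdivrMr //; lra.
  have lin v : dot v ((1 - t) *: p + t *: q) = (1 - t) * dot v p + t * dot v q.
    by rewrite dotDr !dotZr.
  exists ((1 - t) *: p + t *: q); split; first split.
  - by move=> v vS; have := proj1 Fp _ vS; have := proj1 Fq _ vS; rewrite lin; nra.
  - move=> v; rewrite inE lin => /orP[/eqP->|vE].
      by rewrite /t; field; rewrite lt0r_neq0.
    by rewrite (proj2 Fp _ vE) (proj2 Fq _ vE); lra.
  - have := pmin _ Fq; rewrite lin (dotC _ p) (dotC _ q) !lin (dotC q p).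
    have : 0 <= dot p p - 2 * dot p q + dot q q.
      have := dot_ge0 (p + (-1) *: q); rewrite dotDl !dotDr !dotZl !dotZr (dotC q p); lra.
    move: (dot p p) (dot p q) (dot q q) => a b c abc ac.
    have t1' : 0 <= 1 - t by lra.
    have H1 := mulr_ge0 (mulr_ge0 t0 t1') abc.
    have H2 : 0 <= (1 - t) * (c - a) by apply: mulr_ge0; lra.
    rewrite -subr_ge0; apply: le_trans (addr_ge0 H1 H2) _.
    by rewrite le_eqVlt; apply/orP; left; apply/eqP; ring.
have [r [Fr _]] := cross _ F0; have [lam [L1 L2] lmin] := IH _ _ Fr.
exists lam.
  split=> v; last by move=> vE; apply: L2; rewrite inE vE orbT.
  by rewrite inE => /orP[/eqP->|/L1//]; rewrite L2 ?mem_head.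
by move=> mu /cross [r' [/lmin ? ?]]; lra.
Qed.

End MinimalNorm.

(** * The Hilbert-Mumford criterion *)

Section RelatedMinors.
Variables (K : fieldType) (F : closedFieldType) (G : K * F -> Prop) (hG : partial_hom G).
Variables (g m N : nat) (AK : 'M[K]_g) (A : 'M[F]_g).
Variables (RK : 'I_N -> Mon g m -> K) (R : 'I_N -> Mon g m -> F).
Hypotheses (GA : forall i j, G (AK i j, A i j)) (GR : forall i e, G (RK i e, R i e)).

Lemma phom_sign b : G ((-1) ^+ b, (-1) ^+ b).
Proof. by apply: phomX => //; apply: (phomN hG (phom1 hG)). Qed.

Lemma phom_det n (B : 'M[K]_n) (C : 'M[F]_n) : (forall i j, G (B i j, C i j)) ->
  G (\det B, \det C).
Proof.
move=> H; apply: phom_sum => // s _.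
by apply: phomM2 => //; [exact: phom_sign | exact: phom_prod].
Qed.

Lemma phom_symcoef (e' e : Mon g m) : G (symcoef AK e' e, symcoef A e' e).
Proof. by apply: phom_sum => // t _; apply: phom_prod. Qed.

Lemma phom_actR i e : G (actR AK RK i e, actR A R i e).
Proof. by apply: phom_sum => // e' _; apply: (phomM hG (GR _ _) (phom_symcoef _ _)). Qed.

Lemma phom_minor kappa : G (minor RK kappa, minor R kappa).
Proof. by apply: phom_det => i j; rewrite !mxE. Qed.

End RelatedMinors.

Section Smith.
Variables (K : fieldType) (F : closedFieldType) (G : K * F -> Prop) (hG : partial_hom G).
Hypothesis place : forall x, (exists c, G (x, c)) \/ x != 0 /\ G (x^-1, 0).
Variable n : nat.

Definition finite_entry (_ _ : 'I_n) (x : K) := exists c, G (x, c).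

Lemma finite_entry_closed : op_closed finite_entry.
Proof.
split=> [i j|i|i j c d [x cx] [y dy]|i j c [x cx]|i j k c d [x cx] [y dy]].
- by exists 0; exact: phom0.
- by exists 1; exact: phom1.
- by exists (x + y); exact: (phomD hG cx dy).
- by exists (- x); exact: (phomN hG cx).
- by exists (x * y); exact: (phomM hG cx dy).
Qed.

(** A pivot of least value divides all candidate entries within the valuation ring, so elimination
    gives the decomposition X = L^-1 D k with L and k invertible over that ring. *)
Lemma place_smith (X : 'M[K]_n) : X \in unitmx ->
  exists (L k : 'M[K]_n) (d : 'rV[K]_n), [/\ op_unit finite_entry L, op_unit finite_entry k,
    forall j, d 0 j != 0 & L *m X = diag_mx d *m k].
Proof.
move=> uX; have cl := finite_entry_closed.
have [M A [x0 x0A nz]|L [U [s [uL uU Hs]]]] := elimination cl cl uX.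
  pose S := [seq x <- enum A | M x.1 x.2 != 0].
  have memS x : (x \in S) = (x \in A) && (M x.1 x.2 != 0) by rewrite mem_filter mem_enum andbC.
  pose le (x y : 'I_n * 'I_n) := exists c, G (M y.1 y.2 / M x.1 x.2, c).
  have [x y|||[i j] /=] := @seq_least _ le S.
  - rewrite !memS /le => /andP[_ nx] /andP[_ ny].
    case: (place (M y.1 y.2 / M x.1 x.2)) => [|[_ H]]; [by left | right].
    by exists 0; rewrite -invf_div.
  - move=> x y z; rewrite !memS => /andP[_ nx] /andP[_ ny] _ [c Hc] [d Hd]; exists (d * c).
    by have := phomM2 hG Hd Hc; rewrite mulrA divfK.
  - by apply/eqP => S0; have := memS x0; rewrite S0 x0A nz.
  - rewrite memS /= => /andP[Aij nij] H; exists i, j; split=> //.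
      move=> i' Ai'; have [z|nz'] := eqVneq (M i' j) 0; first by exists 0; rewrite z mul0r; exact: phom0.
      by apply: (H (i', j)); rewrite memS Ai'.
    move=> j' Aj'; have [z|nz'] := eqVneq (M i j') 0; first by exists 0; rewrite z mul0r; exact: phom0.
    by apply: (H (i, j')); rewrite memS Aj'.
have [U' [oU oU' UU' U'U]] := uU.
pose Mo := L *m X *m U; pose d : 'rV[K]_n := \row_i Mo i (s i).
have MoE : Mo = diag_mx d *m perm_mx s.
  apply/matrixP => i j; rewrite mul_diag_mx [RHS]mxE [X in X * _]mxE.
  rewrite [X in _ * X]mxE [X in _ * X]mxE eq_sym -Hs -/Mo; case: (eqVneq (Mo i j) 0) => [->|].
    by rewrite mulr0.
  by rewrite {1}/Mo Hs => /eqP <-; rewrite mulr1.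
have perm_fin (t : 'S_n) : op_matrix finite_entry (perm_mx t).
  move=> i j; rewrite !mxE; exists ((t i == j)%:R).
  by case: eqP => _; [exact: phom1 | exact: phom0].
exists L, (perm_mx s *m U'), d; split=> //.
- apply: op_unit_mul => //; last by exists U.
  by exists (perm_mx s^-1); rewrite -!perm_mxM mulgV mulVg perm_mx1; split.
- by move=> j; rewrite mxE Hs.
- by rewrite mulmxA -MoE /Mo -mulmxA UU' mulmx1.
Qed.

Lemma reduce_mx (M : 'M[K]_n) : op_matrix finite_entry M ->
  exists Mb : 'M[F]_n, forall i j, G (M i j, Mb i j).
Proof.
move=> HM; have /fin_all_exists [f Hf] (x : 'I_n * 'I_n) : exists c, G (M x.1 x.2, c).
  by have [c] := HM x.1 x.2; exists c.
by exists (\matrix_(i, j) f (i, j)) => i j; rewrite mxE; exact: (Hf (i, j)).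
Qed.

Lemma reduce_unit (M : 'M[K]_n) : op_unit finite_entry M ->
  exists Mb : 'M[F]_n, Mb \in unitmx /\ forall i j, G (M i j, Mb i j).
Proof.
move=> [M' [/reduce_mx [Mb HM] /reduce_mx [Mb' HM'] MM' _]].
exists Mb; split=> //; suff /mulmx1_unit[] : Mb *m Mb' = 1%:M by [].
apply/matrixP => i j; apply: (phom_eq hG (a := (M *m M') i j)).
  by rewrite !mxE; apply: phom_sum => // k _; exact: phomM2.
by rewrite MM' !mxE; case: eqP => _; [exact: phom1 | exact: phom0].
Qed.

End Smith.

(** * The generic point of SL and its specialisations *)

Section GenericMatrix.
Variables (F : closedFieldType) (g : nat).
Let D := {mpoly F[g.+1 * g.+1]}.
Let K := {fraction D}.
Local Notation "p %:F" := (@tofrac D p) (format "p %:F").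

Definition generic_mx : 'M[D]_g.+1 := \matrix_(i, j) 'X_(mxvec_index i j).
(** Dividing one row of the generic matrix by its determinant gives determinant 1, and at a point A
    of SL the result still specialises to A. *)
Definition generic_SL : 'M[K]_g.+1 :=
  diag_mx (\row_i (if i == ord0 then ((\det generic_mx)%:F)^-1 else 1)) *m
  map_mx (@tofrac D) generic_mx.
Definition mx_point (A : 'M[F]_g.+1) (k : 'I_(g.+1 * g.+1)) : F := mxvec A 0 k.
Definition fconst (c : F) : K := (c%:MP)%:F.

Lemma meval_generic A i j : (generic_mx i j).@[mx_point A] = A i j.
Proof. by rewrite mxE mevalXU /mx_point mxvecE. Qed.

Lemma meval_det_generic A : (\det generic_mx).@[mx_point A] = \det A.
Proof.
rewrite -det_map_mx; congr (\det _); apply/matrixP => i j.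
by rewrite mxE /= meval_generic.
Qed.

Lemma det_generic_neq0 : \det generic_mx != 0.
Proof.
have := meval_det_generic 1%:M; rewrite det1 => H.
by apply/eqP => d0; move: H; rewrite d0 meval0 => /esym/eqP; rewrite oner_eq0.
Qed.

Lemma det_generic_SL : \det generic_SL = 1.
Proof.
rewrite det_mulmx det_diag (bigD1 ord0) //= mxE eqxx big1 ?mulr1 => [|i /negPf i0].
  by rewrite det_map_mx mulVf // tofrac_eq0 det_generic_neq0.
by rewrite mxE i0.
Qed.

(** The local ring at the point A together with its evaluation map. *)
Definition specializes A (x : K * F) := exists n d : D,
  [/\ d.@[mx_point A] != 0, x.1 * d%:F = n%:F & x.2 * d.@[mx_point A] = n.@[mx_point A]].

Lemma specializes_hom A : partial_hom (specializes A).
Proof.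
split.
- by exists 1, 1; rewrite !meval1 oner_eq0 /= !mul1r.
- move=> [a c] [a' c'] [n [d [/= d0 an cn]]] [n' [d' [/= d0' an' cn']]].
  exists (n * d' - n' * d), (d * d'); rewrite !mevalM !mevalB !mevalM mulf_neq0 //=.
  by split=> //; rewrite ?tofracB ?tofracM -?an -?an' -?cn -?cn'; ring.
- move=> [a c] [a' c'] [n [d [/= d0 an cn]]] [n' [d' [/= d0' an' cn']]].
  exists (n * n'), (d * d'); rewrite !mevalM mulf_neq0 //=.
  by split=> //; rewrite ?tofracM -?an -?an' -?cn -?cn'; ring.
- move=> c [n [d [/= d0]]]; rewrite mul0r => /esym/eqP; rewrite tofrac_eq0 => /eqP ->.
  by rewrite meval0 => /eqP; rewrite mulf_eq0 (negPf d0) orbF => /eqP.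
Qed.

Lemma specializes_const A c : specializes A (fconst c, c).
Proof. by exists c%:MP, 1; rewrite meval1 oner_eq0 mevalC /fconst /= !mulr1. Qed.

Lemma specializes_generic A : \det A = 1 -> forall i j, specializes A (generic_SL i j, A i j).
Proof.
move=> dA i j; rewrite /generic_SL mul_diag_mx mxE mxE [X in _ * X]mxE; case: eqP => _.
  exists (generic_mx i j), (\det generic_mx).
  rewrite meval_det_generic dA oner_eq0 meval_generic /= mulr1 mulrAC mulVf ?mul1r //.
  by rewrite tofrac_eq0 det_generic_neq0.
by exists (generic_mx i j), 1; rewrite meval1 oner_eq0 meval_generic /= !mul1r !mulr1.
Qed.

End GenericMatrix.

Section HilbertMumford.
Variables (F : closedFieldType) (g m N : nat) (R : 'I_N -> Mon g.+1 m -> F).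
Let K := {fraction {mpoly F[g.+1 * g.+1]}}.

Hypothesis R0 : zero_in_orbit_closure R.

Let RK : 'I_N -> Mon g.+1 m -> K := fun i e => fconst g (R i e).

(** The ring generated by the constants and the Plücker coordinates of the generic orbit point, with
    the values that its elements take at the point 0. *)
Inductive orbit_germ : K * F -> Prop :=
| og_const c : orbit_germ (fconst g c, c)
| og_pluecker kappa : orbit_germ (pluecker (actR (generic_SL F g) RK) kappa, 0)
| og_add x y : orbit_germ x -> orbit_germ y -> orbit_germ (x + y)
| og_mul x y : orbit_germ x -> orbit_germ y -> orbit_germ (x * y).

Lemma orbit_germ_poly x : orbit_germ x -> exists P, [/\ polyfun P, P (fun=> 0) = x.2 &
  forall A, \det A = 1 -> specializes A (x.1, P (pluecker (actR A R)))].
Proof.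
elim=> [c|kappa|{}x y _ [P [hP P0 PA]] _ [Q [hQ Q0 QA]]|{}x y _ [P [hP P0 PA]] _ [Q [hQ Q0 QA]]].
- exists (fun=> c); split=> //; first exact: pf_const.
  by move=> A _; exact: specializes_const.
- exists (fun z => z kappa); split=> //; first exact: pf_coord.
  move=> A dA; rewrite /pluecker /=; case: ifP => _; last exact: (phom0 (specializes_hom A)).
  apply: phom_minor; first exact: specializes_hom.
  move=> i e; apply: phom_actR; [exact: specializes_hom | exact: specializes_generic |].
  by move=> i' e'; exact: specializes_const.
- exists (fun z => P z + Q z); split; [exact: pf_add | by rewrite P0 Q0 |].
  by move=> A dA; exact: (phomD (specializes_hom A) (PA A dA) (QA A dA)).
- exists (fun z => P z * Q z); split; [exact: pf_mul | by rewrite P0 Q0 |].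
  by move=> A dA; exact: (phomM (specializes_hom A) (PA A dA) (QA A dA)).
Qed.

(** Single-valuedness is where the closure hypothesis enters: a polynomial in the Plücker
    coordinates that is zero at the generic point vanishes, by specialisation, on the whole orbit,
    hence at 0. *)
Lemma orbit_germ_hom : partial_hom orbit_germ.
Proof.
have cst c : fconst g c = tofrac (c%:MP) :> K by [].
split.
- by have := og_const 1; rewrite cst mpolyC1 tofrac1.
- move=> x y Gx Gy; have -> : x - y = x + (fconst g (- 1), - 1) * y.
    rewrite cst mpolyCN mpolyC1 tofracN tofrac1; case: x y {Gx Gy} => [a c] [b d].
    by congr (_, _) => /=; rewrite mulN1r.
  by apply: og_add => //; apply: og_mul => //; exact: og_const.
- exact: og_mul.
- move=> c /orbit_germ_poly [P [hP /= <- PA]]; apply: R0 => // A dA.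
  exact: (phom_fun (specializes_hom A) (PA A dA)).
Qed.

Lemma increasing_pluecker_minor (G : K * F -> Prop) (RX : 'I_N -> Mon g.+1 m -> K) :
  partial_hom G -> (forall kappa, G (pluecker RX kappa, 0)) ->
  forall kappa, G (minor RX kappa, 0).
Proof.
move=> hG H kappa; have [->|nz] := eqVneq (minor RX kappa) 0; first exact: phom0.
have [s inc] := injective_sort (minor_inj nz).
have := H [ffun k => kappa (s k)]; rewrite /pluecker inc -/(minor _ _) minor_perm.
move/(phomM2 hG (phom_sign hG s)); rewrite mulr0 mulrA -expr2 sqrr_sign.
by rewrite mul1r.
Qed.

(** At a place extending [orbit_germ] write the generic matrix as L^-1 D k. All minors for D k have
    value 0, since L has finite entries. They equal those for k times monomials in D, so whenever
    the minor for the reduction of k is nonzero the corresponding monomial in D has value 0.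
    [gordan] turns this into rational weights. *)
Lemma destabilizing_weights : exists2 k : 'M[F]_g.+1, k \in unitmx &
  exists lam : 'I_g.+1 -> rat, forall kappa, minor (actR k R) kappa != 0 ->
    0 < pairing (centered_weight kappa) lam.
Proof.
have [G [hG sub Ginv place]] := place_extension orbit_germ_hom
  (fun c => ex_intro _ (fconst g c) (og_const c)).
pose X := generic_SL F g; have dX : \det X = 1 by exact: det_generic_SL.
have [|L [k [d [uL uk d0 LX]]]] := place_smith hG place (X := X).
  by rewrite unitmxE dX unitr1.
have [kb [ukb Gk]] := reduce_unit hG uk; exists kb => //.
have GR i e : G (RK i e, R i e) by apply/sub/og_const.
have small kappa : G (minor (actR (diag_mx d) (actR k RK)) kappa, 0).
  rewrite -(eq_minor _ (actR_mul _ _ _)) -LX (eq_minor _ (actR_mul _ _ _)) minor_actR.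
  have [L' [oL _ _ _]] := uL; have [Lb GL] := reduce_mx oL.
  have -> : 0 = \sum_(f : {ffun 'I_N -> Mon g.+1 m}) 0 * \prod_k symcoef Lb (f k) (kappa k).
    by rewrite big1 // => f _; rewrite mul0r.
  apply: phom_sum => // f _; apply: phomM2 => //; last first.
    by apply: phom_prod => // j _; exact: phom_symcoef.
  apply: increasing_pluecker_minor => // kappa'.
  by apply: sub; exact: og_pluecker.
have smallwt kappa : minor (actR kb R) kappa != 0 -> G (\prod_j d 0 j ^+ exponent_sum kappa j, 0).
  move=> nz; have Gm : G (minor (actR k RK) kappa, minor (actR kb R) kappa).
    by apply: phom_minor => // i e; exact: phom_actR.
  have [nz' Gi] := Ginv _ _ Gm nz; have := phomM2 hG Gi (small kappa).
  rewrite minor_diag mulKf // mulr0 exchange_big /=.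
  by under eq_bigr => j _ do rewrite -expr_sum.
(* The generic matrix has determinant 1, so det D is inverse to a finite element. Multiplying by a
   power of this inverse subtracts mN from all exponents, which is the centering. *)
have Gd : exists c, G ((\prod_j d 0 j)^-1, c).
  have [L' [oL oL' LL' _]] := uL; have [Lb GL'] := reduce_mx oL'.
  have [k' [ok _ _ _]] := uk.
  have detd : (\prod_j d 0 j)^-1 = \det L' * \det k.
    have E : \det L = \prod_j d 0 j * \det k.
      transitivity (\det (L *m X)); last by rewrite LX det_mulmx det_diag.
      by rewrite [RHS]det_mulmx dX mulr1.
    apply: mulr1_eq; by rewrite mulrCA -E -det_mulmx (mulmx1C LL') det1.
  by exists (\det Lb * \det kb); rewrite detd; apply: phomM2 => //; exact: phom_det.
have [c Gc] := Gd.
pose Good (t : 'rV[int]_g.+1) := G (\prod_j d 0 j ^ t 0 j, 0).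
have [s t|||lam Hlam] := @gordan _ Good _ _
    [seq centered_weight kappa | kappa <- enum [pred kappa | minor (actR kb R) kappa != 0]].
- rewrite /Good => Gs Gt; have := phomM2 hG Gs Gt; rewrite mul0r -big_split /=.
  by congr (G (_, _)); apply: eq_bigr => j _; rewrite mxE expfzDr.
- rewrite /Good big1 => [G10|j _]; last by rewrite mxE expr0z.
  by have /eqP := phom_eq hG (phom1 hG) G10; rewrite oner_eq0.
- move=> t /mapP[kappa]; rewrite mem_enum inE => /smallwt sm ->.
  rewrite /Good; have := phomM2 hG (phomX hG g.+1 sm) (phomX hG (m * N) Gc).
  rewrite expr0n mul0r; congr (G (_, _)); rewrite exprVn -!prodrXl -prodfV -big_split /=.
  by apply: eq_bigr => j _; rewrite mxE expfzDr // -exprnN -exprnP (mulnC g.+1) -exprM.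
by exists lam => kappa nz; apply: Hlam; apply: map_f; rewrite mem_enum.
Qed.

End HilbertMumford.

(** * Kempf's optimal filtration *)

Section Weights.
Variables (g m N : nat).
Implicit Types (a b : 'rV[rat]_g) (kappa : {ffun 'I_N -> Mon g m}).

Definition mon_weight a (e : Mon g m) : rat := \sum_j a 0 j *+ expo e j.

Definition state_row kappa : 'rV[rat]_g := map_mx intr (centered_weight kappa).

Lemma mon_weight_tmon a (t : m.-tuple 'I_g) : mon_weight a (tmon t) = \sum_(i < m) a 0 (tnth t i).
Proof. by rewrite /mon_weight sum_tmon big_tuple. Qed.

Lemma sum_exponent a kappa :
  \sum_j a 0 j *+ exponent_sum kappa j = \sum_k mon_weight a (kappa k).
Proof. by rewrite exchange_big; apply: eq_bigr => j _; rewrite sumrMnr. Qed.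

Lemma dot_state a kappa : dot (state_row kappa) a =
  g%:R * (\sum_k mon_weight a (kappa k)) - (m * N)%:R * \sum_j a 0 j.
Proof.
rewrite -sum_exponent !mulr_sumr -sumrB; apply: eq_bigr => j _.
by rewrite !mxE rmorphB /= -!pmulrn -[a 0 j *+ _]mulr_natl !natrM; ring.
Qed.

Lemma dot_pairing kappa (lam : 'I_g -> rat) :
  dot (state_row kappa) (\row_j lam j) = pairing (centered_weight kappa) lam.
Proof. by apply: eq_bigr => j _; rewrite !mxE. Qed.

End Weights.

Section FilteredMatrices.
Variables (K : fieldType) (g : nat).
Implicit Types (a b c : 'rV[rat]_g) (A B : 'M[K]_g).

(** For a = b the invertible matrices of this kind form the parabolic subgroup of the weight
    filtration. *)
Definition filtered a b A := forall i j, A i j != 0 -> b 0 j <= a 0 i.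

Lemma det_neq0_perm n (A : 'M[K]_n) : \det A != 0 -> exists s : 'S_n, forall i, A i (s i) != 0.
Proof.
move=> dA; have /existsP [s /forallP Hs] : [exists s : 'S_n, [forall i, A i (s i) != 0]].
  apply: contraR dA => /existsPn H; rewrite /determinant big1 // => s _.
  have /forallPn [i] := H s; rewrite negbK => /eqP Ai.
  by rewrite (bigD1 i) //= Ai mul0r mulr0.
by exists s.
Qed.

(** A nonzero term of the determinant is a permutation along which the weights compare one by
    one. *)
Lemma filtered_sum a b A : A \in unitmx -> filtered a b A -> \sum_j b 0 j <= \sum_i a 0 i.
Proof.
rewrite unitmxE unitfE => /det_neq0_perm [s Hs] fA.
by rewrite (reindex_inj (@perm_inj _ s)) /=; apply: ler_sum => i _; exact: fA.
Qed.

Definition filtered_op a (i j : 'I_g) (x : K) := x = 0 \/ a 0 j <= a 0 i.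

Lemma filtered_op_closed a : op_closed (filtered_op a).
Proof.
split=> [i j|i|i j c d|i j c|i j k c d]; rewrite /filtered_op; [by left | by right | | |].
- by move=> [->|H] [->|H']; try (by right); rewrite addr0; left.
- by move=> [->|H]; [left; rewrite oppr0 | right].
- move=> [->|H]; first by left; rewrite mul0r.
  by move=> [->|H']; [left; rewrite mulr0 | right; exact: le_trans H' H].
Qed.

Lemma filtered_opP a A : op_matrix (filtered_op a) A <-> filtered a a A.
Proof.
split=> H i j; first by move=> nz; case: (H i j) => // Z; rewrite Z eqxx in nz.
by have [->|/H] := eqVneq (A i j) 0; [left | right].
Qed.

(** A pivot (i, j) with least a_i - a_j has a_i least in its column and a_j greatest in its row, so
    both sets of multipliers lie in the parabolic. *)
Lemma bruhat a A : A \in unitmx -> exists (L U : 'M[K]_g) (s : 'S_g),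
  [/\ op_unit (filtered_op a) L, op_unit (filtered_op a) U &
     forall i j, ((L *m A *m U) i j != 0) = (j == s i)].
Proof.
move=> uA; have cl := filtered_op_closed a; apply: elimination => // M S [x0 x0S nz].
pose s := [seq x <- enum S | M x.1 x.2 != 0].
have memS x : (x \in s) = (x \in S) && (M x.1 x.2 != 0) by rewrite mem_filter mem_enum andbC.
have [x y ? ?|x y z ? ? ?||[i j]] :=
    @seq_least _ (fun x y => a 0 x.1 - a 0 x.2 <= a 0 y.1 - a 0 y.2) s.
- by apply/orP; exact: le_total.
- exact: le_trans.
- by apply/eqP => s0; have := memS x0; rewrite s0 x0S nz.
rewrite memS /= => /andP[ijS nij] H; exists i, j; split=> // k kS.
  have [->|nz'] := eqVneq (M k j) 0; first by rewrite mul0r; left.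
  by right; have := H (k, j); rewrite memS kS => /(_ nz') /=; rewrite lerD2r.
have [->|nz'] := eqVneq (M i k) 0; first by rewrite mul0r; left.
by right; have := H (i, k); rewrite memS kS => /(_ nz') /=; rewrite lerD2l lerN2.
Qed.

Variables (m N : nat).
Implicit Types (R : 'I_N -> Mon g m -> K) (kappa : {ffun 'I_N -> Mon g m}).

Lemma filtered_symcoef a b A (e' e : Mon g m) : filtered a b A ->
  symcoef A e' e != 0 -> mon_weight b e' <= mon_weight a e.
Proof.
move=> fA /symcoef_neq0 [t [<- Ht]].
rewrite -(twordK e) !mon_weight_tmon; apply: ler_sum => i _.
exact: fA.
Qed.

(** Each surviving term of [minor_actR] comes from monomials whose b-weight is at most the a-weight
    of [kappa]; equal totals leave the centering unchanged. *)
Lemma filtered_minor a b A R : filtered a b A -> \sum_j a 0 j = \sum_j b 0 j ->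
  (forall f, minor R f != 0 -> 1 <= dot (state_row f) b) ->
  forall kappa, minor (actR A R) kappa != 0 -> 1 <= dot (state_row kappa) a.
Proof.
move=> fA sab H kappa; rewrite minor_actR => nz.
have [f /andP[nf /prodf_neq0 ns]] :
    exists f, (minor R f != 0) && (\prod_k symcoef A (f k) (kappa k) != 0).
  apply/existsP; apply: contraR nz => /existsPn nz; apply/eqP/big1 => f _; apply/eqP.
  by have := nz f; rewrite mulf_eq0 -negb_or negbK.
apply: le_trans (H f nf) _; rewrite !dot_state sab lerD2r ler_wpM2l ?ler0n //.
by apply: ler_sum => k _; apply: filtered_symcoef fA _; exact: ns.
Qed.

End FilteredMatrices.

Section OptimalFiltration.
Variables (K : fieldType) (g m N : nat) (R : 'I_N -> Mon g.+1 m -> K).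
Implicit Types (k h A : 'M[K]_g.+1) (kappa : {ffun 'I_N -> Mon g.+1 m}) (lam nu : 'rV[rat]_g.+1).

(** The bound 1, rather than mere positivity, fixes the scale of the weights so that minimising
    their norm makes sense. *)
Definition destabilizes k lam := k \in unitmx /\
  forall kappa, minor (actR k R) kappa != 0 -> 1 <= dot (state_row kappa) lam.

Lemma destabilizes_scale k (lam : 'I_g.+1 -> rat) : k \in unitmx ->
  (forall kappa, minor (actR k R) kappa != 0 -> 0 < pairing (centered_weight kappa) lam) ->
  exists lam', destabilizes k lam'.
Proof.
move=> uk H; pose p kappa := pairing (centered_weight kappa) lam.
pose c : rat := \sum_(kappa | minor (actR k R) kappa != 0) (p kappa)^-1.
exists (c *: \row_j lam j); split=> // kappa nz; have p0 := H _ nz.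
rewrite dotZr dot_pairing -/(p kappa) /c (bigD1 kappa) //= mulrDl mulVf ?lt0r_neq0 //.
rewrite lerDl; apply: mulr_ge0; last exact: ltW.
apply: sumr_ge0 => f /andP[nf _].
by rewrite invr_ge0 ltW // H.
Qed.

Definition optimal k lam := destabilizes k lam /\
  forall k' lam', destabilizes k' lam' -> dot lam lam <= dot lam' lam'.

(** The constraints on the weights depend on the basis only through its set of nonvanishing minors.
    There are finitely many such sets, so the least of their minimal norms is attained. *)
Lemma optimal_exists k lam : destabilizes k lam -> exists k lam, optimal k lam.
Proof.
pose state k := [set kappa | minor (actR k R) kappa != 0].
pose rows (T : {set {ffun 'I_N -> Mon g.+1 m}}) := [seq state_row kappa | kappa <- enum T].
pose achieved T := exists k lam, destabilizes k lam /\ T = state k.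
have feasP k' lam' : k' \in unitmx ->
    feasible (rows (state k')) [::] lam' <-> destabilizes k' lam'.
  move=> uk; split=> [[H _]|[_ H]]; split=> //.
    by move=> kappa nz; apply: H; apply: map_f; rewrite mem_enum inE.
  by move=> s /mapP[kappa]; rewrite mem_enum inE => /H ? ->.
have /fin_all_exists [f Hf] T : exists lamT, achieved T ->
    feasible (rows T) [::] lamT /\
    forall mu, feasible (rows T) [::] mu -> dot lamT lamT <= dot mu mu.
  have [[k' [lam' [D ET]]]|nA] := boolp.pselect (achieved T); last by exists 0.
  have [] := @min_norm_feasible _ (rows T) [::] lam'.
    by rewrite ET; apply/feasP => //; case: D.
  by move=> l Fl minl; exists l.
move=> D; pose s := [seq T <- enum predT | boolp.asbool (achieved T)].
have memS T : T \in s <-> achieved T.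
  by rewrite mem_filter mem_enum andbT; split=> /boolp.asboolP.
have [T T' ? ?|T T1 T2 ? ? ?||T] := @seq_least _ (fun T T' => dot (f T) (f T) <= dot (f T') (f T')) s.
- by apply/orP; exact: le_total.
- exact: le_trans.
- apply/eqP => s0; have : state k \in s by apply/memS; exists k, lam.
  by rewrite s0.
move=> /memS /[dup] aT [k0 [lam0 [[uk0 _] ET]]] minT; exists k0, (f T).
have [FT _] := Hf T aT; split; first by apply/feasP; rewrite -?ET.
move=> k' lam' D'; have aT' : achieved (state k') by exists k', lam'.
apply: le_trans (minT (state k') _) _; first exact/memS.
by apply: (proj2 (Hf _ aT')); apply/feasP => //; case: D'.
Qed.

(* Two optimal filtrations have a common adapted basis; by strict convexity of the norm they *)
(* carry the same weights there, so they coincide. *)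
Lemma optimal_invariant k lam h : optimal k lam -> h \in unitmx ->
  (forall kappa, minor (actR (k *m h) R) kappa != 0 -> minor (actR k R) kappa != 0) ->
  filtered lam lam (k *m h *m invmx k).
Proof.
move=> [[uk Dk] opt] uh Hh; have [A AE] : exists A, A = k *m h *m invmx k by exists (k *m h *m invmx k).
rewrite -AE.
have [|L [U [s [uL uU Hs]]]] := bruhat lam (A := A).
  by rewrite AE !unitmx_mul uk uh unitmx_inv.
have [L' [/filtered_opP oL oL' LL' L'L]] := uL; have [U' [oU /filtered_opP oU' UU' U'U]] := uU.
pose Pi := L *m A *m U; pose lams : 'rV[rat]_g.+1 := \row_i lam 0 (s i).
have Ak : A *m k = k *m h by rewrite AE mulmxKV.
(* This basis is adapted to both filtrations: it is a filtered change of k h, with weights [lam],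
   and equals Pi U^-1 k, with permuted weights [lams]. *)
pose k' := L *m (k *m h).
have uk' : k' \in unitmx by rewrite !unitmx_mul uk uh (proj1 (mulmx1_unit LL')).
have k'E : k' = Pi *m (U' *m k).
  by rewrite /k' -Ak /Pi !mulmxA -(mulmxA (L *m A)) UU' mulmx1.
have slam : \sum_j lams 0 j = \sum_j lam 0 j.
  by rewrite [RHS](reindex_inj (@perm_inj _ s)); apply: eq_bigr => j _; rewrite mxE.
have D1 : destabilizes k' lam.
  split=> // kappa; rewrite (eq_minor _ (actR_mul _ _ _)); move: kappa.
  by apply: (filtered_minor oL) => // kappa /Hh; exact: Dk.
have D2 : destabilizes k' lams.
  split=> // kappa; rewrite k'E (eq_minor _ (actR_mul _ _ _)); move: kappa.
  apply: (filtered_minor (a := lams) (b := lam)) => //.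
    by move=> i j; rewrite Hs => /eqP ->; rewrite mxE.
  move=> kappa; rewrite (eq_minor _ (actR_mul _ _ _)); move: kappa.
  exact: (filtered_minor oU').
have nlams : dot lams lams = dot lam lam.
  rewrite /dot [RHS](reindex_inj (@perm_inj _ s)); apply: eq_bigr => j _.
  by rewrite !mxE.
(* The midpoint of two distinct vectors of equal norm is shorter, which minimality excludes; hence
   [lam] and [lams] agree and [Pi] preserves the filtration. *)
have D3 : destabilizes k' (2^-1 *: (lam + lams)).
  split=> // kappa nz; have := proj2 D1 _ nz; have := proj2 D2 _ nz.
  by rewrite dotZr dotDr; lra.
have Elam : lam = lams.
  apply/eqP; rewrite -subr_eq0; apply/eqP/dot_eq0; rewrite -scaleN1r.
  have := opt _ _ D3.
  rewrite !(dotZl, dotZr, dotDl, dotDr) nlams (dotC lams lam); lra.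
have oPi : op_matrix (filtered_op lam) Pi.
  apply/filtered_opP => i j; rewrite Hs => /eqP ->.
  by rewrite {2}Elam mxE.
apply/filtered_opP; have -> : A = L' *m Pi *m U'.
  by rewrite /Pi !mulmxA L'L mul1mx -!mulmxA UU' mulmx1.
apply: op_matrix_mul; first exact: filtered_op_closed.
  by apply: op_matrix_mul => //; exact: filtered_op_closed.
exact/filtered_opP.
Qed.

(* The projectors onto the eigenlines of h are polynomials in h, hence preserve the filtration. *)
Lemma eigenbasis_destabilized k lam Q (eta : 'rV[K]_g.+1) : destabilizes k lam ->
  Q \in unitmx -> injective (eta 0) ->
  filtered lam lam (k *m (invmx Q *m diag_mx eta *m Q) *m invmx k) ->
  exists nu, destabilizes Q nu.
Proof.
move=> [uk Dk] uQ etaI filt.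
pose V := k *m invmx Q; pose W := Q *m invmx k.
have VW : V *m W = 1%:M by rewrite /V /W mulmxA mulmxKV // mulmxV.
have WV : W *m V = 1%:M by exact: mulmx1C.
pose A := V *m diag_mx eta *m W.
have AE : k *m (invmx Q *m diag_mx eta *m Q) *m invmx k = A by rewrite /A /V /W !mulmxA.
have cl := filtered_op_closed K lam; rewrite AE in filt.
have WkQ : W *m k = Q by rewrite /W mulmxKV.
clearbody V W.
have proj (s : seq 'I_g.+1) : op_matrix (filtered_op lam)
    (V *m diag_mx (\row_i \prod_(j <- s) (eta 0 i - eta 0 j)) *m W).
  elim: s => [|j s IH].
    have -> : \row_i \prod_(j <- [::]) (eta 0 i - eta 0 j) = const_mx 1.
      by apply/rowP => i; rewrite !mxE big_nil.
    by rewrite diag_const_mx mulmx1 VW; exact: op_matrix1.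
  have -> : V *m diag_mx (\row_i \prod_(j <- j :: s) (eta 0 i - eta 0 j)) *m W =
      (A - (eta 0 j)%:M) *m (V *m diag_mx (\row_i \prod_(j <- s) (eta 0 i - eta 0 j)) *m W).
    have -> : A - (eta 0 j)%:M = V *m diag_mx (\row_i (eta 0 i - eta 0 j)) *m W.
      have -> : diag_mx (\row_i (eta 0 i - eta 0 j)) = diag_mx eta - (eta 0 j)%:M.
        rewrite -diag_const_mx -linearB /=; congr diag_mx.
        by apply/rowP => i; rewrite !mxE.
      by rewrite mulmxBr mulmxBl -scalemx1 -scalemxAr -scalemxAl mulmx1 VW.
    rewrite !mulmxA -(mulmxA _ W V) WV mulmx1 -(mulmxA V (diag_mx _) (diag_mx _)) mulmx_diag; congr (_ *m diag_mx _ *m _).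
    by apply/rowP => i; rewrite !mxE big_cons.
  apply: op_matrix_mul => //; apply/filtered_opP => i l.
  rewrite mxE [X in _ + X]mxE [X in - X]mxE; case: (eqVneq i l) => [->//|ne].
  rewrite mulr0n subr0 => nz.
  exact: filt.
have key c i j : V i c != 0 -> W c j != 0 -> lam 0 j <= lam 0 i.
  move=> Vi Wj; have /filtered_opP := proj [seq c' <- enum 'I_g.+1 | c' != c]; apply.
  rewrite mxE (bigD1 c) //= big1 ?addr0 => [|c' c'c].
    rewrite mul_mx_diag !mxE mulf_neq0 // mulf_neq0 // big_seq prodf_seq_neq0.
    apply/allP => c' _; rewrite mem_filter; apply/implyP => /andP[c'c _].
    by rewrite subr_eq0; apply: contraNneq c'c => /etaI ->.
  rewrite mul_mx_diag !mxE [X in _ * X * _](_ : _ = 0) ?mulr0 ?mul0r //.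
  apply/eqP; rewrite prodf_seq_eq0; apply/hasP; exists c'; last by rewrite /= subrr.
  by rewrite mem_filter c'c mem_enum.
have /fin_all_exists [f Hf] c : exists i, V i c != 0 /\ forall i', V i' c != 0 -> lam 0 i <= lam 0 i'.
  have [x y ? ?|x y z ? ? ?||i] :=
    @seq_least _ (fun i i' => lam 0 i <= lam 0 i') [seq i <- enum 'I_g.+1 | V i c != 0].
  - by apply/orP; exact: le_total.
  - exact: le_trans.
  - apply/eqP => s0; have := congr1 (fun M : 'M_g.+1 => M c c) WV.
    rewrite !mxE eqxx big1 => [/esym/eqP|i _]; first by rewrite oner_eq0.
    have [->|nz] := eqVneq (V i c) 0; first by rewrite mulr0.
    by have : i \in [seq i <- enum 'I_g.+1 | V i c != 0];
      [rewrite mem_filter nz mem_enum | rewrite s0].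
  rewrite mem_filter => /andP[nz _] H; exists i; split=> // i' nz'.
  by apply: H; rewrite mem_filter nz' mem_enum.
(* The least weight in the support of column c of V. By [key] it also dominates the weights in row c
   of W, so V and W are both filtered, which forces equal total weights. *)
pose nu : 'rV[rat]_g.+1 := \row_c lam 0 (f c); exists nu.
have fV : filtered lam nu V by move=> i c nz; rewrite mxE; exact: (proj2 (Hf c)).
have fW : filtered nu lam W by move=> c j nz; rewrite mxE; apply: key nz; exact: (proj1 (Hf c)).
have [uV uW] := mulmx1_unit VW.
have snu : \sum_j nu 0 j = \sum_j lam 0 j.
  by apply/eqP; rewrite eq_le (filtered_sum uV fV) (filtered_sum uW fW).
split=> // kappa.
rewrite -WkQ (eq_minor _ (actR_mul _ _ _)); move: kappa.
exact: (filtered_minor fW).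
Qed.

End OptimalFiltration.

(** The fourth hypothesis holds when h = Q^-1 diag(eta) Q fixes the Hilbert point up to a scalar.
    Then h preserves the optimal filtration, and distinct eigenvalues make the eigenbasis adapted to
    it. *)
Theorem multiplicity_free_criterion (F : closedFieldType) (g m N : nat)
    (R : 'I_N -> Mon g.+1 m -> F) (Q : 'M[F]_g.+1) (eta : 'rV[F]_g.+1) :
  Q \in unitmx -> injective (eta 0) -> (forall j, eta 0 j != 0) ->
  (forall A kappa, minor (actR A (actR (invmx Q *m diag_mx eta *m Q) R)) kappa != 0 ->
     minor (actR A R) kappa != 0) ->
  zero_in_orbit_closure R -> exists nu, destabilizes R Q nu.
Proof.
move=> uQ etaI eta0 Hh R0.
have [k1 uk1 [lam1 H1]] := destabilizing_weights R0.
have [lam' D'] := destabilizes_scale uk1 H1.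
have [k [lam opt]] := optimal_exists D'.
apply: (eigenbasis_destabilized (proj1 opt) uQ etaI).
apply: (optimal_invariant opt).
  rewrite !unitmx_mul unitmx_inv uQ andbT /= unitmxE det_diag unitfE.
  by apply/prodf_neq0 => j _.
by move=> kappa; rewrite (eq_minor _ (actR_mul _ _ _)); exact: Hh.
Qed.

(** * Representatives of the restriction map *)

Section RowOperations.
Variables (K : fieldType) (g m : nat).

Definition row_comb N N' (C : 'M[K]_(N, N')) (R : 'I_N' -> Mon g m -> K) (i : 'I_N) (e : Mon g m) :=
  \sum_k C i k * R k e.

Definition independent_rows N (R : 'I_N -> Mon g m -> K) :=
  forall lam : 'I_N -> K, (forall e, \sum_i lam i * R i e = 0) -> forall i, lam i = 0.

Lemma actR_row_comb N N' (C : 'M[K]_(N, N')) (A : 'M[K]_g) R :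
  actR A (row_comb C R) =2 row_comb C (actR A R).
Proof.
move=> i e; rewrite /actR /row_comb; under eq_bigr => e' _ do rewrite mulr_suml.
rewrite exchange_big; apply: eq_bigr => k _; rewrite mulr_sumr.
by apply: eq_bigr => e' _; rewrite mulrA.
Qed.

Lemma minor_row_comb N (C : 'M[K]_N) R (kappa : {ffun 'I_N -> Mon g m}) :
  minor (row_comb C R) kappa = \det C * minor R kappa.
Proof.
rewrite /minor -det_mulmx; congr (\det _); apply/matrixP => i k; rewrite !mxE.
by apply: eq_bigr => j _; rewrite mxE.
Qed.

Lemma same_kernel_row_comb N N' (R : 'I_N -> Mon g m -> K) (R' : 'I_N' -> Mon g m -> K) :
  (forall c : Mon g m -> K, (forall i, \sum_e R' i e * c e = 0) ->
     forall i, \sum_e R i e * c e = 0) -> exists C, R =2 row_comb C R'.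
Proof.
move=> ker; pose M N0 (R0 : 'I_N0 -> Mon g m -> K) : 'M[K]_(N0, #|Mon g m|) :=
  \matrix_(i, e) R0 i (enum_val e).
have sumM N0 (R0 : 'I_N0 -> Mon g m -> K) i n (Z : 'M_(_, n)) j :
    (M _ R0 *m Z) i j = \sum_e R0 i e * Z (enum_rank e) j.
  rewrite mxE (reindex_onto (@enum_rank _) enum_val) => [|e _]; last exact: enum_valK.
  by apply: eq_big => [e|e _]; [rewrite enum_rankK eqxx | rewrite mxE enum_rankK].
have /submxP [C EC] : (M _ R <= M _ R')%MS.
  rewrite submxE; apply/eqP/matrixP => i j; rewrite sumM [RHS]mxE.
  apply: (ker (fun e => cokermx (M _ R') (enum_rank e) j)) => i'.
  by rewrite -(sumM _ R' i' _ (cokermx _)) mulmx_coker mxE.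
exists C => i e; have := congr1 (fun Z : 'M__ => Z i (enum_rank e)) EC.
rewrite !mxE enum_rankK => ->; apply: eq_bigr => k _.
by rewrite mxE enum_rankK.
Qed.

Lemma row_comb_mul N N' N'' (C : 'M[K]_(N, N')) (C' : 'M_(N', N'')) R :
  row_comb C (row_comb C' R) =2 row_comb (C *m C') R.
Proof.
move=> i e; rewrite /row_comb; under eq_bigr => k _ do rewrite mulr_sumr.
rewrite exchange_big; apply: eq_bigr => j _; rewrite mxE mulr_suml.
by apply: eq_bigr => k _; rewrite mulrA.
Qed.

Lemma independent_row_comb N N' (C : 'M[K]_(N, N')) (R : 'I_N -> Mon g m -> K)
    (R' : 'I_N' -> Mon g m -> K) : independent_rows R -> R =2 row_comb C R' -> row_free C.
Proof.
move=> indR RC; rewrite -kermx_eq0; apply/eqP/row_matrixP => i; rewrite row0.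
have : row i (kermx C) *m C = 0 by rewrite -row_mul mulmx_ker row0.
move: (row i _) => v vC; apply/rowP => k; rewrite mxE.
apply: (indR (v 0)) => e; under eq_bigr => j _ do rewrite RC mulr_sumr.
rewrite exchange_big big1 // => j _.
under eq_bigr => a _ do rewrite mulrA.
by rewrite -mulr_suml; have := congr1 (fun Z : 'rV_N' => Z 0 j) vC; rewrite !mxE => ->; rewrite mul0r.
Qed.

(** Representatives of the restriction map differ by an invertible matrix, which multiplies all
    minors by one scalar; this also identifies N. *)
Lemma same_kernel N N' (R : 'I_N -> Mon g m -> K) (R' : 'I_N' -> Mon g m -> K) :
  independent_rows R -> independent_rows R' ->
  (forall c : Mon g m -> K, (forall i, \sum_e R i e * c e = 0) <->
     (forall i, \sum_e R' i e * c e = 0)) ->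
  N = N' /\ exists2 C : 'M[K]_(N, N'), row_free C & R =2 row_comb C R'.
Proof.
move=> iR iR' ker.
have [C EC] := same_kernel_row_comb (fun c => proj2 (ker c)).
have [C' EC'] := same_kernel_row_comb (fun c => proj1 (ker c)).
have fC := independent_row_comb iR EC; have fC' := independent_row_comb iR' EC'.
split; last by exists C.
apply/eqP; rewrite eqn_leq -{1}(eqP fC) rank_leq_col /=.
by rewrite -{1}(eqP fC') rank_leq_col.
Qed.

Lemma independent_actR N (A : 'M[K]_g) (R : 'I_N -> Mon g m -> K) : A \in unitmx ->
  independent_rows R -> independent_rows (actR A R).
Proof.
move=> uA iR lam H; apply: iR => e.
have -> : \sum_i lam i * R i e = \sum_i lam i * actR (invmx A) (actR A R) i e.
  by apply: eq_bigr => i _; rewrite -actR_mul mulVmx // actR1.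
rewrite /actR; under eq_bigr => i _ do rewrite mulr_sumr.
rewrite exchange_big big1 // => e' _ /=.
under eq_bigr => i _ do rewrite mulrA.
by rewrite -mulr_suml H mul0r.
Qed.

Lemma kernel_actR N (A : 'M[K]_g) (R : 'I_N -> Mon g m -> K) i (c : Mon g m -> K) :
  \sum_e actR A R i e * c e = \sum_e' R i e' * \sum_e symcoef A e' e * c e.
Proof.
rewrite /actR; under eq_bigr => e _ do rewrite mulr_suml.
rewrite exchange_big; apply: eq_bigr => e' _; rewrite mulr_sumr.
by apply: eq_bigr => e _; rewrite mulrA.
Qed.

End RowOperations.

Lemma vanishes_change_basis (F : fieldType) g m (B W : 'I_g -> 'M[F]_(g.-1, 3)) (Q : 'M[F]_g)
    (c : Mon g m -> F) : (forall j, W j = \sum_k Q j k *: B k) ->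
  vanishes_on_C W c <-> vanishes_on_C B (fun e' => \sum_e symcoef Q e' e * c e).
Proof.
move=> WQ.
have cW j i : cpoly W j i = \sum_k (Q j k)%:P * cpoly B k i.
  rewrite /cpoly WQ; have co x : (\sum_k Q j k *: B k) i x = \sum_k Q j k * B k i x.
    by rewrite summxE; apply: eq_bigr => k _; rewrite mxE.
  rewrite !co rmorph_sum !scaler_suml -!big_split; apply: eq_bigr => k _ /=.
  by rewrite !mul_polyC !scalerDr !scalerA polyCM mul_polyC.
have E i : \sum_e c e *: \prod_j cpoly W j i ^+ expo e j =
    \sum_e' (\sum_e symcoef Q e' e * c e) *: \prod_j cpoly B j i ^+ expo e' j.
  under eq_bigr => e _.
    under eq_bigr => j _ do rewrite cW.
    rewrite (subst_monomial polyC Q (fun k => cpoly B k i) e) scaler_sumr.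
    over.
  rewrite exchange_big; apply: eq_bigr => e' _; rewrite scaler_suml.
  by apply: eq_bigr => e _; rewrite mul_polyC scalerA mulrC.
by split=> H i; have := H i; rewrite -E.
Qed.

(** * The canonical embedding of the rosary *)

Section Fourier.
Variables (F : fieldType) (l : nat) (z : F) (zP : l.-primitive_root z).

Lemma prim_expr_modl a k : z ^+ (a * (k %% l)) = z ^+ (a * k).
Proof. by rewrite mulnC exprM prim_expr_mod // -exprM mulnC. Qed.

(** The v_a are the coefficients of a polynomial of degree below l that has the l distinct roots
    z^k. *)
Lemma fourier_injective (v : 'I_l -> F) :
  (forall k, (k < l)%N -> \sum_(a < l) v a * z ^+ (a * k) = 0) -> forall a, v a = 0.
Proof.
move=> H; have l0 := prim_order_gt0 zP.
pose p := \poly_(i < l) (if insub i is Some a then v a else 0).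
have pE a : p`_(val a) = v a by rewrite coef_poly ltn_ord valK.
suff p0 : p = 0 by move=> a; rewrite -pE p0 coef0.
apply: (@roots_geq_poly_eq0 _ p [seq z ^+ k | k <- iota 0 l]).
- apply/allP => x /mapP[k]; rewrite mem_iota => /andP[_ kl] ->; apply/eqP.
  rewrite (@horner_coef_wide _ l) ?size_poly // -[RHS](H k kl).
  by apply: eq_bigr => a _; rewrite pE -exprM mulnC.
- rewrite map_inj_in_uniq ?iota_uniq // => i j; rewrite !mem_iota => /andP[_ il] /andP[_ jl] /eqP.
  by rewrite (eq_prim_root_expr zP) !modn_small // => /eqP.
- by rewrite size_map size_iota size_poly.
Qed.

End Fourier.

Section Letters.
Variable l : nat.

Definition vy : 'I_(l + l).+1 := ord0.
Definition vw (a : 'I_l) : 'I_(l + l).+1 := lift ord0 (lshift l a).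
Definition vw' (b : 'I_l) : 'I_(l + l).+1 := lift ord0 (rshift l b).

Definition on_letters (T : Type) (ty : T) (tw tw' : nat -> T) (j : 'I_(l + l).+1) : T :=
  if unlift ord0 j is Some j' then
    match split j' with inl a => tw a | inr b => tw' b end else ty.

Lemma on_y T (ty : T) tw tw' : on_letters ty tw tw' vy = ty.
Proof. by rewrite /on_letters unlift_none. Qed.
Lemma on_w T (ty : T) tw tw' a : on_letters ty tw tw' (vw a) = tw a.
Proof. by rewrite /on_letters liftK (unsplitK (inl _ a)). Qed.
Lemma on_w' T (ty : T) tw tw' b : on_letters ty tw tw' (vw' b) = tw' b.
Proof. by rewrite /on_letters liftK (unsplitK (inr _ b)). Qed.

Lemma letterP (P : 'I_(l + l).+1 -> Prop) :
  P vy -> (forall a, P (vw a)) -> (forall b, P (vw' b)) -> forall j, P j.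
Proof.
move=> Py Pw Pw' j; have [k ->|->//] := unliftP ord0 j.
by rewrite -(splitK k); case: split => a; [exact: Pw | exact: Pw'].
Qed.

Lemma sum_letters (V : nmodType) (f : 'I_(l + l).+1 -> V) :
  \sum_j f j = f vy + (\sum_a f (vw a) + \sum_b f (vw' b)).
Proof. by rewrite big_ord_recl big_split_ord. Qed.

End Letters.

Section Rosary.
Variables (F : fieldType) (l : nat) (z : F) (zP : l.-primitive_root z).
Local Notation n := (l + l)%N.

(* Eigenbasis of omega: y is u_i^-1 du_i on every component; w_a and w'_b are the discrete Fourier *)
(* transforms of the sections x_i supported at a single tacnode, over even and odd tacnodes. *)
Definition zexp (i : nat) (j : 'I_n.+1) : nat := on_letters 0%N (muln^~ (uphalf i)) (muln^~ i./2) j.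
Definition uexp (i : nat) (j : 'I_n.+1) : nat :=
  on_letters 1%N (fun=> (odd i).*2) (fun=> (~~ odd i).*2) j.
Definition eigensection (j : 'I_n.+1) : 'M[F]_(n.+1.-1, 3) :=
  \matrix_(i, c) (z ^+ zexp i j *+ ((c : nat) == uexp i j)).

Lemma ordS_facts (i : 'I_n) : (val (ordS i) = i.+1 \/ i.+1 = n /\ val (ordS i) = 0)%N.
Proof.
have := ltn_ord i; rewrite leq_eqVlt => /orP[/eqP E|lt].
  by right; split; rewrite //= E modnn.
by left; rewrite /= modn_small.
Qed.

Lemma eigensection_omega j : is_omega (eigensection j).
Proof.
move=> i s t; rewrite /res_inf /res_zero /eigensection !mxE /=.
have [Ei|[Ei E0]] : (i.+1 %% n = i.+1 \/ i.+1 = n /\ i.+1 %% n = 0)%N by exact: ordS_facts.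
  rewrite Ei; move: j; apply: letterP => [|a|b]; rewrite /zexp /uexp ?on_y ?on_w ?on_w' /=.
  - by rewrite addNr.
  - by rewrite uphalf_half; case: (odd i) => /=; rewrite ?mulr0n ?mulr1n; ring.
  - by rewrite ?uphalf_half; case: (odd i) => /=; rewrite ?mulr0n ?mulr1n ?add0n; ring.
rewrite E0; have oi : odd i by lia.
have hi : uphalf i = l by lia.
move: j; apply: letterP => [|a|b]; rewrite /zexp /uexp ?on_y ?on_w ?on_w' /= ?oi ?hi /=.
- by rewrite addNr.
- by rewrite muln0 (mulnC a) exprM (prim_expr_order zP) expr1n; ring.
- by rewrite !mulr0n; ring.
Qed.

(** On the even components y, the w_a and the w'_b occupy different columns, so the three families
    separate; Fourier inversion over these components separates the members of each. *)
Lemma eigensection_independent (v : 'I_n.+1 -> F) :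
  \sum_j v j *: eigensection j = 0 -> forall j, v j = 0.
Proof.
move=> H; have l0 := prim_order_gt0 zP.
have Hk k c : (k < l)%N -> \sum_j v j * (z ^+ zexp k.*2 j *+ ((c : 'I_3) == uexp k.*2 j :> nat)) = 0.
  move=> kl; have kn : (k.*2 < n)%N by lia.
  have := congr1 (fun M : 'M__ => M (Ordinal kn) c) H; rewrite summxE mxE => H0; rewrite -[RHS]H0.
  by apply: eq_bigr => j _; rewrite !mxE.
apply: letterP => [|a|b].
- have := Hk 0%N c1 l0; rewrite sum_letters /zexp /uexp on_y on_y.
  rewrite big1 => [|a _]; last by rewrite !on_w /= mulr0n mulr0.
  rewrite big1 => [|a _]; last by rewrite !on_w' /= mulr0n mulr0.
  by rewrite !addr0 expr0 mulr1.
- move: a; apply: (fourier_injective zP) => k kl; have := Hk k c0 kl.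
  rewrite sum_letters /zexp /uexp on_y on_y mulr0n mulr0 add0r.
  rewrite addrC big1 => [|a _]; last by rewrite !on_w' odd_double mulr0n mulr0.
  rewrite add0r => H0; rewrite -[RHS]H0; apply: eq_bigr => a _.
  by rewrite !on_w odd_double uphalf_double mulr1n.
- move: b; apply: (fourier_injective zP) => k kl; have := Hk k c2 kl.
  rewrite sum_letters /zexp /uexp on_y on_y mulr0n mulr0 add0r.
  rewrite big1 => [|a _]; last by rewrite !on_w odd_double mulr0n mulr0.
  rewrite add0r => H0; rewrite -[RHS]H0; apply: eq_bigr => a _.
  by rewrite !on_w' odd_double doubleK mulr1n.
Qed.

Lemma change_basis (B : 'I_n.+1 -> 'M[F]_(n.+1.-1, 3)) : omega_basis B ->
  exists2 Q : 'M[F]_n.+1, Q \in unitmx & forall j, eigensection j = \sum_k Q j k *: B k.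
Proof.
move=> [_ _ span]; have /fin_all_exists [q Hq] j := span _ (eigensection_omega j).
exists (\matrix_(j, k) q j k) => [|j]; last by rewrite Hq; apply: eq_bigr => k _; rewrite mxE.
rewrite -row_free_unit -kermx_eq0; apply/eqP/row_matrixP => i; rewrite row0.
have : row i (kermx (\matrix_(j, k) q j k)) *m \matrix_(j, k) q j k = 0.
  by rewrite -row_mul mulmx_ker row0.
move: (row i _) => v vq; apply/rowP => j; rewrite [RHS]mxE; move: j.
apply: eigensection_independent; under eq_bigr => j _ do rewrite Hq scaler_sumr.
rewrite exchange_big big1 // => k _ /=; under eq_bigr => j _ do rewrite scalerA.
rewrite -scaler_suml; have := congr1 (fun Z : 'rV__ => Z 0 k) vq; rewrite !mxE.
move=> vk; rewrite (_ : \sum_i0 _ = 0) ?scale0r // -[RHS]vk.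
by apply: eq_bigr => j _; rewrite mxE.
Qed.

Lemma cpoly_eigensection j i : cpoly eigensection j i = z ^+ zexp i j *: 'X^(uexp i j).
Proof.
rewrite /cpoly /eigensection !mxE /=; have : (uexp i j <= 2)%N.
  by move: j; apply: letterP => [|a|b]; rewrite /uexp ?on_y ?on_w ?on_w' //; case: odd.
case: (uexp i j) => [|[|[|//]]] _;
  by rewrite ?mulr0n ?mulr1n ?scale0r ?addr0 ?add0r ?expr0 ?alg_polyC ?polyC0 ?add0r ?expr1.
Qed.

End Rosary.

(** * Sections of O(m) *)

Section DegreeSums.
Variables (g m : nat).

Definition degree_sum (phi : 'I_g -> nat) (e : Mon g m) : nat := (\sum_j expo e j * phi j)%N.

Lemma sum_expo (e : Mon g m) : (\sum_j expo e j)%N = m.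
Proof. exact: (eqP (valP e)). Qed.

Lemma degree_sum_tmon phi (t : m.-tuple 'I_g) : degree_sum phi (tmon t) = (\sum_(j <- t) phi j)%N.
Proof. by rewrite -sum_count_mem; apply: eq_bigr => j _; rewrite tmonE. Qed.

Lemma degree_sumD phi psi e : degree_sum (fun j => phi j + psi j)%N e =
  (degree_sum phi e + degree_sum psi e)%N.
Proof. by rewrite -big_split; apply: eq_bigr => j _; rewrite mulnDr. Qed.

Lemma degree_sumMr phi k e : degree_sum (fun j => phi j * k)%N e = (degree_sum phi e * k)%N.
Proof. by rewrite /degree_sum big_distrl; apply: eq_bigr => j _; rewrite mulnA. Qed.

Lemma degree_sum_const k e : degree_sum (fun=> k) e = (m * k)%N.
Proof. by rewrite /degree_sum -big_distrl sum_expo. Qed.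

Lemma eq_degree_sum phi psi e : phi =1 psi -> degree_sum phi e = degree_sum psi e.
Proof. by move=> H; apply: eq_bigr => j _; rewrite H. Qed.

Lemma prod_scaled_monomials (F : fieldType) (z : F) (a b : 'I_g -> nat) e :
  \prod_j (z ^+ a j *: 'X^(b j)) ^+ expo e j = z ^+ degree_sum a e *: 'X^(degree_sum b e).
Proof.
under eq_bigr => j _ do rewrite exprZn -!exprM !(mulnC _ (expo e j)).
rewrite scaler_prod; congr (_ *: _); by rewrite -expr_sum.
Qed.

End DegreeSums.

Section Sections.
Variables (F : fieldType) (l m : nat) (z : F).
Local Notation n := (l + l)%N.
Local Notation mon := (Mon n.+1 m).
Implicit Types (e : mon) (c : mon -> F).

Definition alpha e := degree_sum (on_letters 0%N id (fun=> 0%N)) e.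
Definition beta e := degree_sum (on_letters 0%N (fun=> 0%N) id) e.
Definition order0 e := degree_sum (uexp 0) e.
Definition charsum e := ((alpha e + beta e) %% l)%N.

Lemma degree_zexp i e : degree_sum (zexp i) e = (alpha e * uphalf i + beta e * i./2)%N.
Proof.
rewrite /alpha /beta -!degree_sumMr -degree_sumD; apply: eq_degree_sum.
by apply: letterP => [|a|b]; rewrite /zexp ?on_y ?on_w ?on_w' ?mul0n ?addn0.
Qed.

Lemma degree_uexp i e :
  (degree_sum (uexp i) e + (if odd i then order0 e else 2 * m - order0 e) = 2 * m)%N.
Proof.
have le2 : (order0 e <= 2 * m)%N.
  rewrite mulnC -(degree_sum_const 2 e); apply: leq_sum => j _; apply: leq_mul => //.
  by move: j; apply: letterP => [|a|b]; rewrite /uexp ?on_y ?on_w ?on_w'.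
case: ifP => oi.
  rewrite -degree_sumD [RHS]mulnC -(degree_sum_const 2 e); apply: eq_degree_sum.
  by apply: letterP => [|a|b]; rewrite /uexp ?on_y ?on_w ?on_w' ?oi.
rewrite (_ : degree_sum _ e = order0 e) ?subnKC //; apply: eq_degree_sum.
by apply: letterP => [|a|b]; rewrite /uexp ?on_y ?on_w ?on_w' ?oi.
Qed.

Lemma order0_le e : (order0 e < (2 * m).+1)%N.
Proof. have := degree_uexp 0 e; rewrite /= -/(order0 e) => H; lia. Qed.

Lemma order0E e : (order0 e = expo e (vy l) + (\sum_b expo e (vw' b)) * 2)%N.
Proof.
rewrite /order0 /degree_sum sum_letters /uexp !on_y muln1 big_distrl; congr (_ + _)%N.
rewrite big1 ?add0r => [|a _]; last by rewrite on_w muln0.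
by apply: eq_bigr => b _; rewrite on_w'.
Qed.

(* On P_i the monomial e restricts to z^(charsum e * i./2) u^(order0 e) if i is even, and to *)
(* z^(alpha e) z^(charsum e * i./2) u^(2m - order0 e) if i is odd. By Fourier inversion in i./2, *)
(* vanishing on C amounts to two linear conditions for each value of (order0, charsum). At orders *)
(* 0, 1, 2m-1, 2m they are proportional (gluing at the tacnodes), so row_sector keeps one of them. *)
Definition sector : finType := ('I_(2 * m).+1 * 'I_l * bool)%type.

Definition sector_entry (x : sector) e : F :=
  ((order0 e == x.1.1) && (charsum e == x.1.2))%:R * (if x.2 then z ^+ alpha e else 1).

Hypothesis zP : l.-primitive_root z.

Lemma sector_coef c (i : 'I_n) (r : 'I_(2 * m).+1) :
  (\sum_e c e *: \prod_j cpoly (eigensection z) j i ^+ expo e j)`_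
      (if odd i then 2 * m - r else r)%N =
  \sum_(s < l) (\sum_e c e * sector_entry (r, s, odd i) e) * z ^+ (s * i./2).
Proof.
have l0 := prim_order_gt0 zP.
under eq_bigr => e _.
  under eq_bigr => j _ do rewrite cpoly_eigensection.
  rewrite prod_scaled_monomials scalerA; over.
rewrite coef_sum.
under [RHS]eq_bigr => s _ do rewrite mulr_suml.
rewrite exchange_big; apply: eq_bigr => e _ /=.
have sl : (charsum e < l)%N by rewrite ltn_mod.
rewrite (bigD1 (Ordinal sl)) //= big1 ?addr0 => [|s]; last first.
  by rewrite -val_eqE eq_sym => /negPf /= ne; rewrite /sector_entry /= ne andbF mul0r mulr0 mul0r.
rewrite coefZ coefXn /sector_entry /= eqxx andbT -!mulrA; congr (_ * _).
have -> : ((if odd i then 2 * m - r else r) == degree_sum (uexp i) e)%N = (order0 e == r).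
  by have := degree_uexp i e; have := order0_le e; have := ltn_ord r; case: ifP => _; lia.
rewrite mulrC; congr (_ * _); rewrite degree_zexp (mulnC (charsum e)) (prim_expr_modl zP) uphalf_half.
by case: odd; rewrite ?mul1r -?exprD; congr (_ ^+ _); rewrite ?add0n; nia.
Qed.

Lemma vanishes_sectors c :
  vanishes_on_C (eigensection z) c <-> forall x, \sum_e c e * sector_entry x e = 0.
Proof.
split=> [H [[r s] b]|H i]; last first.
  apply/polyP => k; rewrite coef0; have [km|km] := leqP k (2 * m).
    have lr : ((if odd i then 2 * m - k else k) < (2 * m).+1)%N by case: ifP; lia.
    have := sector_coef c i (Ordinal lr); rewrite /= (_ : (if odd i then _ else _) = k); last first.
      by case: ifP => ->; lia.
    by move=> ->; rewrite big1 // => s _; rewrite H mul0r.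
  rewrite coef_sum big1 // => e _.
  under eq_bigr => j _ do rewrite cpoly_eigensection.
  rewrite prod_scaled_monomials !coefZ coefXn.
  suff /negPf -> : k != degree_sum (uexp i) e by rewrite !mulr0.
  by have := degree_uexp i e; lia.
move: s; apply: (fourier_injective zP) => k kl.
have kn : (k.*2 + b < n)%N by case: (b); lia.
have := sector_coef c (Ordinal kn) r; rewrite H coef0 /=.
have -> : odd (k.*2 + b) = b by case: (b); lia.
have -> : ((k.*2 + b)./2 = k)%N by case: (b); lia.
by move/esym.
Qed.

Definition row_sector : {pred sector} := [pred x : sector | x.2 ==> (1 < x.1.1 < 2 * m - 1)%N].
Definition row_entry (i : 'I_#|row_sector|) e : F := sector_entry (enum_val i) e.

(** Order at most 1 leaves no w' letter, so alpha is the character modulo l; order at least 2m-1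
    leaves no w letter, so alpha is 0. *)
Lemma extreme_alpha e : ~~ (1 < order0 e < 2 * m - 1)%N ->
  z ^+ alpha e = (if (order0 e <= 1)%N then z ^+ charsum e else 1).
Proof.
have [p pE] : exists p, p = (\sum_a expo e (vw a))%N by exists (\sum_a expo e (vw a))%N.
have [q qE] : exists q, q = (\sum_b expo e (vw' b))%N by exists (\sum_b expo e (vw' b))%N.
have oE : (order0 e = expo e (vy l) + q * 2)%N by rewrite order0E qE.
have mE : (m = expo e (vy l) + (p + q))%N.
  by rewrite -{1}(sum_expo e) sum_letters pE qE.
have aE : alpha e = (\sum_a expo e (vw a) * a)%N.
  rewrite /alpha /degree_sum sum_letters on_y muln0 add0r [X in _ + X]big1 ?addr0.
    by apply: eq_bigr => a _; rewrite on_w.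
  by move=> b _; rewrite on_w' muln0.
have bE : beta e = (\sum_b expo e (vw' b) * b)%N.
  rewrite /beta /degree_sum sum_letters on_y muln0 add0r [X in X + _]big1 ?add0r.
    by apply: eq_bigr => a _; rewrite on_w'.
  by move=> b _; rewrite on_w muln0.
case: leqP => [o1 _|o2 o3].
  have /eqP : (q = 0)%N by lia.
  rewrite qE sum_nat_eq0 => /forallP b0; have -> : charsum e = (alpha e %% l)%N.
    by rewrite /charsum bE big1 ?addn0 // => b _; rewrite (eqP (b0 b)).
  by rewrite prim_expr_mod.
have /eqP : (p = 0)%N by lia.
rewrite pE sum_nat_eq0 => /forallP a0; rewrite aE big1 // => a _.
by rewrite (eqP (a0 a)).
Qed.

Lemma vanishes_rows c :
  vanishes_on_C (eigensection z) c <-> forall i, \sum_e row_entry i e * c e = 0.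
Proof.
rewrite vanishes_sectors; split=> H x.
  by rewrite -[RHS](H (enum_val x)); apply: eq_bigr => e _; rewrite mulrC.
have Hx y : y \in row_sector -> \sum_e c e * sector_entry y e = 0.
  move=> ry; rewrite -[RHS](H (enum_rank_in ry y)); apply: eq_bigr => e _.
  by rewrite /row_entry enum_rankK_in // mulrC.
have [/Hx //|] := boolP (x \in row_sector).
case: x => [[r s] b]; rewrite inE /= negb_imply => /andP[-> nr].
have Hf := Hx (r, s, false) isT.
transitivity ((if (r <= 1)%N then z ^+ s else 1) * \sum_e c e * sector_entry (r, s, false) e).
  rewrite mulr_sumr.
  apply: eq_bigr => e _; rewrite [RHS]mulrCA; congr (_ * _); rewrite /sector_entry /=.
  case: eqP => /= [oe|_]; last by rewrite !mul0r mulr0.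
  case: eqP => /= [se|_]; last by rewrite !mul0r mulr0.
  by rewrite !mul1r mulr1 extreme_alpha ?oe // -se.
by rewrite Hf mulr0.
Qed.

(** The last condition makes each 2x2 block, with columns (1, z^alpha), nonsingular. *)
Definition section_basis (T : sector -> mon) :=
  (forall x, x \in row_sector -> order0 (T x) = x.1.1 /\ charsum (T x) = x.1.2) /\
  forall r s, (1 < val r < 2 * m - 1)%N ->
    z ^+ alpha (T (r, s, false)) != z ^+ alpha (T (r, s, true)).

Lemma section_basis_separates T (lam : 'I_#|row_sector| -> F) : section_basis T ->
  (forall y, y \in row_sector -> \sum_i lam i * row_entry i (T y) = 0) -> forall i, lam i = 0.
Proof.
move=> [Tsec Tsep] H.
pose v (x : sector) := \sum_(i | enum_val i == x) lam i.
have vE i : v (enum_val i) = lam i.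
  rewrite /v (bigD1 i) //= big1 ?addr0 // => j /andP[/eqP /enum_val_inj -> ].
  by rewrite eqxx.
have v0 x : x \notin row_sector -> v x = 0.
  by move=> nx; apply: big1 => i /eqP ix; case/negP: nx; rewrite -ix; exact: enum_valP.
have sumE y : y \in row_sector ->
    v (y.1, false) + v (y.1, true) * z ^+ alpha (T y) = 0.
  move=> ry; rewrite -[RHS](H y ry); have [oy cy] := Tsec y ry.
  rewrite (partition_big (fun i => enum_val i) predT) //=.
  under eq_bigr => x _.
    rewrite (eq_bigr (fun i => lam i * sector_entry x (T y))); last by move=> i /eqP <-.
    rewrite -mulr_suml -/(v x); over.
  have ne : (y.1, true) != (y.1, false) by rewrite xpair_eqE andbF.
  rewrite (bigD1 (y.1, false)) //= (bigD1 (y.1, true)) ?ne //= [X in _ + (_ + X)]big1 ?addr0.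
    by rewrite /sector_entry /= oy cy !eqxx !mul1r mulr1.
  move=> x /andP[n1 n2]; rewrite /sector_entry oy cy.
  case: andP => [[/eqP E1 /eqP E2]|_]; last by rewrite mul0r mulr0.
  have E : x.1 = y.1.
    by rewrite [x.1]surjective_pairing [y.1]surjective_pairing; congr (_, _); apply/val_inj.
  by move: n1 n2; case: x E {E1 E2} => [x1 [|]] /= -> /eqP // _ /eqP.
have vf x1 : v (x1, true) = 0 -> v (x1, false) = 0.
  by move=> vt; have := sumE (x1, false) isT; rewrite /= vt mul0r addr0.
have vt x1 : v (x1, true) = 0.
  have [mid|/v0 //] := boolP ((x1, true) \in row_sector).
  have := sumE _ mid; have := sumE (x1, false) isT; rewrite /= => Hf Ht.
  have /Tsep : (1 < val x1.1 < 2 * m - 1)%N by [].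
  move=> /(_ x1.2); rewrite -surjective_pairing => ne.
  have : v (x1, true) * (z ^+ alpha (T (x1, false)) - z ^+ alpha (T (x1, true))) = 0.
    rewrite mulrBr; apply/eqP; rewrite subr_eq0; apply/eqP/(addrI (v (x1, false))).
    by rewrite Hf Ht.
  by move/eqP; rewrite mulf_eq0 subr_eq0 (negPf ne) orbF => /eqP.
by move=> i; rewrite -vE; case: (enum_val i) => [x1 [|]]; [|apply: vf].
Qed.

Lemma section_basis_independent T : section_basis T -> independent_rows row_entry.
Proof. by move=> HT lam H; apply: (section_basis_separates HT) => y _. Qed.

Definition basis_tuple (T : sector -> mon) : {ffun 'I_#|row_sector| -> mon} :=
  [ffun k => T (enum_val k)].

Lemma section_basis_minor T : section_basis T -> minor row_entry (basis_tuple T) != 0.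
Proof.
move=> HT; rewrite -unitfE -unitmxE -row_free_unit -kermx_eq0.
apply/eqP/row_matrixP => i; rewrite row0.
set M := \matrix_(_, _) _.
have : row i (kermx M) *m M = 0 by rewrite -row_mul mulmx_ker row0.
move: (row i _) => v vM; apply/rowP => k; rewrite mxE; move: k.
apply: (section_basis_separates HT) => y ry.
have := congr1 (fun Z : 'rV__ => Z 0 (enum_rank_in ry y)) vM; rewrite !mxE => H.
rewrite -[RHS]H; apply: eq_bigr => j _.
by rewrite mxE ffunE enum_rankK_in.
Qed.

Lemma sum_basis_tuple T (V : nmodType) (f : mon -> V) :
  \sum_k f (basis_tuple T k) = \sum_(x in row_sector) f (T x).
Proof. by rewrite [RHS]big_enum_val; apply: eq_bigr => k _; rewrite ffunE. Qed.

(** A nonzero term of the determinant matches monomials with rows. This gives a bound valid for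
    every monomial basis, not only for the constructed ones. *)
Lemma minor_orders kappa : minor row_entry kappa != 0 ->
  exists s : 'S_#|row_sector|, forall i, order0 (kappa (s i)) = (enum_val i).1.1.
Proof.
move=> /det_neq0_perm [s Hs]; exists s => i; have := Hs i.
rewrite mxE /row_entry /sector_entry; case: (order0 _ =P _) => // _.
by rewrite mul0r eqxx.
Qed.

Lemma sum_row_sector (V : nmodType) (f : sector -> V) : \sum_(x in row_sector) f x =
  \sum_r \sum_s (f (r, s, false) + f (r, s, true) *+ (1 < val r < 2 * m - 1)%N).
Proof.
rewrite big_mkcond /= pair_bigA /=.
rewrite [RHS](eq_bigr (fun p => \sum_(b : bool) if (p, b) \in row_sector then f (p, b) else 0)).
  by rewrite pair_bigA /=; apply: eq_bigr => [[p b]] _.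
move=> [r s] _ /=; rewrite big_bool /= inE /= addrC; congr (_ + _).
by case: ifP => _; rewrite ?mulr1n.
Qed.

End Sections.

(** * Monomial bases *)

(** [b] is a minimiser away from c, so it is at most the average -phi(c)/(k+1) of the other
    values. *)
Lemma zero_sum_minima k (phi : 'I_k.+2 -> rat) : \sum_a phi a = 0 ->
  exists a0, [/\ phi a0 <= 0, forall a, phi a0 <= phi a &
    forall c, exists b, [/\ b != c, k.+1%:R * phi b <= - phi c & phi b <= - phi a0]].
Proof.
move=> S0; have [a0 _ min0] := @arg_minP _ _ _ ord0 xpredT phi isT.
have {}min0 a : phi a0 <= phi a by exact: min0.
have a00 : phi a0 <= 0.
  have : \sum_(a < k.+2) phi a0 <= \sum_a phi a by apply: ler_sum => a _.
  by rewrite S0 sumr_const card_ord pmulrn_lle0.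
exists a0; split=> // c.
have [c' c'c] : exists c' : 'I_k.+2, c' != c.
  by have [->|c0] := eqVneq c ord0; [exists ord_max | exists ord0; rewrite eq_sym].
have [b bc minb] := @arg_minP _ _ _ c' (fun a => a != c) phi c'c; exists b.
have Hb : k.+1%:R * phi b <= - phi c.
  have : \sum_(a | a != c) phi b <= \sum_(a | a != c) phi a by apply: ler_sum => a /minb.
  rewrite sumr_const cardC1 card_ord /= mulr_natl; move: S0; rewrite (bigD1 c) //= => S0; lra.
split=> //; have [ca|ca] := eqVneq c a0.
  have [//|] := leP (phi b) (- phi a0); rewrite ca in Hb => Hlt.
  have : 1 * phi b <= k.+1%:R * phi b by rewrite ler_wpM2r ?ler1n //; lra.
  lra.
by have := minb a0; rewrite eq_sym => /(_ ca); lra.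
Qed.

Lemma sum_reflect m (V : nmodType) (h : nat -> V) :
  \sum_(r < (2 * m).+1) h r = h m + \sum_(r < m) (h r + h (2 * m - r)%N).
Proof.
rewrite -(big_mkord xpredT h) (@big_cat_nat _ _ _ m) //=; last by lia.
rewrite [X in _ + X]big_ltn; last by lia.
rewrite big_mkord addrCA; congr (_ + _); rewrite big_split; congr (_ + _).
rewrite big_nat_rev /= -{1}[m.+1]addn0 addnC -{1}[m.+1]add0n big_addn.
rewrite (_ : ((2 * m).+1 - m.+1 = m)%N); last by lia.
rewrite big_mkord; apply: eq_bigr => r _; congr h; lia.
Qed.

Section Words.
Variables (k m : nat).
Local Notation l := k.+2.
Local Notation n := (l + l)%N.
Local Notation mon := (Mon n.+1 m).
Implicit Types (A B : seq 'I_l) (s : 'I_l).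

Definition letters A B : seq 'I_n.+1 :=
  nseq (m - (size A + size B)) (vy l) ++ [seq vw a | a <- A] ++ [seq vw' b | b <- B].
Definition word_mon A B : mon := tmon (insubd (nseq_tuple m (vy l)) (letters A B)).

Lemma val_letters A B : (size A + size B <= m)%N ->
  val (insubd (nseq_tuple m (vy l)) (letters A B)) = letters A B.
Proof.
by move=> H; rewrite val_insubd !size_cat size_nseq !size_map subnK // eqxx.
Qed.

Lemma word_degree_sum phi A B : (size A + size B <= m)%N -> degree_sum phi (word_mon A B) =
  ((m - (size A + size B)) * phi (vy l) + (\sum_(a <- A) phi (vw a) + \sum_(b <- B) phi (vw' b)))%N.
Proof.
move=> H; rewrite degree_sum_tmon val_letters // !big_cat !big_map; congr (_ + _)%N.
by rewrite big_nseq iter_addn_0 mulnC.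
Qed.

Lemma word_weight (nu : 'rV[rat]_n.+1) A B : (size A + size B <= m)%N ->
  mon_weight nu (word_mon A B) = nu 0 (vy l) *+ (m - (size A + size B)) +
    (\sum_(a <- A) nu 0 (vw a) + \sum_(b <- B) nu 0 (vw' b)).
Proof.
move=> H; rewrite /mon_weight sum_tmon val_letters // !big_cat !big_map; congr (_ + _).
by rewrite big_nseq iter_addr_0.
Qed.

Lemma val_Zp_sum A : val (\sum_(a <- A) a) = ((\sum_(a <- A) val a) %% l)%N.
Proof.
elim: A => [|a A IH]; first by rewrite !big_nil mod0n.
by rewrite !big_cons /= IH modnDmr.
Qed.

Lemma word_order A B : (size A + size B <= m)%N ->
  (order0 (word_mon A B) + size A = m + size B)%N.
Proof.
move=> H; rewrite /order0 word_degree_sum // /uexp on_y muln1.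
rewrite big1 => [|a _]; last by rewrite on_w.
rewrite (eq_bigr (fun=> 2%N)) => [|b _]; last by rewrite on_w'.
by rewrite big_const_seq count_predT iter_addn_0; lia.
Qed.

Lemma word_alpha A B : (size A + size B <= m)%N -> alpha (word_mon A B) = (\sum_(a <- A) val a)%N.
Proof.
move=> H; rewrite /alpha word_degree_sum // on_y muln0 add0n.
rewrite [X in (_ + X)%N]big1 ?addn0 => [|b _]; last by rewrite on_w'.
by apply: eq_bigr => a _; rewrite on_w.
Qed.

Lemma word_beta A B : (size A + size B <= m)%N -> beta (word_mon A B) = (\sum_(b <- B) val b)%N.
Proof.
move=> H; rewrite /beta word_degree_sum // on_y muln0 add0n.
rewrite [X in (X + _)%N]big1 ?add0n => [|b _]; last by rewrite on_w.
by apply: eq_bigr => a _; rewrite on_w'.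
Qed.

Definition mid (r : nat) : bool := (1 < r < 2 * m - 1)%N.

(* [C r s b] lists the w-letters and the w'-letters of the b-th basis monomial of order r and *)
(* character s; the remaining letters are y. *)
Definition admissible (C : nat -> 'I_l -> bool -> seq 'I_l * seq 'I_l) := forall r s b,
  (r <= 2 * m)%N -> (b ==> mid r) ->
  [/\ (size (C r s b).1 + size (C r s b).2 <= m)%N,
      (r + size (C r s b).1 = m + size (C r s b).2)%N,
      \sum_(a <- (C r s b).1) a + \sum_(b <- (C r s b).2) b = s &
      b -> \sum_(a <- (C r s false).1) a != \sum_(a <- (C r s true).1) a].

Definition word_basis (C : nat -> 'I_l -> bool -> seq 'I_l * seq 'I_l) (x : sector l m) : mon :=
  word_mon (C x.1.1 x.1.2 x.2).1 (C x.1.1 x.1.2 x.2).2.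

Variables (F : fieldType) (z : F).
Hypothesis zP : l.-primitive_root z.

Lemma word_basis_section C : admissible C -> section_basis z (word_basis C).
Proof.
move=> adm; split=> [[[r s] b]|r s mr].
  rewrite inE /= => rb; have [//|H1 H2 H3 _] := adm r s b _ rb; first by rewrite -ltnS.
  rewrite /word_basis /=; split; first by have := word_order H1; lia.
  rewrite /charsum word_alpha // word_beta // -[in RHS]H3 /= !val_Zp_sum.
  by rewrite modnDml modnDmr.
have lr : (r <= 2 * m)%N by rewrite -ltnS.
have [H1 _ _ _] := adm r s false lr isT; have [H1' _ _ /(_ isT)] := adm r s true lr mr.
apply: contraNneq => /eqP; rewrite !word_alpha // (eq_prim_root_expr zP) => /eqP E.
by apply/eqP/val_inj; rewrite !val_Zp_sum.
Qed.

End Words.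

Section RowSums.
Variables (k j : nat).
Local Notation l := k.+2.
Local Notation m := j.+2.

Lemma sum_rows (V : nmodType) (h : nat -> 'I_l -> bool -> V) :
  \sum_(x in @row_sector l m) h x.1.1 x.1.2 x.2 =
  \sum_s (h m s false + h m s true) +
  (\sum_s (h 0%N s false + h (2 * m)%N s false) +
   (\sum_s (h 1%N s false + h (2 * m - 1)%N s false) +
    \sum_(i < j) \sum_s ((h i.+2 s false + h i.+2 s true) +
      (h (2 * m - i.+2)%N s false + h (2 * m - i.+2)%N s true)))).
Proof.
rewrite sum_row_sector /=.
rewrite (@sum_reflect m _ (fun r => \sum_s (h r s false + h r s true *+ (1 < r < 2 * m - 1)%N))).
have -> : (1 < m < 2 * m - 1)%N by lia.
congr (_ + _); rewrite (@big_ord_recl _ _ _ j.+1) (@big_ord_recl _ _ _ j) /=; congr (_ + (_ + _)).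
- rewrite subn0 -big_split; apply: eq_bigr => s _ /=.
  by rewrite (_ : (_ < _)%N = false) ?mulr0n ?addr0 //; lia.
- rewrite -big_split; apply: eq_bigr => s _ /=.
  rewrite (_ : bump 0 0 = 1%N) //.
  by rewrite (_ : (_ && _) = false) ?mulr0n ?addr0 //; lia.
apply: eq_bigr => i _; rewrite -big_split; apply: eq_bigr => s _ /=.
have ij := ltn_ord i; rewrite !/bump /= !add1n.
have -> : (i.+2 < 2 * m - 1)%N by lia.
have -> : (1 < 2 * m - i.+2 < 2 * m - 1)%N by lia.
by [].
Qed.

Lemma card_row_sector : #|@row_sector l m| = (2 * l * (2 * m - 1))%N.
Proof.
rewrite -sum1_card (sum_rows (fun _ _ _ => 1%N)) !sum_nat_const !card_ord.
rewrite -[RHS]mulnA; lia.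
Qed.

End RowSums.

Lemma addr_le0 (x y : rat) : x <= 0 -> y <= 0 -> x + y <= 0.
Proof. lra. Qed.

(** * Weights of word bases *)

Section Choices.
Variables (k j : nat) (nu : 'rV[rat]_(k.+2 + k.+2).+1).
Local Notation l := k.+2.
Local Notation m := j.+2.
Local Notation choice := (nat -> 'I_l -> bool -> seq 'I_l * seq 'I_l).

Definition mean : rat := (\sum_a nu 0 (vw a)) / l%:R.
Definition mean' : rat := (\sum_b nu 0 (vw' b)) / l%:R.
Definition phi (a : 'I_l) : rat := nu 0 (vw a) - mean.
Definition phi' (b : 'I_l) : rat := nu 0 (vw' b) - mean'.
Definition y0 : rat := nu 0 (vy l).

Lemma lnz : l%:R != 0 :> rat. Proof. by rewrite pnatr_eq0. Qed.

Lemma sum_phi : \sum_a phi a = 0.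
Proof. by rewrite sumrB sumr_const card_ord -mulr_natr divfK ?lnz // subrr. Qed.
Lemma sum_phi' : \sum_b phi' b = 0.
Proof. by rewrite sumrB sumr_const card_ord -mulr_natr divfK ?lnz // subrr. Qed.

Definition y_degree (p : seq 'I_l * seq 'I_l) : nat := (m - (size p.1 + size p.2))%N.
Definition deviation (p : seq 'I_l * seq 'I_l) : rat :=
  \sum_(a <- p.1) phi a + \sum_(b <- p.2) phi' b.

Lemma seq_sum_dev (A : seq 'I_l) (f : 'I_l -> rat) c :
  \sum_(a <- A) f a = \sum_(a <- A) (f a - c) + (size A)%:R * c.
Proof.
elim: A => [|a A IH]; first by rewrite !big_nil mul0r addr0.
by rewrite !big_cons IH /= -natr1; ring.
Qed.

(** The numbers of w and w' letters are determined by the order and the y-degree, so the mean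
    weights contribute through these two alone and the rest is the deviation. *)
Lemma choice_weight A B r : (size A + size B <= m)%N -> (r + size A = m + size B)%N ->
  mon_weight nu (word_mon m A B) = m%:R * ((mean + mean') / 2) +
    (y0 - (mean + mean') / 2) * (y_degree (A, B))%:R +
    (m%:R - r%:R) * ((mean - mean') / 2) + deviation (A, B).
Proof.
move=> H1 H2; rewrite word_weight // (seq_sum_dev A _ mean) (seq_sum_dev B _ mean') /deviation /=.
have Ey : (y_degree (A, B))%:R = m%:R - (size A)%:R - (size B)%:R :> rat.
  by rewrite /y_degree /= natrB // natrD; ring.
have Er : r%:R = m%:R + (size B)%:R - (size A)%:R :> rat.
  by rewrite -natrD -H2 natrD addrK.
rewrite -/y0 -[y0 *+ _]mulr_natl -[(m - _)%N]/(y_degree (A, B)) Ey Er /phi /phi'.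
by field.
Qed.

(** The terms in m - r cancel between the orders r and 2m - r. What remains is the excess of the
    y-degree over its average, times y0 minus the mean letter weight, plus the deviation. *)
Lemma choice_inequality (C : choice) : admissible m C ->
  (y0 - (mean + mean') / 2) *
    ((l + l).+1%:R * (\sum_(x in @row_sector l m) (y_degree (C x.1.1 x.1.2 x.2))%:R)
      - (m * #|@row_sector l m|)%:R) <= 0 ->
  \sum_(x in @row_sector l m) deviation (C x.1.1 x.1.2 x.2) <= 0 ->
  (l + l).+1%:R * \sum_(x in @row_sector l m) mon_weight nu (word_basis C x)
    <= (m * #|@row_sector l m|)%:R * \sum_i nu 0 i.
Proof.
move=> adm HY HD.
have W x : x \in @row_sector l m -> mon_weight nu (word_basis C x) =
    m%:R * ((mean + mean') / 2) +
    (y0 - (mean + mean') / 2) * (y_degree (C x.1.1 x.1.2 x.2))%:R +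
    (m%:R - (x.1.1 : nat)%:R) * ((mean - mean') / 2) + deviation (C x.1.1 x.1.2 x.2).
  case: x => [[r s] b]; rewrite inE /= => rb.
  have [||H1 H2 _ _] := @adm r s b; rewrite ?rb //; first by rewrite -ltnS.
  rewrite /word_basis /=; case: (C r s b) H1 H2 => A B /= H1 H2.
  exact: choice_weight.
rewrite (eq_bigr _ W) 3!big_split /= -!mulr_sumr -mulr_suml sumr_const.
have balance : \sum_(x in @row_sector l m) (m%:R - (x.1.1 : nat)%:R) = 0 :> rat.
  rewrite (@sum_rows k j _ (fun r _ _ => m%:R - r%:R)) subrr add0r !big1 ?addr0 //.
  - move=> i _; rewrite big1 // => s _; have ij := ltn_ord i.
    rewrite natrB; last by lia.
    by rewrite natrM; ring.
  - by move=> s _; rewrite natrB // natrM; ring.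
  - by move=> s _; rewrite natrM; ring.
have Enu : \sum_i nu 0 i = y0 + l%:R * (mean + mean').
  rewrite sum_letters mulrDr [l%:R * mean]mulrC [l%:R * mean']mulrC !divfK ?lnz //.
have gE : (l + l).+1%:R = l%:R + l%:R + 1 :> rat by rewrite -natr1 natrD.
rewrite balance mul0r addr0 Enu -[_ *+ #|_|]mulr_natr gE natrM.
move: HY HD; rewrite gE natrM.
move: (\sum_(x in _) (y_degree _)%:R) (\sum_(x in _) deviation _) => Y D.
move: (l%:R) (m%:R) (#|_|%:R) (mean + mean') y0 (ler0n rat l) => L M c s y L0.
move=> HY HD; rewrite -subr_le0.
have : (L + L + 1) * D <= 0 by rewrite mulr_ge0_le0 //; lra.
move: HY; lra.
Qed.


(* [padded t p a] has p letters summing to t, all but one of them equal to a. *)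
Definition padded (t : 'I_l) (p : nat) (a : 'I_l) : seq 'I_l := (t - a *+ p.-1) :: nseq p.-1 a.

Lemma size_padded t p a : (0 < p)%N -> size (padded t p a) = p.
Proof. by move=> p0; rewrite /= size_nseq prednK. Qed.

Lemma sum_padded t p a : \sum_(x <- padded t p a) x = t.
Proof. by rewrite big_cons big_nseq iter_addr_0 subrK. Qed.

Lemma sum_constant n (c : rat) : \sum_(s < n) c = n%:R * c.
Proof. by rewrite sumr_const card_ord mulr_natl. Qed.

Lemma sum_add4 n (f1 f2 f3 f4 : 'I_n -> rat) : \sum_s (f1 s + f2 s + (f3 s + f4 s)) =
  \sum_s f1 s + \sum_s f2 s + (\sum_s f3 s + \sum_s f4 s).
Proof. by rewrite !big_split. Qed.

Lemma sum_translate (f : 'I_l -> rat) c : \sum_s f (s - c) = \sum_s f s.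
Proof.
rewrite [RHS](reindex (fun s => s - c)) //; exists (fun s => s + c) => s _; first exact: subrK.
exact: addrK.
Qed.

(** As s runs over Z/l so does the adjusting letter, whose deviations cancel; only the copies of a
    count. *)
Lemma sum_dev_padded (f : 'I_l -> rat) c p a : \sum_s f s = 0 ->
  \sum_s \sum_(x <- padded (s - c) p a) f x = l%:R * (p.-1%:R * f a).
Proof.
move=> f0; under eq_bigr => s _ do rewrite big_cons big_nseq iter_addr_0.
rewrite big_split /= sum_constant -[f a *+ _]mulr_natl.
under eq_bigr => s _ do rewrite -addrA -opprD.
by rewrite sum_translate f0 add0r.
Qed.

Lemma sum_dev_padded0 (f : 'I_l -> rat) p a : \sum_s f s = 0 ->
  \sum_s \sum_(x <- padded s p a) f x = l%:R * (p.-1%:R * f a).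
Proof.
by move=> f0; rewrite -(sum_dev_padded 0 p a f0); apply: eq_bigr => s _; rewrite subr0.
Qed.

Lemma choice_sumE (C : choice) (h : seq 'I_l * seq 'I_l -> rat) :
  \sum_(x in @row_sector l m) h (C x.1.1 x.1.2 x.2) =
  \sum_s (h (C m s false) + h (C m s true)) +
  (\sum_s (h (C 0%N s false) + h (C (2 * m)%N s false)) +
   (\sum_s (h (C 1%N s false) + h (C (2 * m - 1)%N s false)) +
    \sum_(i < j) \sum_s ((h (C i.+2 s false) + h (C i.+2 s true)) +
      (h (C (2 * m - i.+2)%N s false) + h (C (2 * m - i.+2)%N s true))))).
Proof. exact: (@sum_rows k j _ (fun r s b => h (C r s b))). Qed.

(** * A monomial basis of low y-degree *)

Section LowYDegree.
Variables (a0 b0 b1 : 'I_l).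

Definition block (b : 'I_l) (q : nat) := if q == 0%N then [::] else b :: nseq q.-1 b0.

(** The y-exponent is the parity of r, the least possible. The second monomial of a block trades one
    letter b0 for b1. *)
Definition low_choice : choice := fun r s b =>
  let q := r./2 in let p := (m - odd r - q)%N in
  (* This happens for r = 2m-1 and 2m: no w letter is left to adjust the character, so a w' letter
     does. *)
  if p == 0%N then ([::], padded s q b0) else
  let B := block (if b then b1 else b0) q in (padded (s - \sum_(x <- B) x) p a0, B).

Lemma size_block b q : size (block b q) = q.
Proof. by rewrite /block; case: q => //= q; rewrite size_nseq. Qed.

Lemma low_choice_admissible : b1 != b0 -> admissible m low_choice.
Proof.
move=> b10 r s b rm rb; rewrite /low_choice /mid in rb *.
have [p0|p0] := eqVneq (m - odd r - r./2)%N 0%N.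
  rewrite size_padded /=; last by lia.
  rewrite big_nil add0r sum_padded; split=> //; [lia | lia |].
  by move=> bt; move: rb; rewrite bt /=; lia.
rewrite size_padded; last by lia.
rewrite size_block sum_padded subrK; split=> //; [lia | lia |] => bt.
have q0 : (0 < r./2)%N by move: rb; rewrite bt /=; lia.
rewrite /= !sum_padded (inj_eq (addrI _)) (inj_eq oppr_inj) /block.
case: (r./2) q0 => // q _ /=; rewrite !big_cons (inj_eq (addIr _)) eq_sym //.
Qed.

Lemma low_choice_y_degree r s b : (r <= 2 * m)%N -> y_degree (low_choice r s b) = odd r.
Proof.
move=> rm; rewrite /low_choice; have [p0|p0] := eqVneq (m - odd r - r./2)%N 0%N.
  by rewrite /y_degree size_padded /=; lia.
by rewrite /y_degree [(_, _).1]/= [(_, _).2]/= size_padded ?size_block; lia.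
Qed.

Lemma low_choice_deviation r b : \sum_s deviation (low_choice r s b) =
  if (m - odd r - r./2)%N == 0%N then l%:R * ((r./2).-1%:R * phi' b0) else
  l%:R * ((m - odd r - r./2).-1%:R * phi a0) +
    l%:R * \sum_(x <- block (if b then b1 else b0) r./2) phi' x.
Proof.
rewrite /low_choice /deviation; case: ((m - odd r - r./2)%N == 0%N) => /=.
  under eq_bigr => s _ do rewrite big_nil add0r.
  by rewrite sum_dev_padded0 // sum_phi'.
by rewrite big_split /= sum_dev_padded ?sum_phi // sum_constant.
Qed.

Lemma low_choice_deviation_le0 : phi a0 <= 0 -> phi' b0 <= 0 -> phi' b1 <= - phi' b0 ->
  \sum_(x in @row_sector l m) deviation (low_choice x.1.1 x.1.2 x.2) <= 0.
Proof.
move=> ha hb hb1; rewrite choice_sumE.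
have neg (p : nat) (x : rat) : x <= 0 -> l%:R * (p%:R * x) <= 0.
  by move=> x0; rewrite mulr_ge0_le0 // mulr_ge0_le0.
have pair r : (1 < r < 2 * m - 1)%N ->
    \sum_s (deviation (low_choice r s false) + deviation (low_choice r s true)) <= 0.
  move=> rm; rewrite big_split /= !low_choice_deviation.
  have /negPf -> : (m - odd r - r./2)%N != 0%N by lia.
  have : (0 < r./2)%N by lia.
  rewrite /block; case: (r./2) => // q _ /=; rewrite !big_cons !big_nseq !iter_addr_0.
  rewrite -[phi' b0 *+ q]mulr_natl; have := neg q _ hb; have := neg (m - odd r - q.+1).-1 _ ha.
  have : l%:R * (phi' b0 + phi' b1) <= 0 by rewrite mulr_ge0_le0 //; lra.
  by lra.
have low r : (r <= 1)%N -> \sum_s deviation (low_choice r s false) <= 0.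
  move=> r1; rewrite low_choice_deviation (_ : (m - odd r - r./2)%N == 0%N = false); last by lia.
  by rewrite /block (_ : r./2 == 0%N) ?big_nil ?mulr0 ?addr0 ?neg //; lia.
have high r : (2 * m - 1 <= r <= 2 * m)%N -> \sum_s deviation (low_choice r s false) <= 0.
  move=> r1; rewrite low_choice_deviation (_ : (m - odd r - r./2)%N == 0%N); last by lia.
  exact: neg.
apply: addr_le0; first by apply: pair; lia.
apply: addr_le0.
  by rewrite big_split; apply: addr_le0; [apply: low | apply: high; lia].
apply: addr_le0.
  by rewrite big_split; apply: addr_le0; [apply: low | apply: high; lia].
apply: sumr_le0 => i _; have ij := ltn_ord i.
by rewrite big_split; apply: addr_le0; apply: pair; lia.
Qed.

End LowYDegree.

(** * A monomial basis of high y-degree *)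

Section HighYDegree.
Variables (a0 b0 a1 b1 : 'I_l).

(** Away from the middle order the first monomial has the greatest y-exponent that the order allows,
    and the second trades two letters y for one w and one w'. At r = m the power y^m is available
    for the character 0, which explains the summand 2 in the total y-degree. *)
Definition high_choice : choice := fun r s b =>
  if (r < m)%N then
    if b then (padded (s - b1) (m - r).+1 a0, [:: b1]) else (padded s (m - r) a0, [::])
  else if (m < r)%N then
    if b then ([:: a1], padded (s - a1) (r - m).+1 b0) else ([::], padded s (r - m) b0)
  else if b then ([:: s - b1], [:: b1])
  else if s == 0 then ([::], [::]) else ([:: s], [:: 0]).

Lemma high_choice_admissible : a1 != 0 -> b1 != 0 -> admissible m high_choice.
Proof.
move=> a10 b10 r s b rm rb; rewrite /high_choice /mid in rb *.
have [rlt|mlt|rE] := ltngtP r m.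
- case: b rb => /= rb; rewrite ?big_seq1 ?big_nil sum_padded ?subrK ?addr0 ?size_nseq.
    rewrite sum_padded -subr_eq0 subKr.
    by split=> //; lia.
  by split=> //; lia.
- case: b rb => /= rb; rewrite ?big_seq1 ?big_nil sum_padded ?add0r ?size_nseq.
    rewrite addrC subrK eq_sym.
    by split=> //; lia.
  by split=> //; lia.
- case: b rb => /= rb.
    rewrite !big_seq1 subrK rE; split=> // _.
    case: (eqVneq s 0) => [->|_]; rewrite /= ?big_nil ?big_seq1 ?sub0r.
      by rewrite eq_sym oppr_eq0.
    by rewrite -subr_eq0 subKr.
  by case: (eqVneq s 0) => [->|_]; rewrite /= ?big_nil ?big_seq1 ?addr0 ?rE.
Qed.

Lemma high_choice_y_degree :
  \sum_(x in @row_sector l m) (y_degree (high_choice x.1.1 x.1.2 x.2))%:R =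
  2 * l%:R * (j.+1%:R) ^+ 2 + 2 :> rat.
Proof.
rewrite (choice_sumE high_choice (fun p => (y_degree p)%:R)).
have yE r b s : (0 < r < m)%N -> y_degree (high_choice r s b) = (r - b.*2)%N.
  move=> rm; have lt1 : (r < m)%N by lia.
  by rewrite /high_choice /y_degree lt1; case: b => /=; rewrite size_nseq; lia.
have yE' r b s : (0 < r < m)%N -> y_degree (high_choice (2 * m - r) s b) = (r - b.*2)%N.
  move=> rm; have lt1 : (2 * m - r < m)%N = false by lia.
  have lt2 : (m < 2 * m - r)%N by lia.
  by rewrite /high_choice /y_degree lt1 lt2; case: b => /=; rewrite size_nseq; lia.
have -> : \sum_s ((y_degree (high_choice 0 s false))%:R + (y_degree (high_choice (2 * m) s false))%:R) = 0 :> rat.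
  have lt1 : (2 * m < m)%N = false by lia.
  have lt2 : (m < 2 * m)%N by lia.
  rewrite big1 // => s _; rewrite /high_choice /y_degree lt1 lt2.
  have -> : (m - (size (padded s (m - 0) a0, [::] : seq 'I_l).1 + 0) = 0)%N.
    by rewrite size_padded; lia.
  have -> : (m - (0 + size (padded s (2 * m - m) b0)) = 0)%N by rewrite size_padded; lia.
  by rewrite addr0.
have -> : \sum_s ((y_degree (high_choice 1 s false))%:R + (y_degree (high_choice (2 * m - 1) s false))%:R) = l%:R * 2 :> rat.
  rewrite (eq_bigr (fun=> 2)) => [|s _]; last by rewrite (yE 1%N) // (yE' 1%N).
  by rewrite sum_constant.
have -> : \sum_(i < j) \sum_s ((y_degree (high_choice i.+2 s false))%:R + (y_degree (high_choice i.+2 s true))%:R +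
    ((y_degree (high_choice (2 * m - i.+2) s false))%:R + (y_degree (high_choice (2 * m - i.+2) s true))%:R))
    = \sum_(i < j) l%:R * (4 * (i : nat).+1%:R) :> rat.
  apply: eq_bigr => i _; have ij := ltn_ord i.
  rewrite (eq_bigr (fun=> 4 * (i : nat).+1%:R)) => [|s _].
    by rewrite sum_constant.
  have i2 : (0 < i.+2 < m)%N by lia.
  rewrite !(yE i.+2 _ _ i2) !(yE' i.+2 _ _ i2) subn0 subn2 /= -(natr1 i.+1) -(natr1 i); ring.
have -> : \sum_s ((y_degree (high_choice m s false))%:R + (y_degree (high_choice m s true))%:R)
    = l%:R * (2 * j%:R) + 2 :> rat.
  rewrite (bigD1 ord0) //= (eq_bigr (fun=> 2 * j%:R)) => [|s /negPf s0].
    rewrite sumr_const cardC1 card_ord /= -(mulr_natl _ k.+1).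
    rewrite /high_choice /y_degree ltnn /= subn0 subn2 /= -(natr1 k.+1) -(natr1 j.+1) -(natr1 j); ring.
  by rewrite /high_choice /y_degree ltnn s0 /= subn2 /=; ring.
rewrite -mulr_sumr -mulr_sumr.
have -> : 4 * \sum_(i < j) (i : nat).+1%:R = 2 * j%:R * (j%:R + 1) :> rat.
  elim: (j) => [|q IH]; first by rewrite big_ord0; ring.
  by rewrite big_ord_recr /= mulrDr IH -!natr1; ring.
by rewrite -(natr1 j); ring.
Qed.

(** The middle order contributes - phi 0 + (l-1) phi' 0, of no definite sign. Copies of a0 offset
    the first term, and the average bound on b1 offsets the second. *)
Lemma high_choice_deviation_le0 : (k <= j)%N -> phi a0 <= phi 0 -> phi a0 <= 0 -> phi' b0 <= 0 ->
  phi a1 <= - phi a0 -> k.+1%:R * phi' b1 <= - phi' 0 -> phi' b1 <= - phi' b0 ->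
  \sum_(x in @row_sector l m) deviation (high_choice x.1.1 x.1.2 x.2) <= 0.
Proof.
move=> kj ha0 ha hb ha1 hb1 hb1'; rewrite choice_sumE.
have neg (p : nat) (x : rat) : x <= 0 -> l%:R * (p%:R * x) <= 0.
  by move=> x0; rewrite mulr_ge0_le0 // mulr_ge0_le0.
have dF r : (r < m)%N -> \sum_s deviation (high_choice r s false) = l%:R * ((m - r).-1%:R * phi a0).
  move=> rm; rewrite /high_choice rm /deviation /=.
  under eq_bigr => s _ do rewrite big_nil addr0.
  by rewrite sum_dev_padded0 // sum_phi.
have dT r : (r < m)%N -> \sum_s deviation (high_choice r s true) =
    l%:R * ((m - r)%:R * phi a0) + l%:R * phi' b1.
  move=> rm; rewrite /high_choice rm /deviation big_split /= sum_dev_padded ?sum_phi //.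
  by rewrite big_seq1 sum_constant.
have dF' r : (m < r)%N -> \sum_s deviation (high_choice r s false) = l%:R * ((r - m).-1%:R * phi' b0).
  move=> rm; have lt : (r < m)%N = false by lia.
  rewrite /high_choice lt rm /deviation /=.
  under eq_bigr => s _ do rewrite big_nil add0r.
  by rewrite sum_dev_padded0 // sum_phi'.
have dT' r : (m < r)%N -> \sum_s deviation (high_choice r s true) =
    l%:R * phi a1 + l%:R * ((r - m)%:R * phi' b0).
  move=> rm; have lt : (r < m)%N = false by lia.
  rewrite /high_choice lt rm /deviation /=.
  rewrite big_split /= sum_dev_padded ?sum_phi' //.
  by rewrite big_seq1 sum_constant.
have dm : \sum_s (deviation (high_choice m s false) + deviation (high_choice m s true)) =
    - phi 0 + k.+1%:R * phi' 0 + l%:R * phi' b1.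
  rewrite big_split /= /high_choice ltnn /deviation; congr (_ + _); last first.
    under eq_bigr => s _ do rewrite !big_seq1.
    rewrite big_split /= (sum_translate phi) sum_phi add0r.
    by rewrite sum_constant.
  rewrite (bigD1 0) //= !big_nil addr0 add0r.
  rewrite (eq_bigr (fun s => phi s + phi' 0)) => [|s /negPf ->]; last by rewrite !big_seq1.
  rewrite big_split /= sumr_const cardC1 card_ord /= -[_ *+ k.+1]mulr_natl; congr (_ + _).
  by have := sum_phi; rewrite (bigD1 0) //=; lra.
have mid i : (i < j)%N -> \sum_s (deviation (high_choice i.+2 s false) + deviation (high_choice i.+2 s true) +
     (deviation (high_choice (2 * m - i.+2) s false) + deviation (high_choice (2 * m - i.+2) s true)))
   <= l%:R * (phi' b1 + phi a1).
  move=> ij; have lt1 : (i.+2 < m)%N by lia.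
  have lt2 : (m < 2 * m - i.+2)%N by lia.
  rewrite sum_add4 (dF _ lt1) (dT _ lt1) (dF' _ lt2) (dT' _ lt2).
  have := neg (m - i.+2).-1 _ ha; have := neg (m - i.+2)%N _ ha.
  have := neg (2 * m - i.+2 - m).-1 _ hb; have := neg (2 * m - i.+2 - m)%N _ hb; lra.
have mids : \sum_(i < j) \sum_s (deviation (high_choice i.+2 s false) + deviation (high_choice i.+2 s true) +
     (deviation (high_choice (2 * m - i.+2) s false) + deviation (high_choice (2 * m - i.+2) s true)))
   <= j%:R * (l%:R * (phi' b1 + phi a1)).
  apply: le_trans (ler_sum _ (fun i _ => mid _ (ltn_ord i))) _.
  by rewrite sum_constant.
have d0 : \sum_s (deviation (high_choice 0 s false) + deviation (high_choice (2 * m) s false)) =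
    l%:R * (j.+1%:R * (phi a0 + phi' b0)).
  have lt : (m < 2 * m)%N by lia.
  rewrite big_split dF // (dF' _ lt).
  by rewrite subn0 (_ : (2 * m - m)%N = m) /=; [ring | lia].
have d1 : \sum_s (deviation (high_choice 1 s false) + deviation (high_choice (2 * m - 1) s false)) <= 0.
  have lt : (m < 2 * m - 1)%N by lia.
  by rewrite big_split dF // (dF' _ lt); apply: addr_le0; exact: neg.
rewrite dm d0; move: mids d1; set X := \sum_(i < j) _; set Y := \sum_s _ => mids d1.
apply: le_trans (_ : - phi 0 + k.+1%:R * phi' 0 + l%:R * phi' b1 +
  (l%:R * (j.+1%:R * (phi a0 + phi' b0)) + j%:R * (l%:R * (phi' b1 + phi a1))) <= 0); first by lra.
have El : l%:R = k.+1%:R + 1 :> rat by rewrite natr1.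
have Ej : j.+1%:R = j%:R + 1 :> rat by rewrite natr1.
have hkj : k.+1%:R <= j%:R + 1 :> rat by rewrite natr1 ler_nat.
have k1 : 1 <= k.+1%:R :> rat by rewrite ler1n.
have j0 : 0 <= j%:R :> rat by [].
rewrite El Ej; move: (phi a0) (phi 0) (phi a1) (phi' b0) (phi' 0) (phi' b1) ha0 ha hb ha1 hb1 hb1'.
move: (k.+1%:R) (j%:R) hkj k1 j0 => K J hkj k1 j0 u f0 f1 u' f0' f1' ha0 ha hb ha1 hb1 hb1'.
have P1 : J * (K + 1) * (f1 + u) <= 0 by rewrite mulr_ge0_le0 ?mulr_ge0 //; lra.
have P2 : K * u <= 0 by rewrite mulr_ge0_le0 //; lra.
have P3 : K * (K * f1' + f0') <= 0 by rewrite mulr_ge0_le0 //; lra.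
(* Here l <= m enters: after K * K copies of b1 have offset phi' 0, the number of copies left is
   nonnegative. *)
have c0 : 0 <= (K + 1) * (J + 1) - K * K by nra.
have P4 : ((K + 1) * (J + 1) - K * K) * (f1' + u') <= 0 by rewrite mulr_ge0_le0 //; lra.
have P5 : K * K * u' <= 0 by rewrite mulr_ge0_le0 ?mulr_ge0 //; lra.
lra.
Qed.

End HighYDegree.

Lemma sum_odd_rows : (\sum_(x in @row_sector l m) odd (val x.1.1) = 2 * l * j.+1)%N.
Proof.
rewrite (@sum_rows k j _ (fun r _ _ => odd r : nat)) !sum_nat_const !card_ord.
under eq_bigr => i _.
  rewrite sum_nat_const card_ord.
  have -> : odd (2 * m - i.+2) = odd i by have := ltn_ord i; lia.
  rewrite /= negbK; over.
have half q : (\sum_(i < q) odd i = q./2)%N.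
  by elim: q => [|q IH]; rewrite ?big_ord0 // big_ord_recr /= IH uphalf_half addnC.
rewrite (eq_bigr (fun i : 'I_j => odd i * (4 * l))%N) => [|i _]; last by lia.
rewrite -big_distrl /= half; have := odd_double_half j; lia.
Qed.

(** A light y calls for the basis of high y-degree, a heavy y for the one of low y-degree. *)
Lemma low_weight_basis_exists : (k <= j)%N -> exists2 C, admissible m C &
  (l + l).+1%:R * \sum_(x in @row_sector l m) mon_weight nu (word_basis C x)
    <= (m * #|@row_sector l m|)%:R * \sum_i nu 0 i.
Proof.
move=> kj.
have [a0 [ha hamin ha1]] := zero_sum_minima sum_phi.
have [b0 [hb hbmin hb1]] := zero_sum_minima sum_phi'.
have El : (l + l).+1%:R = 2 * l%:R + 1 :> rat by rewrite -natr1 natrD; ring.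
have EL : (m * #|@row_sector l m|)%:R = m%:R * (2 * l%:R * (2 * m%:R - 1)) :> rat.
  rewrite card_row_sector !natrM natrB; last by lia.
  by rewrite natrM.
have hkj : l%:R <= m%:R :> rat by rewrite ler_nat.
have l2 : 2 <= l%:R :> rat by rewrite ler_nat.
have Ej : j.+1%:R = m%:R - 1 :> rat by rewrite -[m%:R]natr1 addrK.
have [y0le|y0ge] := leP y0 ((mean + mean') / 2).
  have [a1 [a10 _ ha1']] := ha1 0; have [b1 [b10 hb1' hb1'']] := hb1 0.
  exists (high_choice a0 b0 a1 b1); first exact: high_choice_admissible.
  apply: choice_inequality; [exact: high_choice_admissible | | exact: high_choice_deviation_le0].
  rewrite high_choice_y_degree EL El Ej mulr_le0_ge0 //; first by lra.
  move: (l%:R) (m%:R) hkj l2 => L M hkj l2.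
  (* With Y the total y-degree, gY - mN = 2l((2l-4)(m-1)^2 + 3(m-1)(m-2) + 1) + 2. *)
  have H1 : 0 <= 2 * L * ((2 * L - 4) * (M - 1) ^+ 2).
    by rewrite !mulr_ge0 ?exprn_even_ge0 //; lra.
  have H2 : 0 <= 2 * L * (3 * (M - 1) * (M - 2)) by rewrite !mulr_ge0 //; lra.
  lra.
have [b1 [b10 _ hb1']] := hb1 b0.
exists (low_choice a0 b0 b1); first exact: low_choice_admissible.
apply: choice_inequality; [exact: low_choice_admissible | | exact: low_choice_deviation_le0].
have -> : \sum_(x in @row_sector l m) (y_degree (low_choice a0 b0 b1 x.1.1 x.1.2 x.2))%:R =
    2 * l%:R * j.+1%:R :> rat.
  rewrite -!natrM -sum_odd_rows natr_sum; apply: eq_bigr => x _.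
  by rewrite low_choice_y_degree // -ltnS.
rewrite EL El Ej mulr_ge0_le0 //; first by lra.
move: (l%:R) (m%:R) hkj l2 => L M hkj l2.
(* Here gY - mN = -2l(2(m-l)(m-1) + 1), which is negative since l <= m. *)
have H : 0 <= 2 * L * (2 * (M - L) * (M - 1)) by rewrite !mulr_ge0 //; lra.
lra.
Qed.


End Choices.

(** * The Hilbert point of the rosary *)

Section CharacteristicZero.
Variables (F : closedFieldType) (char0 : [pchar F] =i pred0).

Lemma natr_eq0_char0 n : (n%:R == 0 :> F) = (n == 0)%N.
Proof. by have /pcharf0P := char0. Qed.

Lemma natr_inj_char0 : injective (fun n => n%:R : F).
Proof.
have leN i j : (i <= j)%N -> i%:R = j%:R :> F -> i = j.
  move=> ij E; apply/eqP; rewrite eqn_leq ij /= -subn_eq0 -natr_eq0_char0.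
  by rewrite natrB // E subrr.
by move=> i j E; case/orP: (leq_total i j) => /leN; [exact | move=> H; exact/esym/H/esym].
Qed.

Lemma prim_root_exists n : (0 < n)%N -> exists z : F, n.-primitive_root z.
Proof.
move=> n0; have [r Dp] := closed_field_poly_normal ('X^n - 1 : {poly F}).
rewrite (monicP _) ?monicXnsubC // scale1r in Dp.
have rn1 : all n.-unity_root r by apply/allP => z; rewrite -root_prod_XsubC -Dp.
have sz_r : (n < (size r).+1)%N by rewrite -(size_prod_XsubC r id) -Dp size_XnsubC.
have [|z] := hasP (has_prim_root n0 rn1 _ sz_r); last by exists z.
by rewrite -separable_prod_XsubC -Dp separable_Xn_sub_1 // natr_eq0_char0 -lt0n.
Qed.

Lemma poly_eq0_punctured (p : {poly F}) : (forall t, t != 0 -> p.[t] = 0) -> p = 0.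
Proof.
move=> H; apply: (@roots_geq_poly_eq0 _ p [seq i.+1%:R | i <- iota 0 (size p)]).
- by apply/allP => x /mapP[i _ ->]; apply/eqP/H; rewrite natr_eq0_char0.
- by rewrite map_inj_uniq ?iota_uniq // => i j /natr_inj_char0 [].
- by rewrite size_map size_iota.
Qed.

Lemma polyfun_curve (D : finType) (P : (D -> F) -> F) (q : D -> {poly F}) : polyfun P ->
  exists p : {poly F}, forall t, p.[t] = P (fun d => (q d).[t]).
Proof.
elim=> [c|d|P1 P2 _ [p1 H1] _ [p2 H2]|P1 P2 _ [p1 H1] _ [p2 H2]].
- by exists c%:P => t; rewrite hornerC.
- by exists (q d).
- by exists (p1 + p2) => t; rewrite hornerD H1 H2.
- by exists (p1 * p2) => t; rewrite hornerM H1 H2.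
Qed.

Lemma zero_in_orbit_closure_curve g m N (R : 'I_N -> Mon g m -> F)
    (q : {ffun 'I_N -> Mon g m} -> {poly F}) : (forall kappa, (q kappa).[0] = 0) ->
  (forall t, t != 0 -> exists2 A : 'M[F]_g, \det A = 1 &
     forall kappa, pluecker (actR A R) kappa = (q kappa).[t]) -> zero_in_orbit_closure R.
Proof.
move=> q0 Hq P hP PA; have [p Hp] := polyfun_curve q hP.
have p0 : p = 0.
  apply: poly_eq0_punctured => t t0; rewrite Hp; have [A dA HA] := Hq t t0.
  by rewrite -[RHS](PA A dA); congr (P _); apply/boolp.funext => kappa; rewrite HA.
have := Hp 0; rewrite p0 horner0 => /esym; congr (_ = _); congr (P _).
by apply/boolp.funext => kappa; rewrite q0.
Qed.

Section Genus.
Variables (k j : nat).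
Local Notation l := k.+2.
Local Notation n := (l + l)%N.
Local Notation m := j.+2.
Local Notation L := #|@row_sector l m|.
Variables (z : F) (zP : l.-primitive_root z).
Local Notation E := (@row_entry F l m z).

Lemma row_entry_independent : independent_rows E.
Proof.
apply: (section_basis_independent (T := word_basis (low_choice j (0 : 'I_l) 0 1))).
exact: word_basis_section (low_choice_admissible _ _).
Qed.

(* Rotation by two components composed with the G_m-action at 2, rescaled to avoid inverses. *)
Definition twist (i : 'I_n.+1) : F := 2 ^+ uexp 1 i * z ^+ zexp 2 i.

Lemma twist_neq0 i : twist i != 0.
Proof.
rewrite mulf_neq0 // expf_neq0 ?natr_eq0_char0 //.
apply/eqP => z0; have := prim_expr_order zP.
by rewrite z0 expr0n => /esym/eqP; rewrite oner_eq0.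
Qed.

(** The l-th power removes the roots of unity and leaves 2^l, 4^l, 1, which separate y, w and w';
    then the powers of z separate the letters. *)
Lemma twist_injective : injective twist.
Proof.
have zl a : (z ^+ a) ^+ l = 1 by rewrite exprAC (prim_expr_order zP) expr1n.
have power i : twist i ^+ l = (on_letters (2 ^ l) (fun=> 4 ^ l) (fun=> 1) i)%N%:R.
  rewrite exprMn zl mulr1; move: i; apply: letterP => [|a|b];
    rewrite /uexp ?on_y ?on_w ?on_w' /= ?expr0 ?expr1n ?expr1 // natrX //.
  by rewrite -natrX.
have lt12 : (1 < 2 ^ l)%N by rewrite -{1}(expn0 2) ltn_exp2l.
have lt24 : (2 ^ l < 4 ^ l)%N by rewrite ltn_exp2r.
move=> i i' E; have := power i; rewrite E power => /natr_inj_char0; move: i i' E.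
have inj (a b : 'I_l) c : c != 0 -> c * z ^+ a = c * z ^+ b -> a = b.
  move=> c0 /(mulfI c0)/eqP; rewrite (eq_prim_root_expr zP) !modn_small // => /eqP.
  exact: val_inj.
apply: letterP => [|a|a]; apply: letterP => [|b|b]; rewrite ?on_y ?on_w ?on_w' //; try lia.
  rewrite /twist /uexp /zexp !on_w /= !muln1 => /inj -> //.
  by rewrite expf_neq0 // natr_eq0_char0.
by rewrite /twist /uexp /zexp !on_w' /= !muln1 => /inj -> //; rewrite oner_neq0.
Qed.

Definition twist_row : 'rV[F]_n.+1 := \row_i twist i.

Definition twist_eigenvalues : 'rV[F]_L :=
  \row_(i < L) (2 ^+ (2 * m - (enum_val i).1.1) * z ^+ (enum_val i).1.2).

(** Each row sees monomials of a single order and character, on which the twist is a scalar; hence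
    it fixes the Hilbert point. *)
Lemma actR_twist : actR (diag_mx twist_row) E =2
  row_comb (diag_mx twist_eigenvalues) E.
Proof.
move=> i e; rewrite actR_diag /row_comb [RHS](bigD1 i) //= [X in _ = _ + X]big1 ?addr0 => [|i' i'i]; last first.
  by rewrite !mxE eq_sym (negPf i'i) mulr0n mul0r.
rewrite !mxE eqxx mulr1n mulrC.
have [->|] := eqVneq (E i e) 0; first by rewrite !mulr0.
rewrite /row_entry /sector_entry; case: (order0 e =P _) => [oe|]; last by rewrite mul0r eqxx.
case: (charsum e =P _) => [ce _|]; last by rewrite mul0r eqxx.
congr (_ * _); under eq_bigr => a _ do rewrite mxE exprMn -!exprM !(mulnC _ (expo e a)).
rewrite big_split /= -!expr_sum; congr (_ * _).
  congr (_ ^+ _); have := degree_uexp 1 e; rewrite /= oe => H.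
  by apply/eqP; rewrite -(eqn_add2r (enum_val i).1.1) H subnK // -oe -ltnS order0_le.
rewrite -[RHS](prim_expr_mod zP) -ce modn_mod prim_expr_mod //.
by rewrite [X in z ^+ X](degree_zexp 2 e) !muln1.
Qed.

Section Embedding.
Variables (B : 'I_n.+1 -> 'M[F]_(n.+1.-1, 3)) (Q : 'M[F]_n.+1).
Hypotheses (uQ : Q \in unitmx) (WQ : forall i, eigensection z i = \sum_c Q i c *: B c).

Lemma vanishes_embedding (c : Mon n.+1 m -> F) :
  vanishes_on_C B (fun e' => \sum_e symcoef Q e' e * c e) <->
  forall i, \sum_e E i e * c e = 0.
Proof. by rewrite -(vanishes_change_basis c WQ) (vanishes_rows zP). Qed.

Lemma restriction_row_entry N (R : 'I_N -> Mon n.+1 m -> F) : represents_restriction B R ->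
  N = L /\ exists2 C : 'M[F]_(N, L), row_free C & actR Q R =2 row_comb C E.
Proof.
move=> [indR kerR]; apply: same_kernel; first exact: independent_actR.
  exact: row_entry_independent.
move=> c; rewrite -vanishes_embedding -kerR.
by split=> H i; have := H i; rewrite kernel_actR.
Qed.

Lemma restriction_exists : represents_restriction B (actR (invmx Q) E).
Proof.
split; first by apply: independent_actR; rewrite ?unitmx_inv //; exact: row_entry_independent.
move=> f; pose c e := \sum_e' symcoef (invmx Q) e e' * f e'.
have fE e' : \sum_e symcoef Q e' e * c e = f e'.
  rewrite /c; under eq_bigr => e _ do rewrite mulr_sumr.
  rewrite exchange_big (bigD1 e') //= [X in _ + X]big1 ?addr0 => [|e'' ne].
    under eq_bigr => e _ do rewrite mulrA.
    by rewrite -mulr_suml -symcoef_mul mulVmx // symcoef1 eqxx mul1r.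
  under eq_bigr => e _ do rewrite mulrA.
  by rewrite -mulr_suml -symcoef_mul mulVmx // symcoef1 eq_sym (negPf ne) mul0r.
have := vanishes_embedding c; rewrite (_ : (fun e' => _) = f); last first.
  by apply/boolp.funext => e'; rewrite fE.
by move=> ->; split=> H i; have := H i; rewrite kernel_actR.
Qed.

Lemma semistable_low_genus : (k <= j)%N -> hilbert_point_semistable m B.
Proof.
move=> kj N R hR R0; have [EN [C fC EC]] := restriction_row_entry hR.
subst N; rewrite row_free_unit in fC.
have RE : R =2 row_comb C (actR (invmx Q) E).
  move=> i e; rewrite -[LHS]actR1 -(mulVmx uQ) actR_mul (eq_actR _ EC).
  exact: actR_row_comb.
have [|i|A kappa|nu [_ Hnu]] :=
    multiplicity_free_criterion uQ (eta := twist_row) _ _ _ R0.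
- by move=> i i'; rewrite !mxE => /twist_injective.
- by rewrite mxE twist_neq0.
- set h := invmx Q *m diag_mx twist_row *m Q.
  have hR' : actR h R =2 row_comb (C *m diag_mx twist_eigenvalues) (actR (invmx Q) E).
    move=> i e; rewrite /h -mulmxA actR_mul (eq_actR _ (actR_mul _ _ _)).
    rewrite (eq_actR _ (eq_actR _ EC)) (eq_actR _ (actR_row_comb _ _ _)) actR_row_comb.
    rewrite -row_comb_mul; apply: eq_bigr => a _; congr (_ * _).
    by rewrite (eq_actR _ actR_twist) actR_row_comb.
  rewrite (eq_minor _ (eq_actR _ hR')) (eq_minor _ (actR_row_comb _ _ _)) minor_row_comb.
  rewrite (eq_minor _ (eq_actR _ RE)) (eq_minor _ (actR_row_comb _ _ _)) minor_row_comb.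
  rewrite !mulf_eq0 !negb_or => /andP[_ ->]; rewrite andbT.
  by rewrite -unitfE -unitmxE.
have [C' adm ineq] := low_weight_basis_exists nu kj.
have secT := word_basis_section zP adm.
have nz : minor (actR Q R) (basis_tuple (word_basis C')) != 0.
  rewrite (eq_minor _ EC) minor_row_comb mulf_neq0 //; last exact: section_basis_minor secT.
  by rewrite -unitfE -unitmxE.
have := Hnu _ nz; rewrite dot_state (sum_basis_tuple _ (mon_weight nu)).
by move: ineq; lra.
Qed.

(** * Instability: the one-parameter subgroup scaling y *)

Definition scaling (t : F) : 'rV[F]_n.+1 := \row_i on_letters (t ^+ n) (fun=> t^-1) (fun=> t^-1) i.

Lemma det_scaling t : t != 0 -> \det (diag_mx (scaling t)) = 1.
Proof.
move=> t0; rewrite det_diag big_ord_recl mxE on_y big_split_ord /=.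
rewrite (eq_bigr (fun=> t^-1)) => [|a _]; last by rewrite mxE on_w.
rewrite [X in _ * (_ * X)](eq_bigr (fun=> t^-1)) => [|a _]; last by rewrite mxE on_w'.
by rewrite !prodr_const !card_ord -exprD exprVn divff // expf_neq0.
Qed.

Lemma scaling_monomial t (e : Mon n.+1 m) : t != 0 ->
  \prod_i scaling t 0 i ^+ expo e i * t ^+ m = t ^+ (n.+1 * expo e (vy l)).
Proof.
move=> t0; rewrite big_ord_recl mxE on_y big_split_ord /=.
rewrite (eq_bigr (fun a => t^-1 ^+ expo e (vw a))) => [|a _]; last by rewrite mxE on_w.
rewrite [X in _ * (_ * X)](eq_bigr (fun b => t^-1 ^+ expo e (vw' b))) => [|a _]; last by rewrite mxE on_w'.
rewrite -!expr_sum -exprD -exprM exprVn.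
have -> : t ^+ m = t ^+ (expo e (vy l) + (\sum_a expo e (vw a) + \sum_b expo e (vw' b))).
  by rewrite -[in LHS](sum_expo e) sum_letters.
rewrite [X in _ * X]exprD mulrACA mulVf ?expf_neq0 // mulr1 -exprD.
by congr (_ ^+ _); rewrite mulSn addnC.
Qed.

(** The order is the y-exponent plus twice the w'-degree, so an odd order forces a letter y; a
    nonzero minor realises the orders of all rows. *)
Lemma y_degree_bound kappa : minor E kappa != 0 ->
  (2 * l * j.+1 <= \sum_i expo (kappa i) (vy l))%N.
Proof.
move=> /minor_orders [s Hs]; rewrite -(sum_odd_rows k j) big_enum_val.
rewrite [X in (_ <= X)%N](reindex_inj (@perm_inj _ s)); apply: leq_sum => i _.
by rewrite -[val _]/(nat_of_ord _) -Hs order0E; lia.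
Qed.

Lemma unstable_high_genus : (j < k)%N -> ~ hilbert_point_semistable m B.
Proof.
move=> jk ss; apply: (ss _ _ restriction_exists).
(* The exponent of t acquired by the minor f: each letter y brings t^g and each monomial loses t^m.
   By [u0] the subtraction is not truncated, and is positive, when the minor is nonzero. *)
pose u (f : {ffun 'I_L -> Mon n.+1 m}) := (n.+1 * (\sum_i expo (f i) (vy l)) - m * L)%N.
pose coef f (kappa : {ffun 'I_L -> Mon n.+1 m}) :=
  minor E f * \prod_i symcoef (invmx Q) (f i) (kappa i).
have u0 f : minor E f != 0 -> (m * L < n.+1 * (\sum_i expo (f i) (vy l)))%N.
  move=> /y_degree_bound H; apply: (@leq_trans (n.+1 * (2 * l * j.+1))); last first.
    by rewrite leq_mul2l H orbT.
  by rewrite card_row_sector mulnCA [X in (_ < X)%N]mulnCA ltn_pmul2l //; nia.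
apply: (@zero_in_orbit_closure_curve _ _ _ _
  (fun kappa => if increasing kappa then \sum_f coef f kappa *: 'X^(u f) else 0)).
  move=> kappa; case: ifP => _; last by rewrite horner0.
  rewrite horner_sum big1 // => f _; rewrite hornerZ hornerXn expr0n /coef.
  have [->|/u0 H] := eqVneq (minor E f) 0; first by rewrite !mul0r.
  by rewrite (_ : u f == 0%N = false) ?mulr0 //; rewrite /u; lia.
move=> t t0; exists (invmx Q *m (diag_mx (scaling t) *m Q)).
  by rewrite !det_mulmx det_scaling // mul1r -det_mulmx mulVmx // det1.
move=> kappa; rewrite /pluecker; case: ifP => _; last by rewrite horner0.
rewrite -/(minor _ kappa) (eq_minor _ (actR_mul _ _ _)).
have RE : actR (diag_mx (scaling t) *m Q) (actR (invmx Q) E) =2 actR (diag_mx (scaling t)) E.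
  move=> i e; rewrite actR_mul; apply: eq_actR => i' e'.
  by rewrite -actR_mul mulmxV // actR1.
rewrite (eq_minor _ (eq_actR _ RE)) minor_actR horner_sum; apply: eq_bigr => f _.
rewrite minor_diag hornerZ hornerXn /coef.
have [->|/u0 H] := eqVneq (minor E f) 0; first by rewrite !mul0r.
rewrite mulrAC; congr (_ * _); apply: (mulIf (expf_neq0 (m * L) t0)).
rewrite -exprD subnK; last exact: ltnW.
have -> : t ^+ (m * L) = \prod_(i < L) t ^+ m by rewrite prodr_const card_ord exprM.
rewrite -big_split big_distrr /= expr_sum; apply: eq_bigr => i _.
exact: scaling_monomial.
Qed.

End Embedding.
End Genus.
End CharacteristicZero.

Theorem theorem5p1 (F : closedFieldType) (g m : nat) (B : 'I_g -> 'M[F]_(g.-1, 3)) :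
  [pchar F] =i pred0 -> odd g -> (5 <= g)%N -> (2 <= m)%N ->
  omega_basis B ->
  (hilbert_point_semistable m B <-> (g <= 2 * m + 1)%N).
Proof.
move=> char0 og g5 m2 hB.
have [k Ek] : exists k, g = (k.+2 + k.+2).+1 by exists (g./2 - 2)%N; lia.
have [j Ej] : exists j, m = j.+2 by exists (m - 2)%N; lia.
subst g m.
have [z zP] := prim_root_exists char0 (isT : (0 < k.+2)%N).
have [Q uQ WQ] := change_basis zP hB.
split=> [ss|le]; last by apply: (semistable_low_genus char0 zP uQ WQ); lia.
rewrite leqNgt; apply/negP => lt.
by apply: (unstable_high_genus char0 zP uQ WQ) ss; lia.
Qed.
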